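(* Let $E\to X$ be a holomorphic vector bundle over a complex manifold $X$, and let $h$ be a singular hermitian metric on $E$ that is negatively curved in the sense of Griffiths. Assume that $F:=\{\det h=0\}$ is a closed set, and assume furthermore that there exists an exhaustion of $F^c=X\setminus F$ by open sets $\{U_j\}$ such that $\det h>1/j$ on $U_j$. Then $\Theta^h=\bar\partial(h^{-1}\partial h)$ exists as a current on $F^c$.
   Context: A singular hermitian metric $h$ on a holomorphic vector bundle $E \to X$ is a measurable map from $X$ to the space of non-negative (finite, possibly degenerate) hermitian forms on the fibers of $E$. Such an $h$ is called negatively curved in the sense of Griffiths if, for every holomorphic section $u$ of $E$ over any open subset of $X$, the function $\|u\|_h^2$ is plurisubharmonic. In a local holomorphic frame of $E$, $h$ is represented by a hermitian-matrix-valued function, sections are column vectors, and $(s,t)_h = t^* h s$, $\|s\|_h^2=(s,s)_h$. The set $\{\det h=0\}$ does not depend on the frame; the inequalities $\det h>1/j$ are understood for the determinant of the matrix of $h$ in a fixed collection of holomorphic frames over open sets covering $X$. An exhaustion of $F^c$ by open sets $\{U_j\}$ is an increasing sequence $U_1\subseteq U_2\subseteq\cdots$ of open sets with union $F^c$. $\partial h$ is taken entrywise in the sense of distributions (it is known to have coefficients in $L^2_{loc}$), and $\theta^h:=h^{-1}\partial h$. That $\Theta^h=\bar\partial\theta^h$ exists as a current on $F^c$ means that, in local holomorphic frames over open subsets of $F^c$, the coefficients of $\theta^h$ are locally integrable, so that $\bar\partial\theta^h$ is entrywise defined as a current. *)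

(* Defs.v *)
From HB Require Import structures.
From mathcomp Require Import all_boot all_order all_algebra.
From mathcomp Require Import all_classical all_reals all_analysis.
From mathcomp Require Import complex.
Set Implicit Arguments.
Unset Strict Implicit.
Unset Printing Implicit Defensive.
Import Order.TTheory GRing.Theory Num.Theory numFieldNormedType.Exports.
Local Open Scope classical_set_scope.
Local Open Scope ring_scope.
Local Open Scope complex_scope.

(** Lebesgue measure on R^m, as the m-fold product of the library's measure
    on R, carried by tuples. *)

Section lebesgue_tuple.
Context {R : realType}.
Local Notation RB := (measurableTypeR R).

Section step.
Context (m : nat) (mu : {sigma_finite_measure set (m.-tuple RB) -> \bar R}).

Let cons (p : RB * m.-tuple RB) : m.+1.-tuple RB := [tuple of p.1 :: p.2].

Let mcons : measurable_fun setT cons.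
Proof. exact: measurable_cons measurable_fst measurable_snd. Qed.

Definition leb_step : set (m.+1.-tuple RB) -> \bar R :=
  pushforward (@lebesgue_measure R \x mu)%E cons.

Let leb0 : leb_step set0 = 0%E.
Proof. by rewrite /leb_step /pushforward preimage_set0 measure0. Qed.

Let leb_ge0 A : (0 <= leb_step A)%E.
Proof. exact: measure_ge0. Qed.

Let leb_sigma_additive : semi_sigma_additive leb_step.
Proof.
move=> F mF tF mUF; rewrite /leb_step /pushforward preimage_bigcup.
apply: measure_semi_sigma_additive.
- by move=> i; rewrite -[X in measurable X]setTI; exact: mcons.
- apply/trivIsetP => /= i j _ _ ij; rewrite -preimage_setI.
  by move/trivIsetP : tF => /(_ _ _ _ _ ij) ->//; rewrite preimage_set0.
- by rewrite -preimage_bigcup -[X in measurable X]setTI; exact: mcons.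
Qed.

HB.instance Definition _ := isMeasure.Build _ _ _ leb_step
  leb0 leb_ge0 leb_sigma_additive.

Let leb_sigma_finite : sigma_finite setT leb_step.
Proof.
have /sigma_finiteP[F [FT ndF Foo]] := sigma_finiteT (@lebesgue_measure R).
have /sigma_finiteP[G [GT ndG Goo]] := sigma_finiteT mu.
pose uncons (t : m.+1.-tuple RB) : RB * m.-tuple RB :=
  (thead t, [tuple of behead t]).
have muncons : measurable_fun setT uncons.
  by apply: measurable_fun_pair; [exact: measurable_tnth|exact: measurable_behead].
have consK p : uncons (cons p) = p.
  by case: p => a t; rewrite /uncons /cons theadE; congr pair; exact/val_inj.
exists (fun i => uncons @^-1` (F i `*` G i)).
  rewrite -preimage_bigcup (_ : \bigcup_i _ = setT) ?preimage_setT//.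
  rewrite -subTset => -[x y] _.
  have [i _ Fix] : (\bigcup_i F i) x by rewrite -FT.
  have [j _ Gjy] : (\bigcup_j G j) y by rewrite -GT.
  exists (maxn i j) => //; split => /=.
  - by move: x Fix; exact/subsetPset/ndF/leq_maxl.
  - by move: y Gjy; exact/subsetPset/ndG/leq_maxr.
move=> k; have [mF Fk] := Foo k; have [mG Gk] := Goo k; split.
  by rewrite -[X in measurable X]setTI; apply: muncons => //; exact: measurableX.
rewrite /leb_step /pushforward -comp_preimage.
rewrite (_ : uncons \o cons = id); last by apply/funext => p; exact: consK.
by rewrite preimage_id product_measure1E// lte_mul_pinfty// ge0_fin_numE.
Qed.

HB.instance Definition _ := Measure_isSigmaFinite.Build _ _ _ leb_step
  leb_sigma_finite.

End step.

Definition leb_nil : {sigma_finite_measure set (0.-tuple RB) -> \bar R} :=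
  \d_([tuple] : 0.-tuple RB).

Fixpoint leb (m : nat) : {sigma_finite_measure set (m.-tuple RB) -> \bar R} :=
  if m is m'.+1 then leb_step (leb m') else leb_nil.

End lebesgue_tuple.

(** The instances of the [numFieldType] topology are keyed on [K^o], not on the
    concrete [R[i]]; bundling C^n gives access to its topology. *)
Definition Cn (R : realType) (n : nat) : normedModType R[i] := 'rV[R[i]]_n.

(** C^n is identified with R^(n+n) by [toC]: the first n real coordinates are
    the real parts, the last n the imaginary parts. *)

Section distributions.
Context {R : realType}.

Definition row_of_tuple {m} (t : m.-tuple R) : 'rV[R]_m := \row_i tnth t i.

Definition toC {n} (x : 'rV[R]_(n + n)) : Cn R n :=
  \row_k (x ord0 (lshift n k) +i* x ord0 (rshift n k)).

Definition iter_partial {m} (s : seq 'I_m) (f : 'rV[R]_m -> R) : 'rV[R]_m -> R :=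
  foldr (fun i (g : 'rV[R]_m -> R) => 'D_(delta_mx ord0 i) g) f s.

Definition smooth {m} (f : 'rV[R]_m -> R) :=
  forall s : seq 'I_m, continuous (iter_partial s f) /\
    forall i x, derivable (iter_partial s f) x (delta_mx ord0 i).

(** Real-valued test functions suffice, complex-valued ones being their
    C-linear combinations. *)
Definition test_function_in {m} (K : set 'rV[R]_m) (phi : 'rV[R]_m -> R) :=
  smooth phi /\ forall x, ~ K x -> phi x = 0.

Definition test_function {m} (D : set 'rV[R]_m) (phi : 'rV[R]_m -> R) :=
  exists K, [/\ compact K, K `<=` D & test_function_in K phi].

Definition L1loc {m} (D : set 'rV[R]_m) (f : 'rV[R]_m -> R) :=
  forall K, compact K -> K `<=` D ->
    (leb m).-integrable (@row_of_tuple m @^-1` K)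
      (fun t => (f (row_of_tuple t))%:E).

Definition cL1loc {m} (D : set 'rV[R]_m) (f : 'rV[R]_m -> R[i]) :=
  L1loc D (fun x => complex.Re (f x)) /\ L1loc D (fun x => complex.Im (f x)).

Definition rint {m} (f : 'rV[R]_m -> R) : R :=
  Rintegral (leb m) setT (fun t => f (row_of_tuple t)).

Definition cint {m} (f : 'rV[R]_m -> R[i]) : R[i] :=
  rint (fun x => complex.Re (f x)) +i* rint (fun x => complex.Im (f x)).

Definition partial {m} (j : 'I_m) (f : 'rV[R]_m -> R) : 'rV[R]_m -> R :=
  'D_(delta_mx ord0 j) f.

Definition d_dz {n} (k : 'I_n) (phi : 'rV[R]_(n + n) -> R) x : R[i] :=
  (partial (lshift n k) phi x / 2) +i* - (partial (rshift n k) phi x / 2).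

Definition d_dzbar {n} (k : 'I_n) (phi : 'rV[R]_(n + n) -> R) x : R[i] :=
  (partial (lshift n k) phi x / 2) +i* (partial (rshift n k) phi x / 2).

(** [v] represents the distribution du/dz_k on [Omega]. *)
Definition distr_dz {n} (Omega : set (Cn R n)) (k : 'I_n)
    (u v : Cn R n -> R[i]) :=
  [/\ cL1loc (toC @^-1` Omega) (u \o toC),
      cL1loc (toC @^-1` Omega) (v \o toC) &
      forall phi, test_function (toC @^-1` Omega) phi ->
        cint (fun x => v (toC x) * (phi x)%:C)
        = - cint (fun x => u (toC x) * d_dz k phi x)].

Definition distribution_on {n} (Omega : set (Cn R n))
    (T : ('rV[R]_(n + n) -> R) -> R[i]) :=
  (forall (a : R) phi psi, test_function (toC @^-1` Omega) phi ->
     test_function (toC @^-1` Omega) psi ->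
     T (fun x => a * phi x + psi x) = a%:C * T phi + T psi) /\
  (forall K, compact K -> K `<=` toC @^-1` Omega ->
     exists (C : R) (N : nat), forall phi (B : R), test_function_in K phi ->
       (forall s, (size s <= N)%N -> forall x, `|iter_partial s phi x| <= B) ->
       `|T phi| <= (C * B)%:C).

(** [T] is the distributional derivative dv/dzbar_l on [Omega]. *)
Definition distr_dzbar {n} (Omega : set (Cn R n)) (l : 'I_n)
    (v : Cn R n -> R[i]) (T : ('rV[R]_(n + n) -> R) -> R[i]) :=
  distribution_on Omega T /\
  forall phi, test_function (toC @^-1` Omega) phi ->
    T phi = - cint (fun x => v (toC x) * d_dzbar l phi x).

(** Plurisubharmonic functions on an open subset of C^n: upper semicontinuous
    with values in [-oo, +oo[, and sub-mean-valued on every closed affine disc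
    {z + zeta w : |zeta| <= 1} contained in [Omega]. *)
Definition psh_Cn {n} (Omega : set (Cn R n)) (u : Cn R n -> \bar R) :=
  [/\ forall z, Omega z -> (u z < +oo)%E,
      forall z (a : R), Omega z -> (u z < a%:E)%E ->
        \forall w \near z, (u w < a%:E)%E &
      forall z w : Cn R n,
        (forall zeta : R[i], `|zeta| <= 1 -> Omega (z + zeta *: w)) ->
        ((2 * pi)%R%:E * u z <=
          \int[@lebesgue_measure R]_(t in `[0%R, (2 * pi)%R]%classic)
            u (z + (cos t +i* sin t) *: w)%R)%E].

End distributions.

Section manifolds.
Context {R : realType}.

(** [cinv] is only meaningful on the open set [cod]. *)
Record chart (X : topologicalType) (n : nat) := Chart {
  dom : set X;
  cmap : X -> Cn R n;
  cinv : Cn R n -> X;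
  dom_open : open dom;
  cod_open : open (cmap @` dom);
  cmapK : forall x, dom x -> cinv (cmap x) = x;
  cmap_continuous : {within dom, continuous cmap};
  cinv_continuous : {within cmap @` dom, continuous cinv} }.

(** Differentiability is over the field C, so it means holomorphy here. *)
Definition holo_transition {X n} (c d : chart X n) :=
  forall z, (cmap c @` (dom c `&` dom d)) z ->
    differentiable (cmap d \o cinv c) z.

Definition compatible {X n} (c d : chart X n) :=
  holo_transition c d /\ holo_transition d c.

Record complexManifold (n : nat) := ComplexManifold {
  msort :> topologicalType;
  m_hausdorff : hausdorff_space msort;
  m_countable : @second_countable msort;
  atlas : set (chart msort n);
  atlas_cover : forall x, exists2 c, atlas c & dom c x;
  atlas_compatible : forall c d, atlas c -> atlas d -> compatible c d;
  atlas_maximal : forall c, (forall d, atlas d -> compatible c d) -> atlas c }.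

Definition holo_on {n} (X : complexManifold n) (A : set X) (f : X -> R[i]) :=
  forall c, atlas c -> forall z, (cmap c @` (A `&` dom c)) z ->
    differentiable (f \o cinv c : Cn R n -> R[i]^o) z.

Definition psh_on {n} (X : complexManifold n) (A : set X) (u : X -> \bar R) :=
  forall c, atlas c -> psh_Cn (cmap c @` (A `&` dom c)) (u \o cinv c).

End manifolds.
Arguments complexManifold R n : clear implicits.

(** A bundle of rank r is a family of complex vector spaces with local frames
    whose domains cover X and whose transition matrices are holomorphic; its
    total space is the sigma-type of the fibres, trivialized by the frames. *)

Section bundles.
Context {R : realType}.

(** The values of [fvec] outside [fdom] are irrelevant. *)
Record local_frame {n} (X : complexManifold R n) (r : nat)
    (fib : X -> vectType R[i]) := LocalFrame {
  fdom : set X;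
  fvec : forall x, r.-tuple (fib x);
  fdom_open : open fdom;
  fbasis : forall x, fdom x -> basis_of fullv (fvec x) }.

Record holoVectorBundle {n} (X : complexManifold R n) (r : nat) :=
  HoloVectorBundle {
    fib : X -> vectType R[i];
    triv : set (local_frame r fib);
    triv_cover : forall x, exists2 e, triv e & fdom e x;
    triv_holo : forall e f, triv e -> triv f -> forall i j,
      holo_on (fdom e `&` fdom f)
        (fun x => coord (fvec e x) i (tnth (fvec f x) j)) }.

Context {n : nat} {X : complexManifold R n} {r : nat}.
Variable E : holoVectorBundle X r.

Definition holo_section (A : set X) (u : forall x, fib E x) :=
  forall e, triv e -> forall i,
    holo_on (A `&` fdom e) (fun x => coord (fvec e x) i (u x)).

Definition holo_frame (e : local_frame r (fib E)) :=
  forall i, holo_section (fdom e) (fun x => tnth (fvec e x) i).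

(** Normalized by (s,t) = t^* H s, sections being column vectors. *)
Definition form_mx (h : forall x, {hermitian_sym (fib E x) for @Num.conj R[i]})
    (e : local_frame r (fib E)) (x : X) : 'M[R[i]]_r :=
  \matrix_(i, j) h x (tnth (fvec e x) j) (tnth (fvec e x) i).

Definition borel_on (A : set X) (f : X -> R) :=
  forall B : set (measurableTypeR R), measurable B ->
    <<s @open X >> (A `&` f @^-1` B).

Record singularMetric := SingularMetric {
  mform : forall x, {hermitian_sym (fib E x) for @Num.conj R[i]};
  mform_ge0 : forall x (v : fib E x), 0 <= mform x v v;
  mform_measurable : forall e, holo_frame e -> forall i j,
    borel_on (fdom e) (fun x => complex.Re (form_mx mform e x i j)) /\
    borel_on (fdom e) (fun x => complex.Im (form_mx mform e x i j)) }.

Variable h : singularMetric.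

Definition norm2 (u : forall x, fib E x) (x : X) : R :=
  complex.Re (mform h x (u x) (u x)).

Definition griffiths_negative :=
  forall (A : set X) (u : forall x, fib E x), open A -> holo_section A u ->
    psh_on A (fun x => (norm2 u x)%:E).

Definition degeneracy_set : set X :=
  [set x | exists2 e, triv e & fdom e x /\ \det (form_mx (mform h) e x) = 0].

(** Theta = dbar (H^-1 dH) exists as a current on [V]. In every chart and
    every holomorphic frame over an open subset of [V]:
    - dH = \sum_k (G k) dz_k in the sense of distributions,
    - theta = \sum_k (H^-1 G k) dz_k has locally integrable coefficients,
    - Theta = \sum_(l, k) (Theta l k) dzbar_l /\ dz_k is the entrywise
      distributional dbar of theta. *)
Definition curvature_exists_on (V : set X) :=
  forall (c : chart X n) (e : local_frame r (fib E)),
    atlas c -> holo_frame e -> fdom e `<=` V ->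
    let Omega := cmap c @` (dom c `&` fdom e) in
    let H z := form_mx (mform h) e (cinv c z) in
    exists G : 'I_n -> Cn R n -> 'M[R[i]]_r,
      let theta k z := invmx (H z) *m G k z in
      [/\ forall k i j, distr_dz Omega k (fun z => H z i j) (fun z => G k z i j),
          forall k i j, cL1loc (toC @^-1` Omega) (fun x => theta k (toC x) i j) &
          exists Theta : 'I_n -> 'I_n -> 'I_r -> 'I_r ->
              ('rV[R]_(n + n) -> R) -> R[i],
            forall l k i j,
              distr_dzbar Omega l (fun z => theta k z i j) (Theta l k i j)].

End bundles.

(* Main.v *)
Require Import Defs.
From HB Require Import structures.
From mathcomp Require Import all_boot all_order all_algebra.
From mathcomp Require Import all_classical all_reals all_analysis.
From mathcomp Require Import perm complex measurable_realfun ring lra.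
Set Implicit Arguments.
Unset Strict Implicit.
Unset Printing Implicit Defensive.
Import Order.TTheory GRing.Theory Num.Theory numFieldNormedType.Exports.
Local Open Scope classical_set_scope.
Local Open Scope ring_scope.

(** For a holomorphic section [v], the function [u = |v|_h^2] is nonnegative and
    plurisubharmonic, which makes its first derivatives locally integrable.
    Indeed, for the average over a circle of radius [s] in a coordinate plane,
    [u(x) <= avg u(x + s w)] and [u >= 0] give
    [avg (u(x + s w) - u(x))^2 <= avg u(x + s w)^2 - u(x)^2], and testing this
    against a cutoff function bounds the left side by O(s^2) in L^1_loc. Hence
    the difference quotients [F_s(x) = (2 / s) avg (cos * u(x + s w))] are
    equi-integrable; they have a weak limit in L^1_loc, and by Taylor's formula
    for test functions this limit is the distributional derivative of [u].
    By polarization the entries of [h] have first derivatives in L^1_loc, and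
    they are locally bounded. Comparing frames multiplies [det h] by [|g|^2] with
    [g] holomorphic without zeros, so [det h > 1 / j] on [U_j] bounds [det h] below
    on compact subsets of the complement of [F]. There [h^-1] is bounded, so
    [h^-1 dh] is in L^1_loc and its [dbar] is a current. *)

(** * Weak limits of equi-integrable sequences *)

(** The delicate point is that [dh] must be a locally integrable function. A plain bound in L^1
    would let the difference quotients converge to a measure, whose product with [h^-1] need not be
    locally integrable; this is why a square is estimated. In the smooth case, u >= 0 and Delta u >=
    0 give Delta(u^2) >= 2 |grad u|^2, and integrating against a cutoff bounds the gradient in L^2.
    The variance inequality is this computation without any derivative of u, which is only upper
    semicontinuous. Circles are forced by the definition of plurisubharmonicity, whose mean value
    inequality is about complex discs. The weight cos extracts one real derivative: over the circle
    cos and cos * sin have mean 0 and cos^2 has mean 1/2, whence the factor 2 / s; exchanging cos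
    and sin gives the other derivative. Weak limits are taken along a single ultrafilter, so that
    the limits for all measurable sets and all boxes exist at once and no subsequence has to be
    extracted. *)

Lemma ultra_bounded_cvg (R : realType) (U : set_system nat) (u : nat -> R) (M : R) :
  UltraFilter U -> (\forall n \near U, `|u n| <= M) -> exists l : R, u @ U --> l.
Proof.
move=> UU uM.
have : (u @ U) [set` `[- M, M]].
  by apply: filterS uM => n; rewrite /= in_itv /= -ler_norml.
move=> /(@segment_compact R (- M) M (u @ U) _) [l [_ ul]].
exists l => B Bl; have [//|FnB] := in_ultra_setVsetC (u @^-1` B) UU.
by have [x []] := ul (~` B) B FnB Bl.
Qed.

Lemma Rintegral_sum d (T : measurableType d) (R : realType)
    (mu : {measure set T -> \bar R}) (D : set T) (I : Type) (r : seq I)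
    (f : I -> T -> R) : measurable D ->
  (forall i, mu.-integrable D (EFin \o f i)) ->
  (\int[mu]_(x in D) (\sum_(i <- r) f i x) = \sum_(i <- r) \int[mu]_(x in D) f i x)%R.
Proof.
move=> mD fi; elim: r => [|i r IH].
  rewrite big_nil (_ : (fun=> _) = cst 0) ?Rintegral_cst ?mul0r//.
  by apply/funext => x; rewrite big_nil.
rewrite big_cons -IH -RintegralD//.
  by apply: eq_Rintegral => x _; rewrite big_cons.
apply: (eq_integrable mD (fun x => \sum_(i <- r) (EFin \o f i) x)%E).
  by move=> x _; rewrite /= sumEFin.
exact: integrable_sum.
Qed.

Lemma cvgR_sum (R : realType) (T : Type) (U : set_system T) (UF : Filter U)
    (I : Type) (r : seq I) (f : I -> T -> R) (l : I -> R) :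
  (forall i, f i @ U --> l i) ->
  (fun x => \sum_(i <- r) f i x) @ U --> \sum_(i <- r) l i.
Proof.
move=> fl; elim: r => [|i r IH].
  rewrite big_nil (_ : (fun x => _) = cst 0); first exact: cvg_cst.
  by apply/funext => x; rewrite big_nil.
rewrite big_cons (_ : (fun x => _) = (fun x => f i x + \sum_(j <- r) f j x)).
  exact: cvgD.
by apply/funext => x; rewrite big_cons.
Qed.

Lemma le_Rintegral_subset d (T : measurableType d) (R : realType)
    (mu : {measure set T -> \bar R}) (A B : set T) (f : T -> R) :
  measurable A -> measurable B -> A `<=` B -> (forall x, 0 <= f x) ->
  mu.-integrable B (EFin \o f) ->
  \int[mu]_(x in A) f x <= \int[mu]_(x in B) f x.
Proof.
move=> mA mB AB f0 fi; rewrite fine_le//.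
- by apply: integrable_fin_num => //; exact: integrableS fi.
- exact: integrable_fin_num.
- apply: ge0_subset_integral => //; first exact: measurable_int fi.
  by move=> x _; rewrite lee_fin.
Qed.

Section quantization.
Context d (T : measurableType d) (R : realType) (mu : {measure set T -> \bar R}).

Lemma integrable_scale (D : set T) (c : R) (f : T -> R) : measurable D ->
  mu.-integrable D (EFin \o f) -> mu.-integrable D (EFin \o (fun x => c * f x)).
Proof. by move=> mD; exact: integrableZl. Qed.

Lemma integrable_bounded_mul (D : set T) (phi G : T -> R) (M : R) : measurable D ->
  measurable_fun D phi -> (forall x, D x -> `|phi x| <= M) ->
  mu.-integrable D (EFin \o G) -> mu.-integrable D (EFin \o (fun x => phi x * G x)).
Proof.
move=> mD mphi phiM iG.
apply: (eq_integrable mD ((EFin \o phi) \* (EFin \o G))%E) => //.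
apply: integrableMr => //; exists M; split; first exact: num_real.
by move=> y My x Dx; apply: le_trans (phiM _ Dx) (ltW My).
Qed.

Lemma normr_Rintegral_mul_le (D : set T) (phi G : T -> R) (M : R) : measurable D ->
  measurable_fun D phi -> (forall x, D x -> `|phi x| <= M) ->
  mu.-integrable D (EFin \o G) ->
  `|\int[mu]_(x in D) (phi x * G x)| <= M * \int[mu]_(x in D) `|G x|.
Proof.
move=> mD mphi phiM iG.
have ipG := integrable_bounded_mul mD mphi phiM iG.
apply: (le_trans (le_normr_Rintegral mD ipG)).
rewrite -RintegralZl//; last exact: integrable_norm.
apply: le_Rintegral => //.
- exact: (@integrable_norm _ _ _ _ D (fun x => phi x * G x)).
- by apply: integrable_scale => //; exact: integrable_norm.
- by move=> x Dx; rewrite normrM ler_wpM2r// phiM.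
Qed.

(* A bounded function is a uniform limit of step functions with finitely many
   values, here written as a combination of indicators. *)
Lemma quantization (D : set T) (phi : T -> R) (M delta : R) : measurable D ->
  0 < delta -> measurable_fun setT phi -> (forall x, `|phi x| <= M) ->
  exists K (a : 'I_K -> R) (A : 'I_K -> set T),
    (forall k, measurable (A k)) /\
    forall G : T -> R, mu.-integrable D (EFin \o G) ->
    `|\int[mu]_(x in D) (phi x * G x) -
      \sum_(k < K) a k * \int[mu]_(x in D `&` A k) G x| <=
    delta * \int[mu]_(x in D) `|G x|.
Proof.
move=> mD d0 mphi phiM.
pose q x := Num.truncn ((phi x + M) / delta).
have pM0 x : 0 <= phi x + M.
  by rewrite -lerBlDr sub0r; have /ler_normlP[+ _] := phiM x; rewrite lerNl.
pose N := (Num.truncn ((M + M) / delta)).+1.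
pose A (k : 'I_N) := [set x | q x = k].
pose a (k : 'I_N) := k%:R * delta - M.
have qN x : (q x < N)%N.
  rewrite ltnS; apply: le_truncn; rewrite ler_pM2r ?invr_gt0// lerD2r.
  by rewrite (le_trans (ler_norm _)).
have mA k : measurable (A k).
  have -> : A k = phi @^-1` `[a k, a k + delta[.
    apply/seteqP; split => x /=; rewrite /A /= /a in_itv/=.
      move=> <-; have /andP[h1 h2] := truncn_itv (divr_ge0 (pM0 x) (ltW d0)).
      move: h1 h2; rewrite -/(q x) ler_pdivlMr// ltr_pdivrMr// -natr1 mulrDl mul1r => h1 h2.
      by apply/andP; split; lra.
    move=> /andP[h1 h2]; apply: truncn_def; rewrite ler_pdivlMr// ltr_pdivrMr// -natr1 mulrDl mul1r.
    by apply/andP; split; lra.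
  by rewrite -[X in measurable X]setTI; exact: mphi.
exists N, a, A; split=> // G iG.
pose psi x := \sum_(k < N) a k * \1_(A k) x.
have psiE x : psi x = a (Ordinal (qN x)).
  rewrite /psi (bigD1 (Ordinal (qN x)))//= big1 ?addr0.
    by rewrite indicE mem_set ?mulr1.
  move=> k kq; rewrite indicE memNset ?mulr0// /A/= => e.
  by move/eqP: kq; apply; apply/val_inj.
have iAG k : mu.-integrable D (EFin \o (fun x => \1_(A k) x * G x)).
  apply: (@integrable_bounded_mul _ _ _ 1) => // x _.
  by rewrite indicE; case: (_ \in _); rewrite ?normr1 ?normr0.
have -> : \sum_(k < N) a k * \int[mu]_(x in D `&` A k) G x =
    \int[mu]_(x in D) (psi x * G x).
  transitivity (\int[mu]_(x in D) (\sum_(k < N) (a k * (\1_(A k) x * G x)))).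
    rewrite Rintegral_sum//; last first.
      by move=> k; exact: integrable_scale.
    apply: eq_bigr => k _; rewrite RintegralZl//; congr (_ * _).
    rewrite Rintegral_mkcondr; apply: eq_Rintegral => x _.
    by rewrite patchE indicE; case: (x \in A k); rewrite ?mul1r ?mul0r.
  by apply: eq_Rintegral => x _; rewrite /psi mulr_suml; apply: eq_bigr => k _; rewrite mulrA.
have mpsi : measurable_fun D psi.
  by apply: measurable_sum => k; apply: measurable_funM => //; exact: measurable_indic.
have dpsi x : `|phi x - psi x| <= delta.
  rewrite psiE /a /=.
  have /andP[] := truncn_itv (divr_ge0 (pM0 x) (ltW d0)).
  rewrite -/(q x) ler_pdivlMr// ltr_pdivrMr// -natr1 mulrDl mul1r => h1 h2.
  by rewrite ler_norml; apply/andP; split; lra.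
have psib x : `|psi x| <= M + delta.
  have := phiM x; have := dpsi x; rewrite !ler_norml => /andP[? ?] /andP[? ?].
  by apply/andP; split; lra.
rewrite -RintegralB//.
- rewrite (_ : (fun x => _) = (fun x => (phi x - psi x) * G x)); last first.
    by apply/funext => x; rewrite mulrBl.
  apply: normr_Rintegral_mul_le => //; apply: measurable_funB => //.
  exact: measurable_funTS.
- by apply: (@integrable_bounded_mul _ _ _ M) => //; exact: measurable_funTS.
- by apply: (@integrable_bounded_mul _ _ _ (M + delta)) => //.
Qed.

End quantization.

(* Dunford-Pettis: along an ultrafilter the set functions [A |-> \int_A F n]
   always converge; equi-integrability makes the limit countably additive and
   absolutely continuous, and its Radon-Nikodym density is the weak limit. *)
Section weak_compactness.
Context d (T : measurableType d) (R : realType)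
  (mu : {sigma_finite_measure set T -> \bar R}).
Variables (U : set_system nat) (D : set T) (F : nat -> T -> R) (C : R).
Hypotheses (UU : UltraFilter U) (mD : measurable D) (Doo : (mu D < +oo)%E).
Hypothesis Fint : U [set n | mu.-integrable D (EFin \o F n)].
(** Equi-integrability in the form that AM-GM delivers: a small [e] is chosen first, then [mu A]
    small compared with [e]. *)
Hypothesis equi : U [set n | forall A (e : R), measurable A -> A `<=` D -> 0 < e ->
  \int[mu]_(x in A) `|F n x| <= e * C + fine (mu A) / e].

Let muS A : measurable A -> A `<=` D -> (mu A < +oo)%E.
Proof. by move=> mA AD; apply: le_lt_trans Doo; rewrite le_measure ?inE. Qed.

Let M := C + fine (mu D).

Let FM : U [set n | mu.-integrable D (EFin \o F n) /\
  \int[mu]_(x in D) `|F n x| <= M].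
Proof.
apply: filterS2 Fint equi => n In /(_ D 1 mD (@subset_refl _ D) ltr01).
by rewrite mul1r divr1 => ?; split.
Qed.

Let M0 : 0 <= M.
Proof.
have [n [_ h]] := filter_ex FM.
by apply: le_trans h; apply: Rintegral_ge0.
Qed.

Let setfun_cvg A : measurable A ->
  exists l : R, (fun n => \int[mu]_(x in A `&` D) F n x) @ U --> l.
Proof.
move=> mA; apply: (@ultra_bounded_cvg R U _ M) => //.
apply: filterS FM => n [In FnM].
have IA : mu.-integrable (A `&` D) (EFin \o F n).
  by apply: integrableS In => //; exact: measurableI.
apply: le_trans FnM; apply: le_trans (le_normr_Rintegral _ IA) _.
  exact: measurableI.
apply: le_Rintegral_subset => //; first exact: measurableI.
exact: integrable_norm.
Qed.

Let nu (A : set T) : R := lim ((fun n => \int[mu]_(x in A `&` D) F n x) @ U).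

Let nuP A : measurable A ->
  (fun n => \int[mu]_(x in A `&` D) F n x) @ U --> nu A.
Proof. by move=> /setfun_cvg[l hl]; apply/cvg_ex; exists l. Qed.

Let nu_le A (e : R) : measurable A -> 0 < e -> `|nu A| <= e * C + fine (mu (A `&` D)) / e.
Proof.
move=> mA e0; have mAD := measurableI _ _ mA mD.
apply: (@closed_cvg _ _ U _ _ (fun y : R => `|y| <= e * C + fine (mu (A `&` D)) / e) _ _ _ (nuP mA)).
  rewrite (_ : (fun y => _) = Num.norm @^-1` [set y | y <= e * C + fine (mu (A `&` D)) / e]) //.
  apply: closed_comp; last exact: closed_le.
  by move=> ? _; exact: norm_continuous.
apply: filterS2 equi Fint => n h In.
apply: le_trans (h _ _ mAD (@subIsetr _ _ _) e0).
by apply: le_normr_Rintegral => //; exact: integrableS In.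
Qed.

Let nuU A B : measurable A -> measurable B -> A `&` B = set0 ->
  nu (A `|` B) = nu A + nu B.
Proof.
move=> mA mB AB; have mAB := measurableU _ _ mA mB.
apply: (cvg_unique _ (nuP mAB)) => //.
rewrite /=; apply: (@cvg_trans _ (\int[mu]_(x in A `&` D) F n x + \int[mu]_(x in B `&` D) F n x @[n --> U])); last by apply: cvgD; exact: nuP.
apply: near_eq_cvg; apply: filterS Fint => n In.
rewrite /= setIUl Rintegral_setU//.
- exact: measurableI.
- exact: measurableI.
- by apply: integrableS In => //; [apply: measurableU; exact: measurableI|move=> x [] []].
- by apply/disj_setPS => x [[Ax _] [Bx _]]; have : (A `&` B) x by []; rewrite AB.
Qed.

Let nu0 : nu set0 = 0.
Proof. by have := nuU measurable0 measurable0 (setI0 _); rewrite setU0 => /eqP; rewrite -subr_eq0 opprD addNKr oppr_eq0 => /eqP. Qed.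

Let nuID A : nu (A `&` D) = nu A.
Proof. by rewrite /nu -setIA setIid. Qed.

Let nu_sigma : semi_sigma_additive (fun A => (nu A)%:E).
Proof.
move=> B mB tB mUB.
pose tail n := \bigcup_(i in [set i | (n <= i)%N]) B i.
have mtail n : measurable (tail n) by apply: bigcup_measurable.
have head n : nu (\bigcup_i B i) = \sum_(0 <= i < n) nu (B i) + nu (tail n).
  elim: n => [|n ->].
    by rewrite big_geq// add0r; congr nu; apply: eq_bigcupl; split.
  rewrite big_nat_recr//= -addrA; congr (_ + _); rewrite -nuU//.
    congr nu; apply/seteqP; split => x.
      move=> [i /=]; rewrite leq_eqVlt => /predU1P[<-|ni] Bx; [by left|].
      by right; exists i.
    by move=> [Bx|[i /= ni Bx]]; [exists n => /=|exists i => //=; exact: ltnW].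
  apply/seteqP; split => // x [Bx [i /= ni Bix]].
  have := tB n i Logic.I Logic.I (ex_intro _ x (conj Bx Bix)).
  by move=> e; move: ni; rewrite e ltnn.
(* The [B i] are disjoint, so their tails decrease to the empty set, and [mu D] is finite. *)
have mut : fine (mu (tail n `&` D)) @[n --> \oo] --> 0.
  have : mu (tail n `&` D) @[n --> \oo] --> mu (\bigcap_n (tail n `&` D)).
    apply: nonincreasing_cvg_mu => //.
    - exact: muS (measurableI _ _ (mtail _) mD) (@subIsetr _ _ _).
    - by move=> n; exact: measurableI.
    - by apply: bigcap_measurable => // n _; exact: measurableI.
    - move=> m n mn; apply/subsetPset => x [[i /= ni Bx] Dx]; split => //.
      by exists i => //=; exact: leq_trans ni.
  rewrite (_ : \bigcap_n _ = set0) ?measure0; first exact: fine_cvg.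
  apply/seteqP; split => // x h; have [[i _ Bx] _] := h 0%N Logic.I.
  have [[j /= ij Bjx] _] := h i.+1 Logic.I.
  have := tB i j Logic.I Logic.I (ex_intro _ x (conj Bx Bjx)).
  by move=> e; move: ij; rewrite e ltnn.
have nut : nu (tail n) @[n --> \oo] --> 0.
  apply/cvgrPdist_le => eps eps0.
  have C1 : 0 < `|C| + 1 by rewrite ltr_wpDl.
  (* With this [e] the term [e * C] costs at most [eps / 2]; the measure of the tail is then made
     small relative to [e]. *)
  pose e := eps / 2 / (`|C| + 1).
  have e0 : 0 < e by rewrite !divr_gt0.
  have /cvgrPdist_le/(_ (eps / 2 * e)) := mut.
  rewrite mulr_gt0 ?divr_gt0// => /(_ isT); apply: filterS => n.
  rewrite !sub0r !normrN => h; apply: le_trans (nu_le (mtail n) e0) _.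
  have eC : e * C <= eps / 2.
    rewrite /e mulrAC ler_pdivrMr// ler_pM2l ?divr_gt0//.
    by rewrite (le_trans (ler_norm _))// lerDl.
  have : fine (mu (tail n `&` D)) / e <= eps / 2.
    by rewrite ler_pdivrMr// (le_trans (ler_norm _)).
  by move: eC => /[swap]; lra.
rewrite (_ : (fun n => _) = EFin \o (fun n => nu (\bigcup_i B i) - nu (tail n))); last first.
  by apply/funext => n; rewrite /= (head n) addrK sumEFin.
apply: cvg_EFin; first by near=> n.
rewrite -[X in _ --> X]subr0; apply: cvgB => //; exact: cvg_cst.
Unshelve. all: by end_near. Qed.

Lemma weak_compactness : exists v : T -> R,
  mu.-integrable setT (EFin \o v) /\
  forall (phi : T -> R) (M' : R), measurable_fun setT phi -> (forall x, `|phi x| <= M') ->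
  (fun n => \int[mu]_(x in D) (phi x * F n x)) @ U -->
  \int[mu]_(x in D) (phi x * v x).
Proof.
have nufin A : measurable A -> (nu A)%:E \is a fin_num by [].
pose Q : {charge set T -> \bar R} := HB.pack (fun A => (nu A)%:E)
  (isCharge.Build _ _ _ (fun A => (nu A)%:E) (congr1 EFin nu0) nufin nu_sigma).
(* On a null set [nu_le] leaves only [e * C], for every [e > 0]. *)
have Qmu : Q `<< mu.
  apply/null_content_dominatesP => A mA muA; congr EFin.
  have muAD : mu (A `&` D) = 0%E.
    by apply: subset_measure0 muA => //; exact: measurableI.
  apply/eqP; rewrite -normr_eq0 eq_le normr_ge0 andbT.
  apply/ler_addgt0Pl => eps eps0; rewrite addr0.
  have C1 : 0 < `|C| + 1 by rewrite ltr_wpDl.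
  have e0 : 0 < eps / (`|C| + 1) by rewrite divr_gt0.
  apply: le_trans (nu_le mA e0) _; rewrite muAD mul0r addr0.
  rewrite mulrAC ler_pdivrMr// ler_pM2l//.
  by rewrite (le_trans (ler_norm _))// lerDl.
pose v x := fine ((Radon_Nikodym Q mu) x).
have vE x : (v x)%:E = (Radon_Nikodym Q mu) x.
  by rewrite fineK//; exact: Radon_Nikodym_fin_num.
have iv : mu.-integrable setT (EFin \o v).
  apply: (eq_integrable measurableT (Radon_Nikodym Q mu)); last exact: Radon_Nikodym_integrable.
  by move=> x _; rewrite /= vE.
have nuv A : measurable A -> nu A = \int[mu]_(x in A) v x.
  move=> mA; rewrite /Rintegral -[nu A]/(fine (Q A)) (Radon_Nikodym_integral Qmu mA).
  by congr fine; apply: eq_integral => x _; rewrite vE.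
have ivD : mu.-integrable D (EFin \o v) by exact: integrableS iv.
exists v; split => // phi M' mphi phiM; apply/cvgrPdist_le => eps eps0.
pose L := \int[mu]_(x in D) `|v x|.
have L0 : 0 <= L by apply: Rintegral_ge0.
have ML : 0 < M + L + 1 by rewrite ltr_wpDl// addr_ge0.
(* Quantizing [phi] costs at most [delta * M] for [F n] and [delta * L] for [v]. The step function
   that remains has finitely many values, so convergence on each set [A k] is enough. *)
pose delta := eps / 2 / (M + L + 1).
have d0 : 0 < delta by rewrite !divr_gt0.
have [K [a [A [mA hA]]]] := quantization mu mD d0 mphi phiM.
have : (fun n => \sum_(k < K) a k * \int[mu]_(x in D `&` A k) F n x) @ U -->
    \sum_(k < K) a k * \int[mu]_(x in D `&` A k) v x.
  apply: (@cvgR_sum _ _ U _ _ _ (fun k n => a k * \int[mu]_(x in D `&` A k) F n x)) => k; apply: cvgMr.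
  rewrite setIC -nuv; last exact: measurableI.
  by rewrite nuID; exact: nuP.
move/cvgrPdist_le => /(_ (eps / 2)); rewrite divr_gt0// => /(_ isT).
move=> h; apply: filterS2 h FM => n h [In FnM].
have h1 := hA _ ivD; have h2 := hA _ In.
have : delta * M + delta * L <= eps / 2.
  rewrite -mulrDr /delta mulrAC ler_pdivrMr// ler_pM2l ?divr_gt0//.
  by rewrite lerDl.
have : delta * \int[mu]_(x in D) `|F n x| <= delta * M by rewrite ler_pM2l.
rewrite -/L in h1; move: h h1 h2; rewrite !ler_norml.
by move=> /andP[? ?] /andP[? ?] /andP[? ?] ? ?; apply/andP; split; lra.
Qed.

End weak_compactness.

(** * Lebesgue measure on R^m *)

Section box.
Context {R : realType} {m : nat}.
Implicit Types (x c v : 'rV[R]_m) (r s : R).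

(** For [r > 0] the ball of the sup norm; the coordinatewise form pulls back to tuples as a finite
    intersection of slabs. *)
Definition box c r : set 'rV[R]_m := [set x | forall i, `|x ord0 i - c ord0 i| < r].

Lemma box_ball c r : 0 < r -> box c r = ball c r.
Proof.
move=> r0; apply/seteqP; split => x h.
  by split => // i j; rewrite (ord1 i) /ball/= distrC; exact: h.
by move=> i; rewrite distrC; have [_ /(_ ord0 i)] := h.
Qed.

Lemma nbhs_box x r : 0 < r -> nbhs x (box x r).
Proof. by move=> r0; rewrite box_ball//; exact: nbhsx_ballx. Qed.

Lemma nbhs_boxP x (A : set 'rV[R]_m) : nbhs x A -> exists2 r, 0 < r & box x r `<=` A.
Proof.
by move=> /nbhs_ballP[r /= r0 h]; exists r => //; rewrite box_ball.
Qed.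

Lemma box_open c r : 0 < r -> open (box c r).
Proof. by move=> r0; rewrite box_ball//; exact: ball_open. Qed.

Lemma box_center c r : 0 < r -> box c r c.
Proof. by move=> r0 i; rewrite subrr normr0. Qed.

Lemma box_trans c x y r s : box c r x -> box x s y -> box c (r + s) y.
Proof.
move=> h1 h2 i; rewrite -(subrKA (x ord0 i)); apply: le_lt_trans (ler_normD _ _) _.
by rewrite [r + s]addrC ltrD.
Qed.

Lemma box_subset c r s : r <= s -> box c r `<=` box c s.
Proof. by move=> rs x h i; exact: lt_le_trans (h i) rs. Qed.

End box.

Section lebesgue_translation.
Context {R : realType}.
Local Notation RB := (measurableTypeR R).
Local Open Scope ereal_scope.

Lemma lebesgue_measure_translate (a : R) (A : set R) : measurable A ->
  pushforward (@lebesgue_measure R) ((fun x => x + a)%R : RB -> RB) A = lebesgue_measure A.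
Proof.
move=> mA; apply/esym.
have ma : measurable_fun setT ((fun x => x + a)%R : RB -> RB).
  by apply: measurable_funD => //; exact: measurable_id.
apply: (lebesgue_measure_unique (mu := pushforward (@lebesgue_measure R) ((fun x => x + a)%R : RB -> RB))) => //= _ [[b c]] _ <-.
rewrite /pushforward (_ : _ @^-1` _ = `](b - a)%R, (c - a)%R]%classic).
  by rewrite !lebesgue_measure_itv/= !lte_fin ltrD2r -!EFinB; case: ifP => // _; congr (_%:E); lra.
by apply/seteqP; split => x /=; rewrite !in_itv/= ltrBlDr lerBrDr.
Qed.

Lemma ge0_integral_translate (a : R) (F : R -> \bar R) : measurable_fun setT F ->
  (forall x, 0 <= F x) ->
  \int[@lebesgue_measure R]_x F (x + a)%R = \int[@lebesgue_measure R]_x F x.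
Proof.
move=> mF F0.
have ma : measurable_fun setT ((fun x => x + a)%R : RB -> RB).
  by apply: measurable_funD => //; exact: measurable_id.
have := @ge0_integral_pushforward _ _ RB RB R _ ma (@lebesgue_measure R) setT F measurableT mF.
rewrite preimage_setT /= => <-; last by move=> ? _; exact: F0.
by apply: eq_measure_integral => A mA _; exact: lebesgue_measure_translate.
Qed.

Definition tadd {m} (t : m.-tuple R) (v : 'I_m -> R) : m.-tuple R :=
  [tuple (tnth t i + v i)%R | i < m].

Let cons m (p : R * m.-tuple R) : m.+1.-tuple R := [tuple of p.1 :: p.2].

Let mcons m : measurable_fun [set: RB * m.-tuple RB] (@cons m : RB * m.-tuple RB -> m.+1.-tuple RB).
Proof. exact: measurable_cons measurable_fst measurable_snd. Qed.

Lemma ge0_integral_leb_step m (mu : {sigma_finite_measure set (m.-tuple RB) -> \bar R})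
    (F : m.+1.-tuple RB -> \bar R) : measurable_fun setT F -> (forall t, 0 <= F t) ->
  \int[leb_step mu]_t F t =
  \int[@lebesgue_measure R]_x \int[mu]_t F (cons (x, t)).
Proof.
move=> mF F0.
have := @ge0_integral_pushforward _ _ _ _ R _ (@mcons m) (@lebesgue_measure R \x mu) setT F measurableT mF.
rewrite preimage_setT /= => h.
transitivity (\int[@lebesgue_measure R \x mu]_x (F \o @cons m) x).
  by rewrite -h//= => ? _; exact: F0.
have mFc := measurableT_comp mF (@mcons m).
by rewrite (fubini_tonelli1 _ mFc)// => ?; exact: F0.
Qed.

Lemma measurable_tadd m (v : 'I_m -> R) :
  measurable_fun setT ((fun t => tadd t v) : m.-tuple RB -> m.-tuple RB).
Proof.
apply/measurable_fun_tnthP => i.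
rewrite (_ : _ \o _ = fun t => (tnth t i + v i)%R).
  by apply: measurable_funD => //; exact: measurable_tnth.
by apply/funext => t /=; rewrite tnth_mktuple.
Qed.

(** Tonelli peels off the first coordinate, which is translated on the line. *)
Lemma ge0_integral_leb_translate m (v : 'I_m -> R) (F : m.-tuple RB -> \bar R) :
  measurable_fun setT F -> (forall t, 0 <= F t) ->
  \int[leb m]_t F (tadd t v) = \int[leb m]_t F t.
Proof.
elim: m => [|m IH] in v F *; move=> mF F0.
  by apply: eq_integral => t _; rewrite (tuple0 (tadd t v)) (tuple0 t).
have mFv : measurable_fun setT (fun t : m.+1.-tuple RB => F (tadd t v)).
  exact: measurableT_comp mF (@measurable_tadd m.+1 v).
rewrite [LHS]ge0_integral_leb_step// [RHS]ge0_integral_leb_step//.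
have mFc := measurableT_comp mF (@mcons m).
rewrite -[RHS](ge0_integral_translate (v ord0)).
- apply: eq_integral => x _.
  rewrite -[RHS](IH (fun i => v (lift ord0 i))).
  + apply: eq_integral => t _; congr F; apply: eq_from_tnth => i.
    rewrite tnth_mktuple; case: (unliftP ord0 i) => [j ->|->].
      by rewrite !tnthS tnth_mktuple.
    by rewrite !tnth0.
  + exact: (measurableT_comp mFc (pair1_measurable _)).
  + by move=> t; exact: F0.
- exact: (measurable_fun_fubini_tonelli_F (m2 := leb m) _ mFc (fun _ => F0 _)).
- by move=> x; apply: integral_ge0 => t _; exact: F0.
Qed.

Lemma integral_leb_translate m (v : 'I_m -> R) (F : m.-tuple RB -> \bar R) :
  measurable_fun setT F ->
  \int[leb m]_t F (tadd t v) = \int[leb m]_t F t.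
Proof.
move=> mF; rewrite integralE [RHS]integralE.
congr (_ - _).
  rewrite -[RHS](ge0_integral_leb_translate v (measurable_funepos mF)).
    by apply: eq_integral => t _; rewrite !funeposE.
  by move=> t; exact: funepos_ge0.
rewrite -[RHS](ge0_integral_leb_translate v (measurable_funeneg mF)).
  by apply: eq_integral => t _; rewrite !funenegE.
by move=> t; exact: funeneg_ge0.
Qed.

End lebesgue_translation.

Section rows.
Context {R : realType} {m : nat}.
Local Notation RB := (measurableTypeR R).
Implicit Types (x c v : 'rV[R]_m) (r s : R) (t : m.-tuple RB).

Definition tuple_of_row x : m.-tuple R := [tuple x ord0 i | i < m].

Lemma tuple_of_rowK x : row_of_tuple (tuple_of_row x) = x.
Proof. by apply/rowP => i; rewrite mxE tnth_mktuple. Qed.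

Lemma row_of_tupleK t : tuple_of_row (row_of_tuple t) = t.
Proof. by apply: eq_from_tnth => i; rewrite tnth_mktuple mxE. Qed.

Lemma row_of_tuple_tadd t v : row_of_tuple (tadd t (v ord0)) = row_of_tuple t + v.
Proof. by apply/rowP => i; rewrite !mxE tnth_mktuple. Qed.

(** Topology and derivatives are used on row vectors, the measure on tuples. A function of rows is
    therefore measured through [row_of_tuple], and a map into rows through its coordinates. *)
Lemma measurable_row_comp d (Y : measurableType d) d' (Z : measurableType d')
    (F : 'rV[R]_m -> Z) (w : Y -> 'rV[R]_m) :
  measurable_fun [set: m.-tuple RB] (F \o @row_of_tuple R m) ->
  (forall i, measurable_fun [set: Y] ((fun y => w y ord0 i) : Y -> RB)) ->
  measurable_fun [set: Y] (F \o w).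
Proof.
move=> mF mw.
rewrite (_ : F \o w = (F \o @row_of_tuple R m) \o (tuple_of_row \o w)); last first.
  by apply/funext => y /=; rewrite tuple_of_rowK.
apply: (measurableT_comp mF); apply/measurable_fun_tnthP => i.
rewrite (_ : _ \o _ = (fun y => w y ord0 i))//.
by apply/funext => y /=; rewrite tnth_mktuple.
Qed.

Lemma integral_row_translate (F : 'rV[R]_m -> \bar R) v :
  measurable_fun [set: m.-tuple RB] (F \o @row_of_tuple R m) ->
  (\int[leb m]_t F (row_of_tuple t + v)%R = \int[leb m]_t F (row_of_tuple t))%E.
Proof.
move=> mF; rewrite -(integral_leb_translate (v ord0) mF).
by apply: eq_integral => t _ /=; rewrite row_of_tuple_tadd.
Qed.

Lemma measurable_box c r : measurable (@row_of_tuple R m @^-1` box c r : set (m.-tuple RB)).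
Proof.
rewrite (_ : _ @^-1` _ = \bigcap_(i in [set: 'I_m]) ((fun t : m.-tuple RB => tnth t i) @^-1` [set y | `|y - c ord0 i| < r])).
  apply: fin_bigcap_measurable => // i _.
  rewrite -[X in measurable X]setTI; apply: measurable_tnth => //.
  rewrite (_ : [set y | _] = ball (c ord0 i) r); first exact: measurable_ball.
  by apply/seteqP; split => y /=; rewrite /ball/= distrC.
apply/seteqP; split => t /= h i.
  by move=> _ /=; have := h i; rewrite mxE.
by rewrite mxE; exact: (h i Logic.I).
Qed.

End rows.

Section rational_boxes.
Context {R : realType} {m : nat}.
Local Notation RB := (measurableTypeR R).

Definition ratrow (q : m.-tuple rat) : 'rV[R]_m := \row_i ratr (tnth q i).

(** The factor 4 makes room for the energy estimate on a box of radius [ratr e]: it uses points up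
    to twice as far from the centre, each with a neighbourhood of radius twice [ratr e]. *)
Lemma rational_box (x : 'rV[R]_m) (r : R) : 0 < r ->
  exists q e, [/\ 0 < ratr e :> R, box (ratrow q) (ratr e) x &
    box (ratrow q) (4 * ratr e) `<=` box x r].
Proof.
move=> r0.
(* As [x] is within [e] of the centre, the enlarged box stays within [5 * e < r] of [x]. *)
have /rat_in_itvoo[e] : 0 < r / 8 by rewrite divr_gt0.
rewrite in_itv/= => /andP[e0 er].
have q_ i : exists q, `|x ord0 i - ratr q| < ratr e :> R.
  have /rat_in_itvoo[q] : x ord0 i < x ord0 i + ratr e by rewrite ltrDl.
  rewrite in_itv/= => /andP[h1 h2]; exists q.
  by rewrite ltr_norml; apply/andP; split; lra.
pose q i := sval (cid (q_ i)).
have hq i : `|x ord0 i - ratr (q i)| < ratr e :> R by rewrite /q; case: cid.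
exists [tuple q i | i < m], e; split => //.
  by move=> i; rewrite mxE tnth_mktuple.
move=> y hy i; have := hy i; have := hq i; rewrite mxE tnth_mktuple.
by rewrite !ltr_norml => /andP[? ?] /andP[? ?]; apply/andP; split; lra.
Qed.

(** An open set is the union of the rational boxes that it contains, and these are countably
    many. *)
Lemma measurable_row_open (O : set 'rV[R]_m) : open O ->
  measurable (@row_of_tuple R m @^-1` O : set (m.-tuple RB)).
Proof.
move=> oO.
pose B (p : m.-tuple rat * rat) : set (m.-tuple RB) :=
  if `[< 0 < ratr p.2 :> R /\ box (ratrow p.1) (ratr p.2) `<=` O >]
  then @row_of_tuple R m @^-1` box (ratrow p.1) (ratr p.2) else set0.
rewrite (_ : _ @^-1` O = \bigcup_p B p).
  apply: countable_bigcupT_measurable; first exact: countableP.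
  by move=> p; rewrite /B; case: ifP => // _; exact: measurable_box.
apply/seteqP; split => t /=.
  move=> Ot; have [r r0 rO] := nbhs_boxP (open_nbhs_nbhs (conj oO Ot)).
  have [q [e [e0 qt qO]]] := rational_box (row_of_tuple t) r0.
  exists (q, e) => //; rewrite /B ifT//; apply/asboolP; split=> //=.
  apply: subset_trans rO; apply: subset_trans qO; apply: box_subset; lra.
by move=> [p _]; rewrite /B; case: ifP => // /asboolP[_ h] /h.
Qed.

Lemma measurable_row_compact (K : set 'rV[R]_m) : compact K ->
  measurable (@row_of_tuple R m @^-1` K : set (m.-tuple RB)).
Proof.
move=> /(compact_closed (@norm_hausdorff _ _)) cK.
have := measurableC (measurable_row_open (closed_openC cK)).
by rewrite -preimage_setC setCK.
Qed.

Lemma measurable_row_continuous (f : 'rV[R]_m -> R) : continuous f ->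
  measurable_fun [set: m.-tuple RB] (f \o @row_of_tuple R m).
Proof.
move=> cf; apply: (measurability _ (RGenOpens.measurableE R)).
move=> /= _ [_ [a [b ->]] <-]; rewrite setTI comp_preimage.
by apply: measurable_row_open; apply: open_comp => // ? _; exact: cf.
Qed.

End rational_boxes.

Lemma leb_box_lty {R : realType} {m : nat} (c : 'rV[R]_m) (r : R) :
  (leb m (@row_of_tuple R m @^-1` box c r) < +oo)%E.
Proof.
elim: m c => [|m IH] c.
  by rewrite /= diracE; case: (_ \in _); rewrite ltry.
rewrite /= /leb_step /pushforward.
pose c' : 'rV[R]_m := \row_i c ord0 (lift ord0 i).
rewrite (_ : _ @^-1` _ = [set y | `|y - c ord0 ord0| < r] `*` (@row_of_tuple R m @^-1` box c' r)); last first.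
  apply/seteqP; split => -[y t] /=.
    move=> h; split; first by have := h ord0; rewrite mxE tnth0.
    by move=> i; have := h (lift ord0 i); rewrite !mxE tnthS.
  move=> [h1 h2] i; rewrite mxE; case: (unliftP ord0 i) => [j ->|->].
    by have := h2 j; rewrite !mxE tnthS.
  by rewrite tnth0.
have E : [set y | `|y - c ord0 ord0| < r] = ball (c ord0 ord0) r.
  by apply/seteqP; split => y /=; rewrite /ball/= distrC.
rewrite product_measure1E; last 2 first.
  by rewrite E; exact: measurable_ball.
  exact: measurable_box.
rewrite lte_mul_pinfty//.
  rewrite E ge0_fin_numE// (le_lt_trans _ (ltry (`|r| *+ 2)))//.
  (* The sign of [r] is not assumed, hence the detour through its absolute value. *)
  apply: (@le_trans _ _ (lebesgue_measure (ball (c ord0 ord0) `|r|))).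
    apply: le_measure; rewrite ?inE; [exact: measurable_ball..|].
    by apply: le_ball; exact: ler_norm.
  by rewrite lebesgue_measure_ball.
Qed.

(** * Circular averages and the energy estimate *)

Lemma measurable_fun_integral d1 d2 (T1 : measurableType d1) (T2 : measurableType d2)
    (R : realType) (m2 : {sigma_finite_measure set T2 -> \bar R}) (G : T1 * T2 -> \bar R) :
  measurable_fun setT G ->
  measurable_fun setT (fun x => \int[m2]_y G (x, y))%E.
Proof.
move=> mG; under eq_fun do rewrite integralE.
apply: emeasurable_funB.
- rewrite (_ : (fun x => _) = fubini_F m2 G^\+%E).
    exact: measurable_fun_fubini_tonelli_F (measurable_funepos mG) (funepos_ge0 _).
  by apply/funext => x; rewrite /fubini_F; apply: eq_integral => y _; rewrite !funeposE.
- rewrite (_ : (fun x => _) = fubini_F m2 G^\-%E).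
    exact: measurable_fun_fubini_tonelli_F (measurable_funeneg mG) (funeneg_ge0 _).
  by apply/funext => x; rewrite /fubini_F; apply: eq_integral => y _; rewrite !funenegE.
Qed.

Section probability_integral.
Context d (T : measurableType d) (R : realType) (P : probability T R).

Lemma prob_integrable (h : T -> R) (M : R) : measurable_fun setT h ->
  (forall t, `|h t| <= M) -> P.-integrable setT (EFin \o h).
Proof.
move=> mh hM; apply: measurable_bounded_integrable => //.
  by rewrite -ge0_fin_numE// fin_num_measure.
exists M; split; first exact: num_real.
by move=> y My x Dx; apply: le_trans (hM _) (ltW My).
Qed.

Lemma prob_Rintegral_cst (c : R) : \int[P]_t c = c.
Proof. by rewrite Rintegral_cst// -[fine _]/(fine (P setT)) probability_setT mulr1. Qed.

(** After expanding the square, the right side minus the left is twice [v] times the excess of the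
    mean of [h] over [v]. Here nonnegativity turns the sub-mean-value property into a bound on
    oscillation. *)
Lemma prob_variance (h : T -> R) (v M : R) : measurable_fun setT h ->
  (forall t, `|h t| <= M) -> 0 <= v -> v <= \int[P]_t h t ->
  \int[P]_t ((h t - v) ^+ 2) + v ^+ 2 <= \int[P]_t (h t ^+ 2).
Proof.
move=> mh hM v0 vh.
have ih := prob_integrable mh hM.
have ih2 : P.-integrable setT (EFin \o (fun t => h t ^+ 2)).
  apply: (@prob_integrable _ (M ^+ 2)); first exact: measurable_funX.
  by move=> t; rewrite normrX lerXn2r ?nnegrE// (le_trans _ (hM t)).
have ivh : P.-integrable setT (EFin \o (fun t => 2 * v * h t)) by exact: integrable_scale.
have icst : P.-integrable setT (EFin \o (fun=> v ^+ 2)).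
  by apply: (@prob_integrable _ `|v ^+ 2|) => // ?; exact: measurable_cst.
have -> : \int[P]_t ((h t - v) ^+ 2) = \int[P]_t (h t ^+ 2) - 2 * v * \int[P]_t h t + v ^+ 2.
  transitivity (\int[P]_t (h t ^+ 2 - 2 * v * h t + v ^+ 2)).
    by apply: eq_Rintegral => t _; ring.
  rewrite RintegralD//; last exact: integrableB ih2 ivh.
  by rewrite RintegralB// RintegralZl// prob_Rintegral_cst.
have : v * v <= v * \int[P]_t h t by rewrite ler_wpM2l.
by rewrite expr2; lra.
Qed.

End probability_integral.

(* Only these moments of the uniform law on the circle matter; as [a] and [b]
   play symmetric roles, one argument gives both partial derivatives. *)
Record circle_law {R : realType} d (T : measurableType d) (P : probability T R)
    (a b : T -> R) : Prop := CircleLaw {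
  circle_ma : measurable_fun setT a;
  circle_mb : measurable_fun setT b;
  circle_eq1 : forall t, a t ^+ 2 + b t ^+ 2 = 1;
  circle_ia : \int[P]_t a t = 0;
  circle_ib : \int[P]_t b t = 0;
  circle_iab : \int[P]_t (a t * b t) = 0;
  circle_iaa : \int[P]_t (a t ^+ 2) = 2^-1;
  circle_ibb : \int[P]_t (b t ^+ 2) = 2^-1 }.

Lemma circle_law_sym {R : realType} d (T : measurableType d) (P : probability T R)
  (a b : T -> R) : circle_law P a b -> circle_law P b a.
Proof.
case=> ? ? ab1 ? ? iab ? ?; split=> //; first by move=> t; rewrite addrC.
by under eq_Rintegral do rewrite mulrC.
Qed.

Section circle.
Context {R : realType} {m : nat} (p q : 'I_m) {d'} {T' : measurableType d'}.
Context (P : probability T' R) (a b : T' -> R).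
Local Notation RB := (measurableTypeR R).
Local Notation T := (m.-tuple RB).
Local Notation row := (@row_of_tuple R m).

Definition dir (t : T') : 'rV[R]_m :=
  \row_i (a t * (i == p)%:R + b t * (i == q)%:R).

Hypotheses (pq : p != q) (H : circle_law P a b).
Let ma := circle_ma H.
Let mb := circle_mb H.
Let ab1 := circle_eq1 H.
Let ia := circle_ia H.
Let ib := circle_ib H.

Lemma dir_p t : dir t ord0 p = a t.
Proof. by rewrite mxE eqxx (negPf pq) mulr1 mulr0 addr0. Qed.

Lemma dir_q t : dir t ord0 q = b t.
Proof. by rewrite mxE eqxx eq_sym (negPf pq) mulr1 mulr0 add0r. Qed.

Lemma dir_neq t i : i != p -> i != q -> dir t ord0 i = 0.
Proof. by move=> ip iq; rewrite mxE (negPf ip) (negPf iq) !mulr0 addr0. Qed.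

Lemma circle_le1l t : `|a t| <= 1.
Proof.
rewrite -(@ler_pXn2r _ 2)// ?nnegrE// expr1n real_normK ?num_real//.
by have := ab1 t; have := sqr_ge0 (b t); lra.
Qed.

Lemma circle_le1r t : `|b t| <= 1.
Proof.
rewrite -(@ler_pXn2r _ 2)// ?nnegrE// expr1n real_normK ?num_real//.
by have := ab1 t; have := sqr_ge0 (a t); lra.
Qed.

Lemma dir_le1 t i : `|dir t ord0 i| <= 1.
Proof.
have [->|ip] := eqVneq i p; first by rewrite dir_p circle_le1l.
have [->|iq] := eqVneq i q; first by rewrite dir_q circle_le1r.
by rewrite dir_neq// normr0.
Qed.

Lemma box_dir (c x : 'rV[R]_m) (r s u : R) t : box c r x -> `|s| <= u ->
  box c (r + u) (x + s *: dir t).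
Proof.
move=> h su i; rewrite !mxE -/(dir t).
have -> : x ord0 i + s * (a t * (i == p)%:R + b t * (i == q)%:R) - c ord0 i =
  x ord0 i - c ord0 i + s * dir t ord0 i by rewrite mxE; ring.
apply: le_lt_trans (ler_normD _ _) _; apply: ltr_leD; first exact: h.
rewrite normrM; apply: le_trans su; rewrite ler_piMr//; exact: dir_le1.
Qed.

Lemma measurable_dir_comp d (Z : measurableType d) (F : 'rV[R]_m -> Z) (s : R) :
  measurable_fun [set: T] (F \o row) ->
  measurable_fun [set: T * T'] (fun z : T * T' => F (row z.1 + s *: dir z.2)).
Proof.
move=> mF; apply: (measurable_row_comp (w := fun z : T * T' => row z.1 + s *: dir z.2) mF) => i.
rewrite (_ : (fun y => _) = (fun y : T * T' => tnth y.1 i + s * (a y.2 * (i == p)%:R + b y.2 * (i == q)%:R))).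
  apply: measurable_funD.
    exact: measurableT_comp (measurable_tnth i) measurable_fst.
  apply: measurable_funM => //; apply: measurable_funD; apply: measurable_funM => //.
    exact: measurableT_comp ma measurable_snd.
  exact: measurableT_comp mb measurable_snd.
by apply/funext => y; rewrite !mxE.
Qed.

Lemma integrable_circle (k0 k1 k2 : R) :
  P.-integrable setT (EFin \o (fun t => k0 + (k1 * a t + k2 * b t))).
Proof.
apply: (@prob_integrable _ _ _ _ _ (`|k0| + (`|k1| + `|k2|))).
  by do 2 (apply: measurable_funD => //); apply: measurable_funM.
move=> t; apply: le_trans (ler_normD _ _) _; rewrite lerD2l.
apply: le_trans (ler_normD _ _) _; rewrite !normrM.
by apply: lerD; rewrite ler_piMr// ?circle_le1l ?circle_le1r.
Qed.

Lemma circle_average (k0 k1 k2 : R) :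
  \int[P]_t (k0 + (k1 * a t + k2 * b t)) = k0.
Proof.
have iA : P.-integrable setT (EFin \o a) by apply: (prob_integrable _ ma) circle_le1l.
have iB : P.-integrable setT (EFin \o b) by apply: (prob_integrable _ mb) circle_le1r.
have iA' : P.-integrable setT (EFin \o (fun t => k1 * a t)) by exact: integrable_scale.
have iB' : P.-integrable setT (EFin \o (fun t => k2 * b t)) by exact: integrable_scale.
have iAB : P.-integrable setT (EFin \o (fun t => k1 * a t + k2 * b t)).
  exact: integrableD iA' iB'.
rewrite RintegralD//; last first.
  by apply: (@prob_integrable _ _ _ _ _ `|k0|) => // ?; exact: measurable_cst.
by rewrite RintegralD// !RintegralZl// ia ib !mulr0 !addr0 prob_Rintegral_cst.
Qed.

Section cutoff.
Variables (c : 'rV[R]_m) (rho : R).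
Hypothesis rho0 : 0 < rho.

Let Q : set 'rV[R]_m :=
  [set x | forall i, i != p -> i != q -> `|x ord0 i - c ord0 i| < 2 * rho].

Let bump (x : 'rV[R]_m) : R :=
  Num.max 0 (4 * rho ^+ 2 - (x ord0 p - c ord0 p) ^+ 2 - (x ord0 q - c ord0 q) ^+ 2).

(** Shifts along [dir] move only the coordinates [p] and [q], so in all others a sharp indicator is
    as good as a smooth cutoff. *)
Definition chi (x : 'rV[R]_m) : R := \1_Q x * bump x ^+ 2.

Let bump_ge0 x : 0 <= bump x. Proof. by rewrite le_max lexx. Qed.

Lemma chi_ge0 x : 0 <= chi x.
Proof. by rewrite mulr_ge0// ?sqr_ge0// indicE. Qed.

Let bump_le x : bump x <= 4 * rho ^+ 2.
Proof.
rewrite ge_max; apply/andP; split; first by rewrite mulr_ge0// sqr_ge0.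
have := sqr_ge0 (x ord0 p - c ord0 p); have := sqr_ge0 (x ord0 q - c ord0 q); lra.
Qed.

Lemma chi_le x : chi x <= 16 * rho ^+ 4.
Proof.
have : bump x ^+ 2 <= (4 * rho ^+ 2) ^+ 2.
  by rewrite lerXn2r ?nnegrE// mulr_ge0// sqr_ge0.
rewrite (_ : (4 * rho ^+ 2) ^+ 2 = 16 * rho ^+ 4); last by ring.
move=> h; rewrite /chi indicE; case: (_ \in _); rewrite ?mul1r// mul0r.
by rewrite mulr_ge0// exprn_ge0// ltW.
Qed.

Let bump_box x : Q x -> bump x != 0 -> box c (2 * rho) x.
Proof.
move=> Qx bx i.
have h : 0 < 4 * rho ^+ 2 - (x ord0 p - c ord0 p) ^+ 2 - (x ord0 q - c ord0 q) ^+ 2.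
  by move: bx; rewrite /bump; case: ltP => //; rewrite eqxx.
have e : (2 * rho) ^+ 2 = 4 * rho ^+ 2 by ring.
have r2 : 0 <= 2 * rho by rewrite mulr_ge0// ltW.
have [->|ip] := eqVneq i p.
  rewrite -(@ltr_pXn2r _ 2)// ?nnegrE// real_normK ?num_real// e.
  have := sqr_ge0 (x ord0 q - c ord0 q); lra.
have [->|iq] := eqVneq i q; last exact: Qx.
rewrite -(@ltr_pXn2r _ 2)// ?nnegrE// real_normK ?num_real// e.
have := sqr_ge0 (x ord0 p - c ord0 p); lra.
Qed.

Lemma chi_box x : chi x != 0 -> box c (2 * rho) x.
Proof.
rewrite /chi indicE; case: (boolP (x \in Q)); last by rewrite mul0r eqxx.
by move=> /set_mem Qx; rewrite mul1r expf_eq0/= => /bump_box; exact.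
Qed.

Lemma chi_lb x : box c rho x -> 4 * rho ^+ 4 <= chi x.
Proof.
move=> h.
have sq i : (x ord0 i - c ord0 i) ^+ 2 <= rho ^+ 2.
  rewrite -[_ ^+ 2]real_normK ?num_real// lerXn2r ?nnegrE//; first exact: ltW.
  exact/ltW/h.
have Qx : Q x.
  move=> i _ _; apply: lt_trans (h i) _; rewrite ltr_pMl ?ltr1n//.
rewrite /chi indicE mem_set// mul1r (_ : 4 * rho ^+ 4 = (2 * rho ^+ 2) ^+ 2); last by ring.
rewrite lerXn2r ?nnegrE//; first by rewrite mulr_ge0// sqr_ge0.
by rewrite le_max; apply/orP; right; have := sq p; have := sq q; lra.
Qed.

(* Only an upper bound on second differences is needed, so squaring the positive
   part of a concave quadratic is regular enough. *)
Lemma chi_shift (x : 'rV[R]_m) (s : R) t : 0 < s <= rho ->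
  chi (x - s *: dir t) <= chi x +
    4 * s * (\1_Q x * bump x * (x ord0 p - c ord0 p)) * a t +
    4 * s * (\1_Q x * bump x * (x ord0 q - c ord0 q)) * b t +
    (13 * rho * s) ^+ 2 * \1_(box c (3 * rho)) x.
Proof.
move=> /andP[s0 srho].
have xp : (x - s *: dir t) ord0 p = x ord0 p - s * a t by rewrite 2!mxE [X in _ - X]mxE dir_p.
have xq : (x - s *: dir t) ord0 q = x ord0 q - s * b t by rewrite 2!mxE [X in _ - X]mxE dir_q.
have xi i : i != p -> i != q -> (x - s *: dir t) ord0 i = x ord0 i.
  by move=> ip iq; rewrite 2!mxE [X in _ - X]mxE dir_neq// mulr0 subr0.
(* Outside radius [3 * rho] both [chi] and its shift by [s <= rho] vanish, and so do the linear
   terms. *)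
have [bx|nbx] := pselect (box c (3 * rho) x); last first.
  have -> : chi (x - s *: dir t) = 0.
    apply/eqP; apply: contra_notT nbx => /chi_box h.
    have -> : x = (x - s *: dir t) + s *: dir t by rewrite subrK.
    rewrite (_ : 3 * rho = 2 * rho + rho); last by ring.
    by apply: box_dir => //; rewrite ger0_norm// ltW.
  have b2 : ~ box c (2 * rho) x.
    by apply: contra_not nbx; apply: box_subset; lra.
  have -> : chi x = 0 by apply/eqP; apply: contra_notT b2; exact: chi_box.
  have -> : \1_Q x * bump x = 0.
    apply/eqP; apply: contra_notT b2 => h.
    move: h; rewrite indicE; case: (boolP (x \in Q)); last by rewrite mul0r eqxx.
    by move=> /set_mem Qx; rewrite mul1r; exact: bump_box.
  by rewrite !(mul0r, mulr0, addr0, add0r) mulr_ge0 ?sqr_ge0// indicE ler0n.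
rewrite [\1_(box _ _) x]indicE (mem_set bx) mulr1.
have QE : \1_Q (x - s *: dir t) = \1_Q x :> R.
  rewrite !indicE; congr (_%:R); congr nat_of_bool; apply/idP/idP => /set_mem h; apply/mem_set => i ip iq.
    by rewrite -xi//; exact: h.
  by rewrite xi//; exact: h.
have sr2 := sqr_ge0 (13 * rho * s).
rewrite {1}/chi QE; have [Qx|nQx] := boolP (x \in Q); last first.
  by rewrite /chi indicE (negPf nQx) !(mul0r, mulr0, add0r, addr0).
rewrite /chi !indicE Qx !mul1r /bump xp xq.
set X := x ord0 p - c ord0 p; set Y := x ord0 q - c ord0 q.
have -> : x ord0 p - s * a t - c ord0 p = X - s * a t by rewrite /X; ring.
have -> : x ord0 q - s * b t - c ord0 q = Y - s * b t by rewrite /Y; ring.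
have hX : `|X| <= 3 * rho by exact/ltW/bx.
have hY : `|Y| <= 3 * rho by exact/ltW/bx.
pose A := 4 * rho ^+ 2 - X ^+ 2 - Y ^+ 2.
pose L := 2 * (X * a t + Y * b t) - s.
have -> : 4 * rho ^+ 2 - (X - s * a t) ^+ 2 - (Y - s * b t) ^+ 2 = A + s * L.
  have := ab1 t; rewrite /A /L => e.
  transitivity (4 * rho ^+ 2 - X ^+ 2 - Y ^+ 2 + s * (2 * (X * a t + Y * b t)) - s ^+ 2 * (a t ^+ 2 + b t ^+ 2)).
    by ring.
  by rewrite e; ring.
(* The 13 is 2 * (3 + 3), from the two products, plus 1, from [s <= rho]. *)
have hL : `|L| <= 13 * rho.
  have hXa : `|X * a t| <= 3 * rho by rewrite normrM; apply: le_trans hX; rewrite ler_piMr// circle_le1l.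
  have hYb : `|Y * b t| <= 3 * rho by rewrite normrM; apply: le_trans hY; rewrite ler_piMr// circle_le1r.
  by move: hXa hYb; rewrite /L !ler_norml => /andP[? ?] /andP[? ?]; apply/andP; split; lra.
have hL2 : (s * L) ^+ 2 <= (13 * rho * s) ^+ 2.
  rewrite exprMn [leRHS]exprMn [leRHS]mulrC ler_wpM2l ?sqr_ge0//.
  by rewrite -[L ^+ 2]real_normK ?num_real// lerXn2r ?nnegrE// mulr_ge0 ?ler0n// ltW.
rewrite -/A.
have Z0 : 0 <= Num.max 0 A by rewrite le_max lexx.
(* The right side is the square of [Num.max 0 A + s * L]. If [A + s * L] is negative the left side
   is 0; otherwise the bases are ordered and nonnegative. *)
have main : Num.max 0 (A + s * L) ^+ 2 <= Num.max 0 A ^+ 2 + 2 * Num.max 0 A * (s * L) + (s * L) ^+ 2.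
  rewrite -[leRHS](_ : (Num.max 0 A + s * L) ^+ 2 = _); last by ring.
  have [AsL|AsL] := leP (A + s * L) 0; first by rewrite expr0n sqr_ge0.
  have h : A <= Num.max 0 A by rewrite le_max lexx orbT.
  by rewrite lerXn2r ?nnegrE//; lra.
(* The summand [- s] of [L] contributes a nonpositive term, which is dropped. *)
have : 2 * Num.max 0 A * (s * L) <= 4 * s * (Num.max 0 A * X) * a t + 4 * s * (Num.max 0 A * Y) * b t.
  rewrite /L; have : 0 <= 2 * Num.max 0 A * s ^+ 2 by rewrite mulr_ge0// ?sqr_ge0// mulr_ge0.
  set Z := Num.max 0 A; lra.
by move: main; set Z := Num.max 0 A; lra.
Qed.

Lemma measurable_chi : measurable_fun [set: T] (chi \o row).
Proof.
apply: measurable_funM.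
  have mQ : measurable (row @^-1` Q : set T).
    rewrite (_ : _ @^-1` _ = \bigcap_(i in [set i | i != p /\ i != q])
        ((fun t : T => tnth t i) @^-1` [set y | `|y - c ord0 i| < 2 * rho])).
      apply: fin_bigcap_measurable => [|i _]; first exact: finite_finset.
      rewrite -[X in measurable X]setTI; apply: measurable_tnth => //.
      rewrite (_ : [set y | _] = ball (c ord0 i) (2 * rho)); first exact: measurable_ball.
      by apply/seteqP; split => y /=; rewrite /ball/= distrC.
    apply/seteqP; split => t /= h i.
      by move=> [ip iq] /=; have := h i ip iq; rewrite mxE.
    by move=> ip iq; rewrite mxE; exact: (h i (conj ip iq)).
  have : measurable_fun [set: T] (\1_(row @^-1` Q) : T -> R) by exact: measurable_indic.
  apply: eq_measurable_fun => t _; rewrite !indicE.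
  have QE : (t \in row @^-1` Q) = (row t \in Q) by apply/idP/idP => /set_mem h; exact: mem_set.
  by rewrite QE.
apply: measurable_funX; apply: measurable_maxr => //.
have mX i : measurable_fun [set: T] (fun t : T => (row t ord0 i - c ord0 i) ^+ 2).
  apply: measurable_funX; apply: measurable_funB => //.
  by under eq_fun do rewrite mxE; exact: measurable_tnth.
by apply: measurable_funB => //; apply: measurable_funB => //.
Qed.

(** The linear terms of [chi_shift] have mean zero over the circle, so only the quadratic error
    survives. *)
Lemma chi_average (x : 'rV[R]_m) (s : R) : 0 < s <= rho ->
  \int[P]_t chi (x - s *: dir t) <= chi x + (13 * rho * s) ^+ 2 * \1_(box c (3 * rho)) x.
Proof.
move=> s_; set k1 := 4 * s * (\1_Q x * bump x * (x ord0 p - c ord0 p)).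
set k2 := 4 * s * (\1_Q x * bump x * (x ord0 q - c ord0 q)).
set k0 := chi x + (13 * rho * s) ^+ 2 * \1_(box c (3 * rho)) x.
rewrite -(circle_average k0 k1 k2).
apply: le_Rintegral => //.
- apply: (@prob_integrable _ _ _ _ _ (16 * rho ^+ 4)).
    have := measurable_dir_comp (- s) measurable_chi => h.
    have := measurable_fun_pair2 (tuple_of_row x) h.
    by apply: eq_measurable_fun => t _ /=; rewrite tuple_of_rowK scaleNr.
  by move=> t; rewrite ger0_norm ?chi_ge0// chi_le.
- exact: integrable_circle.
- by move=> t _; have := @chi_shift x s t s_; rewrite -/k1 -/k2 /k0; lra.
Qed.

End cutoff.
End circle.

Lemma EFin_Rintegral d (T : measurableType d) (R : realType) (mu : {measure set T -> \bar R})
    (D : set T) (f : T -> R) : measurable D -> mu.-integrable D (EFin \o f) ->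
  (\int[mu]_(x in D) (f x)%:E)%E = (\int[mu]_(x in D) f x)%:E.
Proof. by move=> mD fi; rewrite /Rintegral fineK//; exact: integrable_fin_num. Qed.

Section energy.
Context {R : realType} {m : nat} (p q : 'I_m) {d'} {T' : measurableType d'}.
Context (P : probability T' R) (a b : T' -> R).
Hypotheses (pq : p != q) (H : circle_law P a b).
Local Notation RB := (measurableTypeR R).
Local Notation T := (m.-tuple RB).
Local Notation row := (@row_of_tuple R m).
Local Notation w := (dir p q a b).
Local Notation mu := (leb m).

(** Three nested radii: the estimate holds on [rho], the cutoff lives on [2 * rho], and shifts by
    [s <= rho] stay inside [3 * rho]. *)
Variables (f : 'rV[R]_m -> R) (c : 'rV[R]_m) (rho M : R).
Hypotheses (rho0 : 0 < rho) (f0 : forall x, 0 <= f x)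
  (mf : measurable_fun [set: T] (f \o row))
  (fM : forall x, box c (3 * rho) x -> f x <= M)
  (sub : forall x s, box c (2 * rho) x -> 0 < s <= rho ->
    f x <= \int[P]_t f (x + s *: w t)).

Let r23 : 2 * rho <= 3 * rho. Proof. by rewrite ler_pM2r ?ler_nat. Qed.

Let M0 : 0 <= M.
Proof. by apply: le_trans (f0 c) (fM _); apply: box_center; rewrite mulr_gt0. Qed.

Let fnorm x : box c (3 * rho) x -> `|f x| <= M.
Proof. by move=> /fM; rewrite ger0_norm. Qed.

Section scale.
Variable s : R.
Hypothesis srho : 0 < s <= rho.

Let s0 : 0 < s. Proof. by case/andP: srho. Qed.

Let shift_box (x : 'rV[R]_m) t : box c (2 * rho) x -> box c (3 * rho) (x + s *: w t).
Proof.
move=> h; rewrite (_ : 3 * rho = 2 * rho + rho); last by ring.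
by apply: (box_dir pq H) => //; rewrite ger0_norm ?(ltW s0)//; case/andP: srho.
Qed.

Let mfw : measurable_fun [set: T * T'] (fun z : T * T' => f (row z.1 + s *: w z.2)).
Proof. exact: (measurable_dir_comp p q H s mf). Qed.

Let mfx (x : 'rV[R]_m) : measurable_fun setT (fun t => f (x + s *: w t)).
Proof.
apply: eq_measurable_fun (measurable_fun_pair2 (tuple_of_row x) mfw) => t _ /=.
by rewrite tuple_of_rowK.
Qed.

Let dsq (z : T * T') : R := (f (row z.1 + s *: w z.2) - f (row z.1)) ^+ 2.

Let mfst : measurable_fun [set: T * T'] (fun z : T * T' => f (row z.1)).
Proof. exact: measurableT_comp mf measurable_fst. Qed.

Let mdsq : measurable_fun [set: T * T'] dsq.
Proof. by apply: measurable_funX; apply: measurable_funB. Qed.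

Let K := chi p q c rho.

Let mK : measurable_fun [set: T] (K \o row). Proof. exact: measurable_chi. Qed.

Let mKfst : measurable_fun [set: T * T'] (fun z : T * T' => K (row z.1)).
Proof. exact: measurableT_comp mK measurable_fst. Qed.

(** Where the cutoff is nonzero, all shifted points lie where [f <= M], so [prob_variance] applies
    with [v] equal to [f (row x)]. *)
Let pointwise_lower (x : T) :
  ((K (row x))%:E * \int[P]_t (dsq (x, t))%:E + (K (row x) * f (row x) ^+ 2)%:E <=
   \int[P]_t (K (row x) * f (row x + s *: w t) ^+ 2)%:E)%E.
Proof.
have [K0|K0] := eqVneq (K (row x)) 0.
  by rewrite K0 mul0e mul0r adde0; apply: integral_ge0 => t _; rewrite lee_fin mul0r.
have bx := chi_box rho0 K0.
have bxt t := shift_box t bx.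
have hM t : `|f (row x + s *: w t)| <= M by exact: fnorm (bxt t).
have ih2 : P.-integrable setT (EFin \o (fun t => f (row x + s *: w t) ^+ 2)).
  apply: (@prob_integrable _ _ _ _ _ (M ^+ 2)); first exact/measurable_funX/mfx.
  by move=> t; rewrite normrX lerXn2r ?nnegrE.
rewrite EFin_Rintegral//; last first.
  apply: (@prob_integrable _ _ _ _ _ ((M + M) ^+ 2)).
    exact: (measurable_funX 2 (measurable_funB (mfx (row x)) (measurable_cst (f (row x))))).
  move=> t; rewrite /dsq normrX lerXn2r ?nnegrE ?addr_ge0//.
  by apply: le_trans (ler_normB _ _) _; rewrite lerD// fnorm//; exact: box_subset bx.
rewrite EFin_Rintegral//; last exact: integrable_scale.
rewrite RintegralZl// -EFinM -EFinD lee_fin -mulrDr ler_wpM2l ?chi_ge0//.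
exact: prob_variance (mfx _) hM (f0 _) (sub bx srho).
Qed.

(** This is [chi_average] multiplied by [f (row x) ^+ 2]; its error term is confined to radius
    [3 * rho], where [f <= M]. *)
Let pointwise_upper (x : T) :
  (\int[P]_t (K (row x - s *: w t) * f (row x) ^+ 2)%:E <=
   (K (row x) * f (row x) ^+ 2 + (13 * rho * s * M) ^+ 2 * \1_(row @^-1` box c (3 * rho)) x)%:E)%E.
Proof.
have iK : P.-integrable setT (EFin \o (fun t => K (row x - s *: w t))).
  apply: (@prob_integrable _ _ _ _ _ (16 * rho ^+ 4)).
    have := measurable_fun_pair2 x (measurable_dir_comp p q H (- s) mK).
    by apply: eq_measurable_fun => t _ /=; rewrite scaleNr.
  by move=> t; rewrite ger0_norm ?chi_ge0// chi_le.
rewrite EFin_Rintegral//; last first.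
  rewrite (_ : (fun t => _) = (fun t => f (row x) ^+ 2 * K (row x - s *: w t))).
    exact: integrable_scale.
  by apply/funext => t; rewrite mulrC.
rewrite RintegralZr// lee_fin.
apply: (le_trans (ler_wpM2r (sqr_ge0 _) (chi_average pq H c rho0 (row x) srho))).
rewrite mulrDl lerD2l.
have -> : \1_(row @^-1` box c (3 * rho)) x = \1_(box c (3 * rho)) (row x) :> R.
  rewrite !indicE.
  have QE : (x \in row @^-1` box c (3 * rho)) = (row x \in box c (3 * rho)).
    by apply/idP/idP => /set_mem h; exact: mem_set.
  by rewrite QE.
rewrite indicE; case: (boolP (row x \in box c (3 * rho))) => [/set_mem bx|_]; last first.
  by rewrite !mulr0 mul0r.
rewrite !mulr1 [leRHS]exprMn ler_wpM2l ?sqr_ge0// lerXn2r ?nnegrE//.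
exact: fM.
Qed.

(* Integrate the variance inequality against [chi], translate so that the shift
   falls on [chi], and use that the circular averages of [chi] exceed it by
   O(s^2) only: the terms [chi * f^2] cancel. *)
Lemma energy :
  ((4 * rho ^+ 4)%:E * \int[mu]_(x in row @^-1` box c rho)
     \int[P]_t ((f (row x + s *: w t) - f (row x)) ^+ 2)%:E <=
   ((13 * rho * s * M) ^+ 2)%:E * mu (row @^-1` box c (3 * rho)))%E.
Proof.
pose E (x : T) := (\int[P]_t (dsq (x, t))%:E)%E.
have E0 x : (0 <= E x)%E by apply: integral_ge0 => t _; rewrite lee_fin sqr_ge0.
have mE : measurable_fun setT E.
  exact: (measurable_fun_integral P (G := EFin \o dsq)) (measurableT_comp _ mdsq).
have mB r := @measurable_box R m c r.
have mI r : measurable_fun [set: T] (fun x => (\1_(row @^-1` box c r) x)%:E).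
  by apply/measurable_EFinP; exact: measurable_indic.
have I0 r (x : T) : [set: T] x -> (0 <= (\1_(row @^-1` box c r) x)%:E :> \bar R)%E.
  by move=> _; rewrite lee_fin indicE.
pose g (x : T) := K (row x) * f (row x) ^+ 2.
have g0 x : 0 <= g x by rewrite mulr_ge0// ?sqr_ge0// chi_ge0.
have mg : measurable_fun setT g by apply: measurable_funM => //; exact: measurable_funX.
have gE x : g x <= 16 * rho ^+ 4 * M ^+ 2 * \1_(row @^-1` box c (2 * rho)) x.
  rewrite /g indicE; case: (boolP (x \in _)) => [/set_mem bx|nbx].
    rewrite mulr1 ler_pM ?chi_ge0 ?sqr_ge0 ?chi_le// lerXn2r ?nnegrE//.
    by apply: fM; exact: box_subset bx.
  have -> : K (row x) = 0.
    apply/eqP; apply: contraNT nbx => h; apply/mem_set.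
    exact: chi_box h.
  by rewrite mul0r mulr0.
(* Finiteness allows this integral to be cancelled from both sides of [main]. *)
have gfin : (\int[mu]_x (g x)%:E)%E \is a fin_num.
  rewrite ge0_fin_numE; last by apply: integral_ge0 => x _; rewrite lee_fin.
  apply: (@le_lt_trans _ _ (\int[mu]_x ((16 * rho ^+ 4 * M ^+ 2)%:E * (\1_(row @^-1` box c (2 * rho)) x)%:E))%E).
    apply: ge0_le_integral => //.
    - by move=> x _; rewrite lee_fin.
    - exact/measurable_EFinP.
    - by apply/measurable_EFinP; apply: measurable_funM => //; exact: measurable_indic.
    - by move=> x _; rewrite -EFinM lee_fin.
  have c0 : 0 <= 16 * rho ^+ 4 * M ^+ 2.
    by rewrite mulr_ge0 ?sqr_ge0// mulr_ge0// exprn_ge0// ltW.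
  rewrite ge0_integralZl_EFin//.
  rewrite integral_indic// setIT lte_mul_pinfty//; exact: leb_box_lty.
have main : (\int[mu]_x ((K (row x))%:E * E x) + \int[mu]_x (g x)%:E <=
    \int[mu]_x (g x)%:E + ((13 * rho * s * M) ^+ 2)%:E * mu (row @^-1` box c (3 * rho)))%E.
  rewrite -ge0_integralD//; first last.
  - exact/measurable_EFinP.
  - by move=> x _; rewrite lee_fin.
  - by apply: emeasurable_funM => //; exact/measurable_EFinP.
  - by move=> x _; rewrite mule_ge0// lee_fin chi_ge0.
  pose G (z : T * T') := (K (row z.1) * f (row z.1 + s *: w z.2) ^+ 2)%:E.
  have mG : measurable_fun setT G.
    by apply/measurable_EFinP; apply: measurable_funM => //; exact: measurable_funX.
  have G0 z : (0 <= G z)%E by rewrite lee_fin mulr_ge0 ?sqr_ge0// chi_ge0.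
  pose G' (z : T * T') := (K (row z.1 - s *: w z.2) * f (row z.1) ^+ 2)%:E.
  have mG' : measurable_fun setT G'.
    apply/measurable_EFinP; apply: measurable_funM => //; last exact: measurable_funX.
    by apply: eq_measurable_fun (measurable_dir_comp p q H (- s) mK) => z _ /=; rewrite scaleNr.
  have G'0 z : (0 <= G' z)%E by rewrite lee_fin mulr_ge0 ?sqr_ge0// chi_ge0.
  apply: (@le_trans _ _ (\int[mu]_x \int[P]_t G (x, t))%E).
    apply: ge0_le_integral => //.
    - by move=> x _; rewrite adde_ge0 ?lee_fin// mule_ge0// lee_fin chi_ge0.
    - apply: emeasurable_funD; last exact/measurable_EFinP.
      by apply: emeasurable_funM => //; exact/measurable_EFinP.
    - exact: measurable_fun_integral.
  (* For fixed [t], the substitution of [x + s *: w t] for [x] moves the shift from [f] to the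
     cutoff. *)
  have -> : (\int[mu]_x \int[P]_t G (x, t) = \int[mu]_x \int[P]_t G' (x, t))%E.
    rewrite (fubini_tonelli G mG G0) (fubini_tonelli G' mG' G'0); apply: eq_integral => t _.
    pose F (y : 'rV[R]_m) := (K (y - s *: w t) * f y ^+ 2)%:E.
    rewrite -[RHS]/(\int[mu]_x F (row x))%E -(integral_row_translate (s *: w t)).
      by apply: eq_integral => x _; rewrite /F addrK.
    exact: (measurable_fun_pair1 t mG').
  apply: (@le_trans _ _ (\int[mu]_x ((g x)%:E + ((13 * rho * s * M) ^+ 2)%:E * (\1_(row @^-1` box c (3 * rho)) x)%:E))%E).
    apply: ge0_le_integral => //.
    - by move=> x _; apply: integral_ge0.
    - exact: measurable_fun_integral.
    - apply: emeasurable_funD; first exact/measurable_EFinP.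
      by apply/measurable_EFinP; apply: measurable_funM => //; exact: measurable_indic.
    - by move=> x _; rewrite -EFinM -EFinD; exact: pointwise_upper.
  rewrite ge0_integralD//; first last.
  - by apply/measurable_EFinP; apply: measurable_funM => //; exact: measurable_indic.
  - by move=> x _; rewrite -EFinM lee_fin mulr_ge0 ?sqr_ge0// indicE.
  - exact/measurable_EFinP.
  - by move=> x _; rewrite lee_fin.
  rewrite ge0_integralZl_EFin ?sqr_ge0//.
  by rewrite integral_indic// setIT.
move: main; rewrite addeC leeD2lE// => /(le_trans _); apply.
(* It remains to restrict to radius [rho], where the cutoff is at least [4 * rho ^+ 4]. *)
rewrite -ge0_integralZl_EFin//; last first.
- by rewrite mulr_ge0// exprn_ge0// ltW.
- exact: measurable_funTS.
- by move=> x _; exact: E0.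
apply: (@le_trans _ _ (\int[mu]_(x in row @^-1` box c rho) ((K (row x))%:E * E x))%E).
  apply: ge0_le_integral => //.
  - by move=> x _; apply: mule_ge0; [rewrite lee_fin mulr_ge0 ?ler0n// exprn_ge0// ltW|exact: E0].
  - by apply: emeasurable_funM => //; exact: measurable_funTS.
  - by apply: emeasurable_funM; [apply/measurable_EFinP|]; exact: measurable_funTS.
  - by move=> x bx; apply: lee_wpmul2r; [exact: E0|rewrite lee_fin; exact: chi_lb].
apply: ge0_subset_integral => //.
- by apply: emeasurable_funM => //; exact/measurable_EFinP.
- by move=> x _; rewrite mule_ge0// lee_fin chi_ge0.
Qed.

End scale.
End energy.

(** * Equi-integrability of the circular difference quotients *)

Section circular_quotient.
Context {R : realType} {m : nat} (p q : 'I_m) {d'} {T' : measurableType d'}.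
Context (P : probability T' R) (a b : T' -> R).
Hypotheses (pq : p != q) (H : circle_law P a b).
Local Notation RB := (measurableTypeR R).
Local Notation T := (m.-tuple RB).
Local Notation row := (@row_of_tuple R m).
Local Notation w := (dir p q a b).
Local Notation mu := (leb m).

(* Tends to the partial derivative of [f] in the direction [p] as [s] goes to 0. *)
Definition quotient (f : 'rV[R]_m -> R) (s : R) (x : 'rV[R]_m) : R :=
  2 / s * \int[P]_t (a t * f (x + s *: w t)).

Lemma measurable_quotient (f : 'rV[R]_m -> R) (s : R) :
  measurable_fun [set: T] (f \o row) ->
  measurable_fun [set: T] (quotient f s \o row).
Proof.
move=> mf; apply: measurable_funM => //.
apply: measurableT_comp => //.
apply: (measurable_fun_integral P (G := fun z : T * T' => (a z.2 * f (row z.1 + s *: w z.2))%:E)).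
apply/measurable_EFinP; apply: measurable_funM.
  exact: measurableT_comp (circle_ma H) measurable_snd.
exact: (measurable_dir_comp p q H s mf).
Qed.

Section bounds.
Variables (f : 'rV[R]_m -> R) (c : 'rV[R]_m) (rho M : R).
Hypotheses (rho0 : 0 < rho) (f0 : forall x, 0 <= f x)
  (mf : measurable_fun [set: T] (f \o row))
  (fM : forall x, box c (3 * rho) x -> f x <= M)
  (sub : forall x s, box c (2 * rho) x -> 0 < s <= rho ->
    f x <= \int[P]_t f (x + s *: w t)).
Variable s : R.
Hypothesis srho : 0 < s <= rho.

Let s0 : 0 < s. Proof. by case/andP: srho. Qed.

Let M0 : 0 <= M.
Proof. by apply: le_trans (f0 c) (fM _); apply: box_center; rewrite mulr_gt0. Qed.

Let fnorm x : box c (3 * rho) x -> `|f x| <= M.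
Proof. by move=> /fM; rewrite ger0_norm. Qed.

Let box13 x : box c rho x -> box c (3 * rho) x.
Proof. by apply: box_subset; rewrite ler_peMl ?ler1n// ltW. Qed.

Let shift (x : 'rV[R]_m) t : box c rho x -> box c (3 * rho) (x + s *: w t).
Proof.
move=> h; apply: (@box_subset _ _ _ (rho + rho)).
  by rewrite (_ : 3 * rho = rho + rho + rho) ?lerDl ?ltW//; ring.
by apply: (box_dir pq H) => //; rewrite ger0_norm ?(ltW s0)//; case/andP: srho.
Qed.

Let mfx (x : 'rV[R]_m) : measurable_fun setT (fun t => f (x + s *: w t)).
Proof.
apply: eq_measurable_fun (measurable_fun_pair2 (tuple_of_row x) (measurable_dir_comp p q H s mf)) => t _ /=.
by rewrite tuple_of_rowK.
Qed.

Let B := row @^-1` box c rho.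
Let mB : measurable (B : set T). Proof. exact: measurable_box. Qed.
Let Boo : (mu B < +oo)%E. Proof. exact: leb_box_lty. Qed.

(** This bound blows up as [s] tends to 0 and serves integrability for fixed [s] only. *)
Let quotient_le x : box c rho x -> `|quotient f s x| <= 2 / s * M.
Proof.
move=> bx; rewrite normrM ger0_norm ?divr_ge0 ?(ltW s0)//.
rewrite ler_wpM2l ?divr_ge0 ?(ltW s0)//.
have iA : P.-integrable setT (EFin \o (fun t => f (x + s *: w t))).
  by apply: (prob_integrable P (mfx x)) => t; exact/fnorm/shift.
apply: le_trans (normr_Rintegral_mul_le measurableT (circle_ma H) _ iA) _.
  by move=> t _; exact: (circle_le1l H t).
rewrite mul1r -[leRHS](prob_Rintegral_cst P); apply: le_Rintegral => //.
- exact: integrable_norm.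
- by apply: (@prob_integrable _ _ _ _ _ `|M|) => // ?; exact: measurable_cst.
- by move=> t _; exact/fnorm/shift.
Qed.

Lemma integrable_quotient : mu.-integrable B (EFin \o (quotient f s \o row)).
Proof.
apply: measurable_bounded_integrable => //.
  by apply: measurable_funTS; exact: measurable_quotient.
exists (2 / s * M); split; first exact: num_real.
by move=> y My x Bx; apply: le_trans (quotient_le Bx) (ltW My).
Qed.

Let W (x : 'rV[R]_m) : R := \int[P]_t ((f (x + s *: w t) - f x) ^+ 2).

Let idsq x : box c rho x ->
  P.-integrable setT (EFin \o (fun t => (f (x + s *: w t) - f x) ^+ 2)).
Proof.
move=> bx; apply: (@prob_integrable _ _ _ _ _ ((M + M) ^+ 2)).
  exact: (measurable_funX 2 (measurable_funB (mfx x) (measurable_cst (f x)))).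
move=> t; rewrite normrX lerXn2r ?nnegrE ?addr_ge0//.
by apply: le_trans (ler_normB _ _) _; rewrite lerD// fnorm//; [exact: shift|exact: box13].
Qed.

(** Since [a] has mean zero, [f x] may be subtracted under the integral. AM-GM with weight [e] then
    trades the first power of the increment for its square, which the energy estimate controls. *)
Let quotient_W x (e : R) : 0 < e -> box c rho x ->
  `|quotient f s x| <= e / s ^+ 2 * W x + e^-1.
Proof.
move=> e0 bx.
have iA : P.-integrable setT (EFin \o (fun t => f (x + s *: w t))).
  by apply: (prob_integrable P (mfx x)) => t; exact/fnorm/shift.
have ic c' : P.-integrable setT (EFin \o (fun=> c')).
  by apply: (@prob_integrable _ _ _ _ _ `|c'|) => // ?; exact: measurable_cst.
have iD : P.-integrable setT (EFin \o (fun t => f (x + s *: w t) - f x)).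
  exact: (integrableB measurableT iA (ic (f x))).
have ia : P.-integrable setT (EFin \o a) by apply: (prob_integrable P (circle_ma H)) (circle_le1l H).
have iaf : P.-integrable setT (EFin \o (fun t => a t * f (x + s *: w t))).
  by apply: (integrable_bounded_mul measurableT (circle_ma H) _ iA) => t _; exact: (circle_le1l H t).
have -> : quotient f s x = 2 / s * \int[P]_t (a t * (f (x + s *: w t) - f x)).
  congr (_ * _); transitivity (\int[P]_t (a t * f (x + s *: w t) - f x * a t)).
    by rewrite RintegralB ?RintegralZl ?(circle_ia H) ?mulr0 ?subr0//; exact: integrable_scale.
  by apply: eq_Rintegral => t _; ring.
have s20 : 0 <= 2 / s by rewrite divr_ge0 ?(ltW s0).
rewrite normrM (ger0_norm s20).
apply: (@le_trans _ _ (2 / s * \int[P]_t `|f (x + s *: w t) - f x|)).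
  rewrite ler_wpM2l//.
  apply: le_trans (normr_Rintegral_mul_le measurableT (circle_ma H) _ iD) _.
    by move=> t _; exact: (circle_le1l H t).
  by rewrite mul1r.
rewrite -RintegralZl//; last exact: (@integrable_norm _ _ _ _ _ (fun t => f (x + s *: w t) - f x)).
have iW : P.-integrable setT (EFin \o (fun t => e / s ^+ 2 * (f (x + s *: w t) - f x) ^+ 2)).
  by apply: integrable_scale => //; exact: idsq.
rewrite /W -RintegralZl//; last exact: idsq.
rewrite -[e^-1](prob_Rintegral_cst P) -RintegralD//.
apply: le_Rintegral => //.
- by apply: integrable_scale => //; exact: (@integrable_norm _ _ _ _ _ (fun t => f (x + s *: w t) - f x)).
- exact: integrableD iW (ic _).
- move=> t _; set D := f _ - f x.
  (* AM-GM: [2 |D| / s <= e |D|^2 / s^2 + 1 / e] *)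
  have : 0 <= e * (`|D| / s - e^-1) ^+ 2 by rewrite mulr_ge0 ?sqr_ge0// ltW.
  have -> : e * (`|D| / s - e^-1) ^+ 2 = e / s ^+ 2 * D ^+ 2 + e^-1 - 2 / s * `|D|.
    rewrite -[D ^+ 2]real_normK ?num_real//; field.
    by rewrite !gt_eqF.
  by rewrite subr_ge0.
Qed.

(** The right side of [energy] divided by [s ^+ 2] and by the lower bound of the cutoff; it no
    longer depends on [s]. *)
Definition energy_bound : R :=
  (13 * rho * M) ^+ 2 * fine (mu (row @^-1` box c (3 * rho))) / (4 * rho ^+ 4).

Let mW : measurable_fun [set: T] (W \o row).
Proof.
apply: measurableT_comp => //.
apply: (measurable_fun_integral P (G := fun z : T * T' => ((f (row z.1 + s *: w z.2) - f (row z.1)) ^+ 2)%:E)).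
apply/measurable_EFinP; apply: measurable_funX; apply: measurable_funB.
  exact: (measurable_dir_comp p q H s mf).
exact: measurableT_comp mf measurable_fst.
Qed.

Let W0 x : 0 <= W x. Proof. by apply: Rintegral_ge0 => t _; exact: sqr_ge0. Qed.

Let iWB : mu.-integrable B (EFin \o (W \o row)).
Proof.
apply: measurable_bounded_integrable => //; first exact: measurable_funTS.
exists ((M + M) ^+ 2); split; first exact: num_real.
move=> y My x Bx; apply: le_trans (ltW My); rewrite /= ger0_norm//.
rewrite -[leRHS](prob_Rintegral_cst P); apply: le_Rintegral => //.
- exact: idsq.
- by apply: (@prob_integrable _ _ _ _ _ `|(M + M) ^+ 2|) => // ?; exact: measurable_cst.
- move=> t _; rewrite -[leLHS]ger0_norm ?sqr_ge0// normrX lerXn2r ?nnegrE ?addr_ge0//.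
  by apply: le_trans (ler_normB _ _) _; rewrite lerD// fnorm//; [exact: shift|exact: box13].
Qed.

Let energyR : \int[mu]_(x in B) W (row x) <= s ^+ 2 * energy_bound.
Proof.
have r4 : 0 < 4 * rho ^+ 4 by rewrite mulr_gt0// exprn_gt0.
have := energy pq H rho0 f0 mf fM sub srho.
rewrite -/B (_ : (\int[mu]_(x in B) _)%E = (\int[mu]_(x in B) W (row x))%:E); last first.
  rewrite -EFin_Rintegral//; apply: eq_integral => x /set_mem Bx.
  by rewrite EFin_Rintegral//; exact: idsq.
have fin : mu (row @^-1` box c (3 * rho)) \is a fin_num.
  by rewrite ge0_fin_numE//; exact: leb_box_lty.
rewrite -(fineK fin) -!EFinM lee_fin /energy_bound => h.
rewrite mulrA ler_pdivlMr// mulrC; apply: le_trans h _.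
by rewrite le_eqVlt; apply/orP; left; apply/eqP; ring.
Qed.

(** Integrating [quotient_W] over [A], the [s ^+ 2] of the energy estimate cancels the denominator,
    so the bound is uniform in [s]. *)
Lemma quotient_equi_integrable (A : set T) (e : R) : measurable A -> A `<=` B -> 0 < e ->
  \int[mu]_(x in A) `|quotient f s (row x)| <= e * energy_bound + fine (mu A) / e.
Proof.
move=> mA AB e0.
have iWA : mu.-integrable A (EFin \o (W \o row)) by exact: integrableS iWB.
have Aoo : (mu A < +oo)%E by apply: le_lt_trans Boo; rewrite le_measure ?inE.
have icA : mu.-integrable A (EFin \o (fun=> e^-1)).
  apply: measurable_bounded_integrable => //; exists `|e^-1|; split; first exact: num_real.
  by move=> y My x Ax; exact: ltW.
have iqA : mu.-integrable A (EFin \o (quotient f s \o row)) by exact: integrableS integrable_quotient.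
have ieWA : mu.-integrable A (EFin \o (fun x => e / s ^+ 2 * W (row x))) by exact: integrable_scale.
apply: (@le_trans _ _ (\int[mu]_(x in A) (e / s ^+ 2 * W (row x) + e^-1))).
  apply: le_Rintegral => //.
  - exact: integrable_norm iqA.
  - exact: integrableD ieWA icA.
  - by move=> x Ax; exact: quotient_W e0 (AB _ Ax).
rewrite RintegralD// RintegralZl// Rintegral_cst// [_^-1 * _]mulrC lerD2r.
have : \int[mu]_(x in A) W (row x) <= s ^+ 2 * energy_bound.
  by apply: le_trans energyR; exact: (le_Rintegral_subset mA mB AB (fun x => W0 (row x)) iWB).
have es0 : 0 <= e / s ^+ 2 by rewrite divr_ge0 ?sqr_ge0 ?ltW.
move=> /(ler_wpM2l es0) /le_trans; apply.
by rewrite mulrA divfK// expf_neq0// gt_eqF.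
Qed.

End bounds.
End circular_quotient.

Lemma integrable_supported d (T : measurableType d) (R : realType)
    (mu : {measure set T -> \bar R}) (S : set T) (h : T -> R) (K : R) :
  measurable S -> (mu S < +oo)%E -> measurable_fun setT h ->
  (forall x, `|h x| <= K) -> (forall x, ~ S x -> h x = 0) ->
  mu.-integrable setT (EFin \o h).
Proof.
move=> mS Soo mh hK h0.
have -> : EFin \o h = (EFin \o h) \_ S.
  apply/funext => x; rewrite patchE; case: ifPn => // /negP xS /=.
  by rewrite h0// => Sx; apply: xS; exact: mem_set.
apply/(integrable_mkcond (D := S)) => //.
apply: measurable_bounded_integrable => //; first exact: measurable_funTS.
exists K; split; first exact: num_real.
by move=> y Ky x Sx; exact: le_trans (hK x) (ltW Ky).
Qed.

(** * Circular difference quotients against test functions *)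

Section test.
Context {R : realType} {m : nat} (p q : 'I_m) {d'} {T' : measurableType d'}.
Context (P : probability T' R) (a b : T' -> R).
Hypotheses (pq : p != q) (H : circle_law P a b).
Local Notation RB := (measurableTypeR R).
Local Notation T := (m.-tuple RB).
Local Notation row := (@row_of_tuple R m).
Local Notation w := (dir p q a b).
Local Notation mu := (leb m).

(** [phip] and [phiq] stand for the partial derivatives of [phi], known here only through [taylor].
    The test function vanishes off [W], and one shift from [W] stays in [W'], where [f] is
    bounded. *)
Variables (f phi phip phiq : 'rV[R]_m -> R) (W W' : set 'rV[R]_m) (M B s : R).
Hypotheses (mf : measurable_fun [set: T] (f \o row))
  (mphi : measurable_fun [set: T] (phi \o row))
  (mphip : measurable_fun [set: T] (phip \o row))
  (mphiq : measurable_fun [set: T] (phiq \o row))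
  (mW' : measurable (row @^-1` W' : set T)) (W'oo : (mu (row @^-1` W') < +oo)%E)
  (WW' : W `<=` W') (M0 : 0 <= M) (B0 : 0 <= B) (s0 : 0 < s)
  (fM : forall x, W' x -> `|f x| <= M)
  (phiB : forall x, `|phi x| <= B) (phipB : forall x, `|phip x| <= B)
  (phiqB : forall x, `|phiq x| <= B)
  (phi0 : forall x, ~ W x -> phi x = 0) (phip0 : forall x, ~ W x -> phip x = 0)
  (phiq0 : forall x, ~ W x -> phiq x = 0)
  (shift : forall x t, W x -> W' (x + s *: w t))
  (taylor : forall x t,
    `|phi (x - s *: w t) - (phi x - s * (a t * phip x + b t * phiq x))| <= B * s ^+ 2).

Let V := fine (mu (row @^-1` W')).

Let shiftN x t : phi (x - s *: w t) != 0 -> W' x.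
Proof.
move=> h; have -> : x = (x - s *: w t) + s *: w t by rewrite subrK.
by apply: shift; apply: contrapT => /phi0 e; rewrite e eqxx in h.
Qed.

Let mfw : measurable_fun [set: T * T'] (fun z : T * T' => f (row z.1 + s *: w z.2)).
Proof. exact: (measurable_dir_comp p q H s mf). Qed.

Let ma2 : measurable_fun [set: T * T'] (fun z : T * T' => a z.2).
Proof. exact: measurableT_comp (circle_ma H) measurable_snd. Qed.

Let G (z : T * T') : R := phi (row z.1) * (a z.2 * f (row z.1 + s *: w z.2)).

Let mG : measurable_fun setT G.
Proof.
apply: measurable_funM; first exact: measurableT_comp mphi measurable_fst.
exact: measurable_funM.
Qed.

Let GB z : `|G z| <= B * M * \1_(row @^-1` W') z.1.
Proof.
rewrite /G indicE; have [Wz|nWz] := pselect (W (row z.1)).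
  rewrite mem_set ?mulr1; last exact: WW'.
  rewrite normrM ler_pM// normrM -[leRHS]mul1r ler_pM// ?(circle_le1l H)//.
  exact/fM/shift.
by rewrite phi0// mul0r normr0 mulr_ge0// mulr_ge0.
Qed.

Let bound_int (k : R) : 0 <= k -> (\int[mu]_x (k * \1_(row @^-1` W') x)%:E < +oo)%E.
Proof.
move=> k0; under eq_integral do rewrite EFinM.
have mI : measurable_fun [set: T] (fun x => (\1_(row @^-1` W') x)%:E : \bar R).
  by apply/measurable_EFinP; exact: measurable_indic.
rewrite ge0_integralZl_EFin//.
by rewrite integral_indic// setIT lte_mul_pinfty.
Qed.

Let iG : (mu \x P)%E.-integrable setT (EFin \o G).
Proof.
apply/integrable12ltyP; first exact/measurable_EFinP.
apply: le_lt_trans (bound_int (mulr_ge0 B0 M0)).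
apply: ge0_le_integral => //.
- by move=> x _; apply: integral_ge0.
- apply: (measurable_fun_integral P (G := fun z => `|(EFin \o G) z|%E)).
  by apply: measurableT_comp => //; exact/measurable_EFinP.
- by apply/measurable_EFinP; apply: measurable_funM => //; exact: measurable_indic.
- move=> x _; apply: (@le_trans _ _ (\int[P]_t (B * M * \1_(row @^-1` W') x)%:E)%E).
    apply: ge0_le_integral => //.
    + apply: measurableT_comp => //; apply/measurable_EFinP.
      exact: (measurable_fun_pair2 x mG).
    + by move=> t _; rewrite lee_fin; exact: (GB (x, t)).
  rewrite integral_cst// [X in (_ * X)%E](_ : _ = 1%E) ?mule1//; exact: probability_setT.
Qed.

Let J (t : T') : R := \int[mu]_x (phi (row x - s *: w t) * f (row x)).

Let mphiw : measurable_fun [set: T * T'] (fun z : T * T' => phi (row z.1 - s *: w z.2)).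
Proof.
by apply: eq_measurable_fun (measurable_dir_comp p q H (- s) mphi) => z _ /=; rewrite scaleNr.
Qed.

Let mphif : measurable_fun [set: T * T'] (fun z : T * T' => phi (row z.1 - s *: w z.2) * f (row z.1)).
Proof. by apply: measurable_funM => //; exact: measurableT_comp mf measurable_fst. Qed.

Let mJ : measurable_fun setT J.
Proof.
apply: measurableT_comp => //.
apply: (measurable_fun_integral mu (G := fun z : T' * T => (phi (row z.2 - s *: w z.1) * f (row z.2))%:E)).
apply/measurable_EFinP.
have := measurableT_comp mphif (@measurable_swap _ _ T' T).
by apply: eq_measurable_fun => z _.
Qed.

Let iphif t : mu.-integrable setT (EFin \o (fun x => phi (row x - s *: w t) * f (row x))).
Proof.
apply: (integrable_supported mW' W'oo (K := B * M)).
- exact: (measurable_fun_pair1 t mphif).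
- move=> x; have [->|h] := eqVneq (phi (row x - s *: w t)) 0.
    by rewrite mul0r normr0 mulr_ge0.
  by rewrite normrM ler_pM//; exact/fM/(shiftN h).
- move=> x nWx; have [->|h] := eqVneq (phi (row x - s *: w t)) 0; first by rewrite mul0r.
  by have := nWx (shiftN h).
Qed.

Let supported_int (g : 'rV[R]_m -> R) : measurable_fun [set: T] (g \o row) ->
  (forall x, `|g x| <= B) -> (forall x, ~ W x -> g x = 0) ->
  mu.-integrable setT (EFin \o (fun x => g (row x) * f (row x))).
Proof.
move=> mg gB g0; apply: (integrable_supported mW' W'oo (K := B * M)).
- exact: measurable_funM.
- move=> x; have [Wx|nWx] := pselect (W (row x)); last by rewrite g0// mul0r normr0 mulr_ge0.
  by rewrite normrM ler_pM//; exact/fM/WW'.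
- by move=> x nWx; rewrite g0 ?mul0r// => /WW'.
Qed.

(** Fubini and a translation move the shift from [f] onto the test function. *)
Let step1 : \int[mu]_x (phi (row x) * quotient p q P a b f s (row x)) =
  2 / s * \int[P]_t (a t * J t).
Proof.
have -> : \int[P]_t (a t * J t) = fine (\int[mu]_x \int[P]_t (G (x, t))%:E)%E.
  rewrite (Fubini iG); congr fine; apply: eq_integral => t _.
  pose F (y : 'rV[R]_m) := (a t * (phi (y - s *: w t) * f y))%:E.
  transitivity (\int[mu]_x F (row x))%E.
    rewrite EFinM /J -EFin_Rintegral//.
    by rewrite -integralZl//; exact: iphif.
  rewrite -(integral_row_translate (s *: w t)).
    by apply: eq_integral => x _; rewrite /F /G addrK /=; congr EFin; ring.
  apply/measurable_EFinP; apply: measurable_funM => //.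
  exact: (measurable_fun_pair1 t mphif).
rewrite -[2 / s * _]/(fine (2 / s)%:E * _) -fineM//; last first.
  by apply: integrable_fin_num => //; exact: integrable_fubini_F iG.
congr fine; rewrite -integralZl//; last exact: integrable_fubini_F iG.
apply: eq_integral => x _; rewrite /G /quotient.
have [Wx|nWx] := pselect (W (row x)); last first.
  rewrite phi0// mul0r integral0_eq ?mule0// => t _.
  by rewrite mul0r.
have iaf : P.-integrable setT (EFin \o (fun t => a t * f (row x + s *: w t))).
  apply: (@prob_integrable _ _ _ _ _ M).
    apply: measurable_funM; first exact: circle_ma H.
    exact: (measurable_fun_pair2 x mfw).
  move=> t; rewrite normrM -[M]mul1r ler_pM// ?(circle_le1l H)//.
  exact/fM/shift.
rewrite EFin_Rintegral//; last exact: (integrable_scale (phi (row x)) measurableT iaf).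
rewrite /= RintegralZl//.
by rewrite -EFinM; congr EFin; ring.
Qed.

Let A0 := \int[mu]_x (phi (row x) * f (row x)).
Let Ap := \int[mu]_x (phip (row x) * f (row x)).
Let Aq := \int[mu]_x (phiq (row x) * f (row x)).

(** By [taylor], [J t] is affine in [a t] and [b t] up to an error of order [s ^+ 2]. *)
Let step2 t : `|J t - (A0 - s * (a t * Ap + b t * Aq))| <= B * s ^+ 2 * M * V.
Proof.
have ip := supported_int mphip phipB phip0.
have iq := supported_int mphiq phiqB phiq0.
have i0 := supported_int mphi phiB phi0.
have ipq : mu.-integrable setT (EFin \o (fun x => a t * (phip (row x) * f (row x)) + b t * (phiq (row x) * f (row x)))).
  by apply: (integrableD _ (integrable_scale _ _ ip) (integrable_scale _ _ iq)).
have is_ := integrable_scale s measurableT ipq.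
have iL := integrableB measurableT i0 is_.
have -> : A0 - s * (a t * Ap + b t * Aq) =
    \int[mu]_x (phi (row x) * f (row x) - s * (a t * (phip (row x) * f (row x)) + b t * (phiq (row x) * f (row x)))).
  rewrite RintegralB// RintegralZl// RintegralD//; try exact: integrable_scale.
  by rewrite !RintegralZl.
rewrite -RintegralB//.
have -> : \int[mu]_x (phi (row x - s *: w t) * f (row x) -
    (phi (row x) * f (row x) - s * (a t * (phip (row x) * f (row x)) + b t * (phiq (row x) * f (row x))))) =
  \int[mu]_(x in row @^-1` W') ((phi (row x - s *: w t) - (phi (row x) - s * (a t * phip (row x) + b t * phiq (row x)))) * f (row x)).
  rewrite [RHS]Rintegral_mkcond; apply: eq_Rintegral => x _; rewrite patchE.
  case: ifPn => [_|/negP nW]; first by ring.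
  have nW' : ~ W' (row x) by move=> h; apply: nW; exact: mem_set.
  have nWx : ~ W (row x) by move/WW'.
  have -> : phi (row x - s *: w t) = 0.
    by apply/eqP; apply: contraT => /shiftN.
  by rewrite phi0// phip0// phiq0// !(mul0r, mulr0, addr0, subr0).
have iF : mu.-integrable (row @^-1` W') (EFin \o (f \o row)).
  apply: measurable_bounded_integrable => //; first exact: measurable_funTS.
  exists M; split; first exact: num_real.
  by move=> y My x /fM h; exact: le_trans h (ltW My).
apply: (le_trans (normr_Rintegral_mul_le _ _ _ iF)) => //.
- apply: measurable_funTS; apply: measurable_funB.
    exact: (measurable_fun_pair1 t mphiw).
  apply: measurable_funB => //; apply: measurable_funM => //.
  by apply: measurable_funD => //; apply: measurable_funM.
rewrite -[leRHS]mulrA; apply: ler_wpM2l; first by rewrite mulr_ge0 ?sqr_ge0.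
have <- : \int[mu]_(x in row @^-1` W') M = M * V by rewrite Rintegral_cst.
apply: le_Rintegral => //; first exact: integrable_norm iF.
  apply: measurable_bounded_integrable => //; exists `|M|; split; first exact: num_real.
  by move=> y My x _; exact: ltW.
by move=> x /fM.
Qed.

(** Averaging [a] times the affine part of [J] leaves [- (s * Ap) / 2], by the moments of the
    circle. The factor [2 / s] turns this into [- Ap] and the quadratic error into one of order
    [s]. *)
Lemma quotient_test :
  `|\int[mu]_x (phi (row x) * quotient p q P a b f s (row x)) +
    \int[mu]_x (phip (row x) * f (row x))| <= 2 * (B * M * V) * s.
Proof.
rewrite step1 -/Ap.
pose L t := A0 - s * (a t * Ap + b t * Aq).
have ia : P.-integrable setT (EFin \o a) by apply: (prob_integrable P (circle_ma H)) (circle_le1l H).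
have iaa : P.-integrable setT (EFin \o (fun t => a t ^+ 2)).
  apply: (@prob_integrable _ _ _ _ _ 1); first exact: (measurable_funX 2 (circle_ma H)).
  by move=> t; rewrite normrX expr_le1// (circle_le1l H).
have iab : P.-integrable setT (EFin \o (fun t => a t * b t)).
  apply: (@prob_integrable _ _ _ _ _ 1); first exact: (measurable_funM (circle_ma H) (circle_mb H)).
  by move=> t; rewrite normrM mulr_ile1// ?(circle_le1l H)// (circle_le1r H).
have mL : measurable_fun setT L.
  apply: measurable_funB => //; apply: measurable_funM => //.
  by apply: measurable_funD; apply: measurable_funM => //; [exact: circle_ma H|exact: circle_mb H].
have iaaS := integrable_scale (s * Ap) measurableT iaa.
have iabS := integrable_scale (s * Aq) measurableT iab.
have iaS := integrable_scale A0 measurableT ia.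
have iaL : P.-integrable setT (EFin \o (fun t => a t * L t)).
  have := integrableB measurableT (integrableB measurableT iaS iaaS) iabS.
  by apply: eq_integrable => // t _ /=; rewrite -!EFinB /L; congr EFin; ring.
have aL : \int[P]_t (a t * L t) = - (s * Ap) / 2.
  transitivity (\int[P]_t (A0 * a t - s * Ap * a t ^+ 2 - s * Aq * (a t * b t))).
    by apply: eq_Rintegral => t _; rewrite /L; ring.
  rewrite RintegralB//; last exact: integrableB iaS iaaS.
  rewrite RintegralB// !RintegralZl// (circle_ia H) (circle_iaa H) (circle_iab H).
  by field.
pose K := B * s ^+ 2 * M * V.
have JL t : `|J t - L t| <= K by exact: step2.
have iJL : P.-integrable setT (EFin \o (fun t => J t - L t)).
  by apply: (@prob_integrable _ _ _ _ _ K) => //; exact: measurable_funB.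
have iaJL : P.-integrable setT (EFin \o (fun t => a t * (J t - L t))).
  by apply: (integrable_bounded_mul measurableT (circle_ma H) _ iJL) => t _; exact: (circle_le1l H t).
have -> : \int[P]_t (a t * J t) = \int[P]_t (a t * (J t - L t)) - (s * Ap) / 2.
  rewrite -mulNr -aL -RintegralD//; apply: eq_Rintegral => t _; ring.
have -> : 2 / s * (\int[P]_t (a t * (J t - L t)) - s * Ap / 2) + Ap =
    2 / s * \int[P]_t (a t * (J t - L t)).
  by field; rewrite gt_eqF.
have s20 : 0 <= 2 / s by rewrite divr_ge0 ?(ltW s0).
rewrite normrM (ger0_norm s20).
have -> : 2 * (B * M * V) * s = 2 / s * K.
  by rewrite /K; field; rewrite gt_eqF.
rewrite ler_wpM2l//.
apply: le_trans (normr_Rintegral_mul_le measurableT (circle_ma H) _ iJL) _.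
  by move=> t _; exact: (circle_le1l H t).
rewrite mul1r -[leRHS](prob_Rintegral_cst P); apply: le_Rintegral => //.
- exact: integrable_norm iJL.
- by apply: (@prob_integrable _ _ _ _ _ `|K|) => // ?; exact: measurable_cst.
Qed.

End test.

(** * Weak partial derivatives of subharmonic functions *)

Section directional.
Context {R : realType} {m : nat}.
Implicit Types (phi : 'rV[R]_m -> R) (i j : 'I_m) (x : 'rV[R]_m).
Local Notation e i := (delta_mx ord0 i : 'rV[R]_m).

Lemma line_is_derive phi i x (u : R) : (forall y, derivable phi y (e i)) ->
  is_derive u (1 : R) (fun u : R => phi (x + u *: e i)) ('D_(e i) phi (x + u *: e i)).
Proof.
move=> dphi.
have E : (fun h : R => h^-1 *: (phi (x + (h *: (1 : R) + u) *: e i) - phi (x + u *: e i))) =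
    (fun h => h^-1 *: (phi (h *: e i + (x + u *: e i)) - phi (x + u *: e i))).
  apply/funext => h; congr (_ *: (phi _ - _)).
  by rewrite [h *: 1]mulr1 scalerDl addrCA.
have dg : derivable (fun u : R => phi (x + u *: e i)) u (1 : R).
  by rewrite /derivable /= E; exact: dphi.
by apply: DeriveDef => //; rewrite /derive /= E.
Qed.

Lemma directional_MVT phi i x (h : R) : (forall y, derivable phi y (e i)) ->
  exists2 t, `|t| <= `|h| &
    phi (x + h *: e i) - phi x = h * 'D_(e i) phi (x + t *: e i).
Proof.
move=> dphi.
have pos (y : 'rV[R]_m) (k : R) : 0 <= k -> exists2 t, 0 <= t <= k &
    phi (y + k *: e i) - phi y = k * 'D_(e i) phi (y + t *: e i).
  move=> k0; pose g (u : R) := phi (y + u *: e i).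
  have dg (u : R) : is_derive u (1 : R) g ('D_(e i) phi (y + u *: e i)) by exact: line_is_derive.
  have cg : {within `[0, k], continuous g}.
    apply: continuous_subspaceT => u.
    by apply: differentiable_continuous; apply/derivable1_diffP; case: (dg u).
  have [t tk] := MVT_segment k0 (fun u _ => dg u) cg.
  by rewrite /g scale0r addr0 subr0 mulrC => ->; exists t.
have [h0|h0] := leP 0 h.
  have [t /andP[t0 th] E] := pos x h h0; exists t => //.
  by rewrite !ger0_norm.
(* For [h < 0] the segment is traversed from its other end. *)
have nh0 : 0 <= - h by rewrite oppr_ge0 ltW.
have [t /andP[t0 th]] := pos (x + h *: e i) (- h) nh0.
rewrite scaleNr addrK => E; exists (h + t).
  by rewrite ler0_norm ?(ltr0_norm h0); lra.
by rewrite scalerDl addrA -opprB E mulNr opprK.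
Qed.

Lemma directional_lipschitz phi i x (h B : R) : (forall y, derivable phi y (e i)) ->
  (forall y, `|'D_(e i) phi y| <= B) -> `|phi (x + h *: e i) - phi x| <= B * `|h|.
Proof.
move=> dphi dB; have [t _ ->] := directional_MVT x h dphi.
by rewrite normrM mulrC ler_wpM2r.
Qed.

Lemma directional_taylor phi i x (h B : R) : (forall y, derivable phi y (e i)) ->
  (forall y, derivable ('D_(e i) phi) y (e i)) ->
  (forall y, `|'D_(e i) ('D_(e i) phi) y| <= B) ->
  `|phi (x + h *: e i) - phi x - h * 'D_(e i) phi x| <= B * h ^+ 2.
Proof.
move=> dphi ddphi dB; have [t th ->] := directional_MVT x h dphi.
rewrite -mulrBr normrM.
have B0 : 0 <= B by exact: le_trans (dB x).
apply: (@le_trans _ _ (`|h| * (B * `|h|))).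
  rewrite ler_wpM2l//; apply: le_trans (directional_lipschitz x t ddphi dB) _.
  by rewrite ler_wpM2l.
by rewrite -[h ^+ 2]real_normK ?num_real// expr2 mulrCA.
Qed.

(** Two expansions on lines, along [e i] and then [e j]; the mixed derivative compares the [e j]
    derivative at the two corners. Each of the three errors is at most [B * s ^+ 2]. Only coordinate
    derivatives enter, which is what [smooth] provides. *)
Lemma planar_taylor phi i j x (u v s B : R) : `|u| <= s -> `|v| <= s ->
  (forall y, derivable phi y (e i)) -> (forall y, derivable phi y (e j)) ->
  (forall y, derivable ('D_(e i) phi) y (e i)) ->
  (forall y, derivable ('D_(e j) phi) y (e j)) ->
  (forall y, derivable ('D_(e j) phi) y (e i)) ->
  (forall y, `|'D_(e i) ('D_(e i) phi) y| <= B) ->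
  (forall y, `|'D_(e j) ('D_(e j) phi) y| <= B) ->
  (forall y, `|'D_(e i) ('D_(e j) phi) y| <= B) ->
  `|phi (x + u *: e i + v *: e j) - (phi x + (u * 'D_(e i) phi x + v * 'D_(e j) phi x))|
   <= 3 * B * s ^+ 2.
Proof.
move=> us vs di dj dii djj dij Bii Bjj Bij.
have B0 : 0 <= B by exact: le_trans (Bii x).
have s0 : 0 <= s by exact: le_trans us.
have h1 := directional_taylor x u di dii Bii.
have h2 := directional_taylor (x + u *: e i) v dj djj Bjj.
have h3 := directional_lipschitz x u dij Bij.
have h4 : `|v * ('D_(e j) phi (x + u *: e i) - 'D_(e j) phi x)| <= B * s ^+ 2.
  rewrite normrM; apply: (@le_trans _ _ (s * (B * s))).
    by rewrite ler_pM//; apply: le_trans h3 _; rewrite ler_wpM2l.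
  by rewrite expr2 mulrCA.
have sq (t : R) : `|t| <= s -> B * t ^+ 2 <= B * s ^+ 2.
  by move=> ts; rewrite ler_wpM2l// -[t ^+ 2]real_normK ?num_real// lerXn2r ?nnegrE.
have := le_trans h1 (sq _ us); have := le_trans h2 (sq _ vs).
move: h4; rewrite mulrBr.
set y := x + u *: e i; set A := phi (y + _); set u1 := phi y; set u0 := phi x.
set d1 := v * _; set d2 := v * _; set d3 := u * _; move=> h4 h2' h1'.
have -> : A - (u0 + (d3 + d2)) = (A - u1 - d1) + (d1 - d2) + (u1 - u0 - d3).
  by move: A u1 u0 d1 d2 d3 {h4 h2' h1'} => ? ? ? ? ? ?; ring.
have -> : 3 * B * s ^+ 2 = B * s ^+ 2 + B * s ^+ 2 + B * s ^+ 2 by ring.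
by do 2 (apply: le_trans (ler_normD _ _) _; apply: lerD => //).
Qed.

End directional.

Section test_functions.
Context {R : realType} {m : nat}.
Implicit Types (phi : 'rV[R]_m -> R) (K : set 'rV[R]_m).

Lemma test_function_in_partial K phi j : compact K -> test_function_in K phi ->
  test_function_in K (partial j phi).
Proof.
move=> cK [sphi phi0]; split.
  by move=> s; have := sphi (rcons s j); rewrite /iter_partial foldr_rcons.
move=> x nKx; rewrite /partial.
have oK : open (~` K) by apply: closed_openC; apply: compact_closed => //; exact: norm_hausdorff.
have /(near_eq_derive (delta_mx ord0 j)) -> : {near x, phi =1 cst 0}.
  by apply: filterS (open_nbhs_nbhs (conj oK nKx)) => y nKy; rewrite phi0.
by rewrite derive_cst.
Qed.

Lemma test_function_in_continuous K phi : test_function_in K phi -> continuous phi.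
Proof. by move=> [/(_ [::])[]]. Qed.

Lemma test_function_in_derivable K phi j x : test_function_in K phi ->
  derivable phi x (delta_mx ord0 j).
Proof. by move=> [/(_ [::])[_ +] _]; exact. Qed.

Lemma continuous_supported_bounded K phi : compact K -> continuous phi ->
  (forall x, ~ K x -> phi x = 0) -> exists2 B, 0 <= B & forall x, `|phi x| <= B.
Proof.
move=> cK cphi phi0.
have /compact_bounded[M [_ hM]] : compact (phi @` K).
  by apply: continuous_compact => //; exact: continuous_subspaceT.
exists (`|M| + 1); first by rewrite addr_ge0.
move=> x; have [Kx|nKx] := pselect (K x).
  by apply: (hM (`|M| + 1)); [rewrite ltr_pwDr// ler_norm|exists x].
by rewrite phi0// normr0 addr_ge0.
Qed.

Lemma test_function_in_bounded K phi : compact K -> test_function_in K phi ->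
  exists2 B, 0 <= B & forall x, `|phi x| <= B.
Proof.
move=> cK tphi; apply: (continuous_supported_bounded cK).
  exact: test_function_in_continuous tphi.
by case: tphi.
Qed.

End test_functions.

Lemma Rintegral_partition d (T : measurableType d) (R : realType)
    (mu : {measure set T -> \bar R}) (A : nat -> set T) (N : nat) (h : T -> R) :
  (forall j, measurable (A j)) -> trivIset setT A ->
  (forall j, (j < N)%N -> mu.-integrable (A j) (EFin \o h)) ->
  (forall x, (forall j, (j < N)%N -> ~ A j x) -> h x = 0) ->
  mu.-integrable setT (EFin \o h) /\
  \int[mu]_x h x = \sum_(j < N) \int[mu]_(x in A j) h x.
Proof.
move=> mA tA ih h0.
have i_ (j : 'I_N) : mu.-integrable setT (EFin \o (fun x => (h \_ (A j)) x)).
  have /(integrable_mkcond _ (mA j)) := ih j (ltn_ord j).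
  by apply: eq_integrable => // x _; rewrite /= restrict_EFin.
have hE x : h x = \sum_(j < N) (h \_ (A j)) x.
  have [[j [jN Ajx]]|nA] := pselect (exists j, (j < N)%N /\ A j x).
    rewrite (bigD1 (Ordinal jN))//= big1 ?addr0.
      by rewrite patchE mem_set.
    move=> i ij; rewrite patchE memNset// => Aix.
    have /val_inj : val i = val (Ordinal jN).
      exact: (tA i j Logic.I Logic.I (ex_intro _ x (conj Aix Ajx))).
    by move=> e; rewrite e eqxx in ij.
  rewrite h0; last by move=> j jN Ajx; apply: nA; exists j.
  rewrite big1// => j _; rewrite patchE memNset// => Ajx.
  by apply: nA; exists j.
split.
  apply: (eq_integrable measurableT (fun x => \sum_(j < N) (EFin \o (h \_ (A j))) x)%E).
    by move=> x _; rewrite /= sumEFin -hE.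
  exact: integrable_sum.
under eq_Rintegral do rewrite hE.
rewrite Rintegral_sum//; apply: eq_bigr => j _.
by rewrite [RHS]Rintegral_mkcond.
Qed.

Definition weak_partial {R : realType} {m} (D : set 'rV[R]_m) (j : 'I_m)
    (f v : 'rV[R]_m -> R) :=
  [/\ L1loc D f, L1loc D v & forall phi, test_function D phi ->
    rint (fun x => v x * phi x) = - rint (fun x => f x * partial j phi x)].

(** Near-covering compactness with the bound itself as parameter: each local bound is eventually
    below [N], hence [N] can be chosen uniformly on [K]. *)
Lemma locally_bounded_compact {R : realType} {m} (D K : set 'rV[R]_m) (g : 'rV[R]_m -> R) :
  (forall x, D x -> exists r M : R, 0 < r /\ forall y, box x r y -> g y <= M) ->
  compact K -> K `<=` D -> exists2 M : R, 0 <= M & forall x, K x -> g x <= M.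
Proof.
move=> lb /compact_near_coveringP cK KD.
have [] := cK nat \oo (fun N x => g x <= N%:R).
  move=> x Kx; have [r [M [r0 hM]]] := lb _ (KD _ Kx).
  exists (box x r, [set N | M <= N%:R]) => /=.
    by split; [exact: nbhs_box|exact: nbhs_infty_ger].
  by move=> [x' N] /= [/hM]; exact: le_trans.
by move=> N _ hN; exists N%:R => // x Kx; exact: (hN N (leqnn N) x Kx).
Qed.

(** * Gluing local weak limits into a weak partial derivative *)

Section weak_partial_existence.
Context {R : realType} {m : nat} (p q : 'I_m) {d'} {T' : measurableType d'}.
Context (P : probability T' R) (a b : T' -> R).
Hypotheses (pq : p != q) (H : circle_law P a b).
Local Notation RB := (measurableTypeR R).
Local Notation T := (m.-tuple RB).
Local Notation row := (@row_of_tuple R m).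
Local Notation w := (dir p q a b).
Local Notation mu := (leb m).

Variables (D : set 'rV[R]_m) (g : 'rV[R]_m -> R).
Hypotheses (oD : open D) (g0 : forall x, 0 <= g x)
  (mg : measurable_fun [set: T] (g \o row))
  (lb : forall x, D x -> exists r M : R, 0 < r /\ forall y, box x r y -> g y <= M)
  (sub : forall x (r M s : R), box x r `<=` D -> (forall y, box x r y -> g y <= M) ->
    0 < s < r -> g x <= \int[P]_t g (x + s *: w t)).

(** Rational data make these boxes countable, so they can be made disjoint in sequence; by [cover]
    they still cover [D]. *)
Let good (i : m.-tuple rat * rat) : Prop :=
  0 < ratr i.2 :> R /\ box (ratrow i.1) (4 * ratr i.2) `<=` D /\
  exists M : R, forall y, box (ratrow i.1) (4 * ratr i.2) y -> g y <= M.

(** Not every number encodes a good box; [ok] discards the others, for which [cc] and [rho] take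
    dummy values. *)
Let ok (j : nat) : Prop :=
  if (unpickle j : option (m.-tuple rat * rat)) is Some i then good i else False.

Let cc (j : nat) : 'rV[R]_m :=
  if (unpickle j : option (m.-tuple rat * rat)) is Some i then ratrow i.1 else 0.

Let rho (j : nat) : R :=
  if (unpickle j : option (m.-tuple rat * rat)) is Some i then ratr i.2 else 0.

Let okP j : ok j -> [/\ 0 < rho j, box (cc j) (4 * rho j) `<=` D &
  exists M : R, forall y, box (cc j) (4 * rho j) y -> g y <= M].
Proof. by rewrite /ok /cc /rho; case: unpickle => // i [? []]. Qed.

Let cover x : D x -> exists2 j, ok j & box (cc j) (rho j) x.
Proof.
move=> Dx; have [r1 r10 r1D] := nbhs_boxP (open_nbhs_nbhs (conj oD Dx)).
have [r2 [M [r20 hM]]] := lb Dx.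
have r0 : 0 < Num.min r1 r2 by rewrite lt_min r10.
have [qq [e [e0 qx sub_]]] := rational_box x r0.
exists (pickle (qq, e)); last by rewrite /cc /rho pickleK.
rewrite /ok pickleK; split => //; split.
  by apply: subset_trans sub_ (subset_trans _ r1D); apply: box_subset; rewrite ge_min lexx.
exists M => y /sub_ h; apply: hM; apply: box_subset h.
by rewrite ge_min lexx orbT.
Qed.

Let E (j : nat) : set T := [set t | ok j /\ box (cc j) (rho j) (row t)].

Let mE j : measurable (E j).
Proof.
have [oj|noj] := pselect (ok j).
  rewrite (_ : E j = row @^-1` box (cc j) (rho j)); first exact: measurable_box.
  by apply/seteqP; split => t // [].
by rewrite (_ : E j = set0)//; apply/seteqP; split => t // [].
Qed.

(** On disjoint pieces the local densities glue without any check of agreement on overlaps. *)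
Let A := seqDU E.

Let mA j : measurable (A j).
Proof. by apply: measurableD => //; apply: bigsetU_measurable. Qed.

Let AE j : A j `<=` E j. Proof. by move=> t []. Qed.

Let tA : trivIset setT A. Proof. exact: trivIset_seqDU. Qed.

Let compact_cover_boxes K : compact K -> K `<=` D ->
  exists N, forall x, K x -> exists j, (j < N)%N /\ ok j /\ box (cc j) (rho j) x.
Proof.
move=> /compact_near_coveringP cK KD.
have [] := cK nat \oo (fun N x => exists j, (j < N)%N /\ ok j /\ box (cc j) (rho j) x).
  move=> x Kx; have [j oj bj] := cover (KD x Kx).
  have [rj _ _] := okP oj.
  exists (box (cc j) (rho j), [set N | (j < N)%N]) => /=.
    by split; [apply: open_nbhs_nbhs; split => //; exact: box_open|exact: nbhs_infty_gt].
  by move=> [x' N] /= [bx jN]; exists j.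
by move=> N _ hN; exists N => x Kx; exact: (hN N (leqnn N) x Kx).
Qed.

Let cover_A K : compact K -> K `<=` D -> exists N, forall t, K (row t) ->
  exists2 j, (j < N)%N & A j t.
Proof.
move=> cK KD; have [N hN] := compact_cover_boxes cK KD; exists N => t /hN[j [jN [oj bj]]].
have : (\big[setU/set0]_(i < N) E i) t.
  by rewrite -bigcup_mkord; exists j.
by rewrite bigsetU_seqDU -bigcup_mkord => -[i iN Ait]; exists i.
Qed.

Let sn (n : nat) : R := n.+1%:R^-1.
Let F (n : nat) (t : T) : R := quotient p q P a b g (sn n) (row t).

Let sn_small (r : R) : 0 < r -> \forall n \near \oo, 0 < sn n <= r.
Proof.
move=> r0; have /cvgrPdist_le/(_ r r0) := @cvg_harmonic R.
apply: filterS => n; rewrite sub0r normrN => h.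
by rewrite invr_gt0 ltr0n /= (le_trans (ler_norm _)).
Qed.

(** The radius 4 splits as 2 + 2: a point within [2 * rho j] of the centre still has its box of
    radius [2 * rho j] inside [D], and [s <= rho j] is strictly smaller than that. *)
Let box_hyps j : ok j -> exists M : R,
  (forall x, box (cc j) (3 * rho j) x -> g x <= M) /\
  (forall x s, box (cc j) (2 * rho j) x -> 0 < s <= rho j ->
    g x <= \int[P]_t g (x + s *: w t)).
Proof.
move=> /okP[rj bD [M hM]]; exists M; split.
  by move=> x bx; apply: hM; apply: box_subset bx; rewrite ler_pM2r// ler_nat.
move=> x s bx /andP[s0 srho].
have xb : box x (2 * rho j) `<=` box (cc j) (4 * rho j).
  by move=> y /(box_trans bx); apply: box_subset; lra.
apply: (@sub x (2 * rho j) M) => //.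
- exact: subset_trans xb bD.
- by move=> y /xb /hM.
- by rewrite s0 (le_lt_trans srho)// ltr_pMl ?ltr1n.
Qed.

Context (U : set_system nat) (UU : UltraFilter U) (ooU : \oo `<=` U).

(** The same [U] serves every [j], which replaces a diagonal argument. If [j] is not [ok], the piece
    is empty and the zero density works. *)
Let local_density j : exists v : T -> R,
  mu.-integrable setT (EFin \o v) /\
  forall (phi : T -> R) (M' : R), measurable_fun setT phi -> (forall x, `|phi x| <= M') ->
  (fun n => \int[mu]_(x in A j) (phi x * F n x)) @ U -->
  \int[mu]_(x in A j) (phi x * v x).
Proof.
have [oj|noj] := pselect (ok j); last first.
  have A0 : A j = set0 by apply/seteqP; split => t // /AE [].
  exists (fun=> 0); split.
    rewrite (_ : EFin \o _ = cst 0%E)//; exact: integrable0.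
  move=> phi M' _ _; rewrite A0 Rintegral_set0.
  by under eq_fun do rewrite Rintegral_set0; exact: cvg_cst.
have [M [gM gsub]] := box_hyps oj.
have [rj _ _] := okP oj.
have EE : E j = row @^-1` box (cc j) (rho j).
  by apply/seteqP; split => t // [].
have AB : A j `<=` row @^-1` box (cc j) (rho j) by rewrite -EE; exact: AE.
have mb : measurable (row @^-1` box (cc j) (rho j) : set T) by exact: measurable_box.
apply: (@weak_compactness _ T R mu U (A j) F (energy_bound (cc j) (rho j) M)) => //.
- by apply: le_lt_trans (leb_box_lty (cc j) (rho j)); rewrite le_measure ?inE.
- apply: ooU; apply: filterS (sn_small rj) => n sr.
  by apply: integrableS (integrable_quotient pq H rj g0 mg gM sr).
- apply: ooU; apply: filterS (sn_small rj) => n sr B e mB BA e0.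
  by apply: (quotient_equi_integrable pq H rj g0 mg gM gsub sr) => //; exact: subset_trans AB.
Qed.

Let vj j : T -> R := sval (cid (local_density j)).

Let vj_int j : mu.-integrable setT (EFin \o vj j).
Proof. by rewrite /vj; case: cid => ? []. Qed.

Let vj_cvg j (phi : T -> R) (M' : R) : measurable_fun setT phi -> (forall x, `|phi x| <= M') ->
  (fun n => \int[mu]_(x in A j) (phi x * F n x)) @ U -->
  \int[mu]_(x in A j) (phi x * vj j x).
Proof. by move=> mphi phiM; rewrite /vj; case: cid => ? /= [_]; exact. Qed.

(** At most one index qualifies, the pieces being disjoint. The default index 0 is taken only
    outside all pieces, which by [cover_A] means outside every compact subset of [D]. *)
Let v (x : 'rV[R]_m) : R := vj (xget 0%N [set j | A j (tuple_of_row x)]) (tuple_of_row x).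

Let vE j t : A j t -> v (row t) = vj j t.
Proof.
move=> Ajt; rewrite /v row_of_tupleK.
case: xgetP => [i _ /= Ait|/(_ j)]; last by [].
by rewrite (tA Logic.I Logic.I (ex_intro _ t (conj Ait Ajt))).
Qed.

Let v_int j : mu.-integrable (A j) (EFin \o (v \o row)).
Proof.
apply: (eq_integrable (mA j) (EFin \o vj j)).
  by move=> t /set_mem At; rewrite /= (vE At).
by apply: integrableS (vj_int j).
Qed.

Let L1loc_v : L1loc D v.
Proof.
move=> K cK KD; have [N hN] := cover_A cK KD.
have mK := measurable_row_compact cK.
have [i _] : mu.-integrable setT (EFin \o (fun t => (v \o row) t * \1_(row @^-1` K) t)) /\
   \int[mu]_t ((v \o row) t * \1_(row @^-1` K) t) =
   \sum_(j < N) \int[mu]_(t in A j) ((v \o row) t * \1_(row @^-1` K) t).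
  apply: Rintegral_partition => //.
    move=> j jN.
    rewrite (_ : (fun t => _) = (fun t => \1_(row @^-1` K) t * (v \o row) t)); last first.
      by apply/funext => t; rewrite mulrC.
    apply: (integrable_bounded_mul (mA j) _ (M := 1)) => //.
    by move=> t _; rewrite indicE; case: (_ \in _); rewrite ?normr1 ?normr0.
  move=> t h; rewrite indicE memNset ?mulr0// => /hN[j jN Ajt].
  exact: h jN Ajt.
have := integrableS measurableT mK (@subsetT _ _) i.
by apply: eq_integrable => // t tK; rewrite /= indicE tK mulr1.
Qed.

Lemma L1loc_locally_bounded : L1loc D g.
Proof.
move=> K cK KD; have [M M0 hM] := locally_bounded_compact lb cK KD.
have mK := measurable_row_compact cK.
apply: measurable_bounded_integrable => //.
- have /compact_bounded[B [_ hB]] := cK.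
  have BK : K `<=` box 0 (`|B| + 2).
    move=> x Kx i; rewrite mxE subr0.
    have /= : `|x| <= `|B| + 1 by apply: hB => //; rewrite ltr_pwDr// ler_norm.
    rewrite [`|x|]mx_normrE => /bigmax_leP[_ /(_ (ord0, i) isT)] /= h.
    by apply: le_lt_trans h _; rewrite ltrD2l ltr1n.
  apply: le_lt_trans (leb_box_lty (0 : 'rV[R]_m) (`|B| + 2)).
  by rewrite le_measure ?inE//; [exact: measurable_box|move=> t /BK].
- exact: measurable_funTS.
- exists M; split; first exact: num_real.
  by move=> y My t Kt; rewrite /= ger0_norm//; apply: le_trans (hM _ Kt) (ltW My).
Qed.

Let eventually_small N : \forall n \near \oo, forall j, (j < N)%N -> ok j -> 0 < sn n <= rho j.
Proof.
elim: N => [|N IH]; first by apply: nearW.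
have [oN|noN] := pselect (ok N); last first.
  apply: filterS IH => n IH j; rewrite ltnS leq_eqVlt => /predU1P[->//|]; exact: IH.
have [rN _ _] := okP oN.
apply: filterS2 IH (sn_small rN) => n IH h j; rewrite ltnS leq_eqVlt => /predU1P[->//|]; exact: IH.
Qed.

Let uniform_bound N : exists2 M : R, 0 <= M &
  forall j, (j < N)%N -> ok j -> forall x, box (cc j) (3 * rho j) x -> g x <= M.
Proof.
elim: N => [|N [M M0 IH]]; first by exists 0.
have [oN|noN] := pselect (ok N); last first.
  by exists M => // j; rewrite ltnS leq_eqVlt => /predU1P[->//|]; exact: IH.
have [M' [hM' _]] := box_hyps oN.
exists (Num.max M M'); first by rewrite le_max M0.
move=> j; rewrite ltnS leq_eqVlt => /predU1P[->|jN] oj x bx; rewrite le_max.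
  by rewrite hM' ?orbT.
by rewrite (IH j).
Qed.

Lemma exists_weak_partial_ultra : exists v, weak_partial D p g v.
Proof.
exists v; split => //; first exact: L1loc_locally_bounded.
move=> phi [K [cK KD tphi]].
have tp j := test_function_in_partial j cK tphi.
have tpp i j := test_function_in_partial i cK (tp j).
have bnd f : test_function_in K f -> exists B : R, 0 <= B /\ forall x, `|f x| <= B.
  by move=> /(test_function_in_bounded cK)[B B0 hB]; exists B.
have [B1 [B10 hB1]] := bnd _ tphi.
have [B2 [B20 hB2]] := bnd _ (tp p).
have [B3 [B30 hB3]] := bnd _ (tp q).
have [B4 [B40 hB4]] := bnd _ (tpp p p).
have [B5 [B50 hB5]] := bnd _ (tpp q q).
have [B6 [B60 hB6]] := bnd _ (tpp p q).
pose B' := B4 + B5 + B6.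
(* One constant for all uses: [B'] bounds the second derivatives, and [planar_taylor] contributes
   the factor 3. *)
pose B := B1 + B2 + B3 + 3 * B'.
have B'0 : 0 <= B' by rewrite !addr_ge0.
have B0 : 0 <= B by rewrite !addr_ge0// mulr_ge0.
have mf f : test_function_in K f -> measurable_fun [set: T] (f \o row).
  by move=> /test_function_in_continuous; exact: measurable_row_continuous.
have out f x : test_function_in K f -> ~ K x -> f x = 0 by case=> _; exact.
have [N hN] := compact_cover_boxes cK KD.
have [N' hN'] := cover_A cK KD.
have [M M0 hM] := uniform_bound N.
(* Finitely many boxes cover the support of [phi]. On the boxes of triple radius [g] is at most [M],
   and once [sn n <= rho j] for these boxes a shift from [W] ends in [W']. *)
pose W := [set x | exists j, (j < N)%N /\ ok j /\ box (cc j) (rho j) x].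
pose W' := [set x | exists j, (j < N)%N /\ ok j /\ box (cc j) (3 * rho j) x].
have KW : K `<=` W by move=> x /hN.
pose S j : set T := [set t | ok j /\ box (cc j) (3 * rho j) (row t)].
have mS j : measurable (S j).
  have [oj|noj] := pselect (ok j).
    rewrite (_ : S j = row @^-1` box (cc j) (3 * rho j)); first exact: measurable_box.
    by apply/seteqP; split => t // [].
  by rewrite (_ : S j = set0)//; apply/seteqP; split => t // [].
have W'E : row @^-1` W' = \big[setU/set0]_(j < N) S j.
  rewrite -bigcup_mkord; apply/seteqP; split => t /=.
    by move=> [j [jN h]]; exists j.
  by move=> [j jN h]; exists j.
have mW' : measurable (row @^-1` W' : set T).
  by rewrite W'E; apply: bigsetU_measurable.
have W'oo : (mu (row @^-1` W') < +oo)%E.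
  rewrite W'E; apply: le_lt_trans (Boole_inequality _ _) _ => //.
  apply: lte_sum_pinfty => j _.
  apply: le_lt_trans (leb_box_lty (cc j) (3 * rho j)).
  by rewrite le_measure ?inE//; [exact: measurable_box|move=> t []].
have WW' : W `<=` W'.
  move=> x [j [jN [oj bx]]]; exists j; split => //; split => //.
  have [rj _ _] := okP oj.
  by apply: box_subset bx; rewrite ler_peMl ?ler1n// ltW.
have gM x : W' x -> `|g x| <= M.
  by move=> [j [jN [oj bx]]]; rewrite ger0_norm//; exact: hM bx.
pose Xi n := \int[mu]_t (phi (row t) * F n t).
pose I := \int[mu]_t (partial p phi (row t) * g (row t)).
have Xi_le : \forall n \near \oo, `|Xi n + I| <= 2 * (B * M * fine (mu (row @^-1` W'))) * sn n.
  apply: filterS2 (eventually_small N) (sn_small ltr01) => n small /andP[s0 _].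
  apply: (quotient_test H (W := W) (phiq := partial q phi) mg (mf _ tphi) (mf _ (tp p)) (mf _ (tp q)) mW' W'oo WW' M0 B0 s0 gM).
  - by move=> x; apply: le_trans (hB1 x) _; rewrite /B; lra.
  - by move=> x; apply: le_trans (hB2 x) _; rewrite /B; lra.
  - by move=> x; apply: le_trans (hB3 x) _; rewrite /B; lra.
  - by move=> x nW; apply: (out _ _ tphi) => /KW.
  - by move=> x nW; apply: (out _ _ (tp p)) => /KW.
  - by move=> x nW; apply: (out _ _ (tp q)) => /KW.
  - move=> x t [j [jN [oj bx]]]; exists j; split => //; split => //.
    have /andP[_ sr] := small j jN oj.
    have [rj _ _] := okP oj.
    apply: (@box_subset _ _ _ (rho j + rho j)); first by lra.
    by apply: (box_dir pq H) => //; rewrite ger0_norm// ltW.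
  - move=> x t.
    have -> : x - sn n *: w t = x + (- (sn n * a t)) *: delta_mx ord0 p + (- (sn n * b t)) *: delta_mx ord0 q.
      apply/rowP => i; rewrite !mxE !eqxx /=; ring.
    have -> : phi x - sn n * (a t * partial p phi x + b t * partial q phi x) =
       phi x + ((- (sn n * a t)) * partial p phi x + (- (sn n * b t)) * partial q phi x) by ring.
    apply: (@le_trans _ _ (3 * B' * sn n ^+ 2)); last first.
      by rewrite ler_wpM2r ?sqr_ge0// /B; lra.
    have dle u : `|u| <= 1 -> `|- (sn n * u)| <= sn n.
      by move=> u1; rewrite normrN normrM (gtr0_norm s0) ler_piMr// ltW.
    apply: planar_taylor.
    + by apply: dle; exact: (circle_le1l H).
    + by apply: dle; exact: (circle_le1r H).
    + by move=> y; exact: test_function_in_derivable tphi.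
    + by move=> y; exact: test_function_in_derivable tphi.
    + by move=> y; exact: test_function_in_derivable (tp p).
    + by move=> y; exact: test_function_in_derivable (tp q).
    + by move=> y; exact: test_function_in_derivable (tp q).
    + by move=> y; apply: le_trans (hB4 y) _; rewrite /B'; lra.
    + by move=> y; apply: le_trans (hB5 y) _; rewrite /B'; lra.
    + by move=> y; apply: le_trans (hB6 y) _; rewrite /B'; lra.
(* The sequence [Xi] is given two limits along [U]: here [- I], from the test function estimate, and
   in [Xiv] the sum of the integrals against the local densities. Their equality is the weak
   derivative identity. *)
have XiI : Xi @ U --> - I.
  apply: cvg_trans (_ : Xi @ \oo --> - I); first exact: cvg_app.
  apply/cvgrPdist_le => eps eps0.
  pose C := 2 * (B * M * fine (mu (row @^-1` W'))).
  have C0 : 0 <= C by rewrite mulr_ge0// mulr_ge0 ?mulr_ge0// fine_ge0.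
  have e0 : 0 < eps / (C + 1) by rewrite divr_gt0// ltr_wpDl.
  apply: filterS2 Xi_le (sn_small e0) => n h /andP[s0 se].
  rewrite -normrN opprB opprK; apply: le_trans h _; rewrite -/C.
  apply: (@le_trans _ _ ((C + 1) * sn n)); first by rewrite ler_wpM2r ?(ltW s0)// lerDl.
  by rewrite mulrC -ler_pdivlMr// ltr_wpDl.
have phiB x : `|(phi \o row) x| <= B1 by exact: hB1.
(* For large [n] the step [sn n] is below the radii of the finitely many boxes involved, so that
   [F n] is integrable on each piece. *)
have Xi_sum : \forall n \near \oo, Xi n = \sum_(j < N') \int[mu]_(t in A j) (phi (row t) * F n t).
  apply: filterS (eventually_small N') => n small.
  rewrite /Xi; have [||_ ->//] := @Rintegral_partition _ T R mu A N' (fun t => phi (row t) * F n t) mA tA.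
  - move=> j jN'; have [oj|noj] := pselect (ok j); last first.
      rewrite (_ : A j = set0); first exact: integrable_set0.
      by apply/seteqP; split => t // /AE [].
    have [rj _ _] := okP oj; have [Mj [gMj _]] := box_hyps oj.
    apply: (integrable_bounded_mul (mA j) (measurable_funTS (mf _ tphi)) (fun t _ => hB1 (row t))).
    apply: integrableS (integrable_quotient pq H rj g0 mg gMj (small j jN' oj)) => //.
      exact: measurable_box.
    by move=> t /AE [].
  - move=> t h; rewrite (out _ _ tphi) ?mul0r// => /hN'[j jN' Ajt].
    exact: h jN' Ajt.
have Xiv : Xi @ U --> \sum_(j < N') \int[mu]_(t in A j) (phi (row t) * vj j t).
  apply: (@cvg_trans _ ((fun n => \sum_(j < N') \int[mu]_(t in A j) (phi (row t) * F n t)) @ U)).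
    by apply: near_eq_cvg; apply: ooU; apply: filterS Xi_sum => n ->.
  apply: (@cvgR_sum _ _ U _ _ _ (fun (j : 'I_N') n => \int[mu]_(t in A j) (phi (row t) * F n t))) => j.
  exact: (@vj_cvg j _ _ (mf _ tphi) phiB).
have := cvg_unique _ Xiv XiI => e.
have := e (@Rhausdorff R) => {}e.
rewrite /rint.
have -> : \int[mu]_t (v (row t) * phi (row t)) = \int[mu]_t (phi (row t) * v (row t)).
  by apply: eq_Rintegral => t _; rewrite mulrC.
have -> : \int[mu]_t (g (row t) * partial p phi (row t)) = I.
  by apply: eq_Rintegral => t _; rewrite mulrC.
rewrite -e.
have [||_ ->] := @Rintegral_partition _ T R mu A N' (fun t => phi (row t) * v (row t)) mA tA.
- move=> j _.
  exact: (integrable_bounded_mul (mA j) (measurable_funTS (mf _ tphi)) (fun t _ => hB1 (row t)) (v_int j)).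
- move=> t h; rewrite (out _ _ tphi) ?mul0r// => /hN'[j jN' Ajt].
  exact: h jN' Ajt.
- by apply: eq_bigr => j _; apply: eq_Rintegral => t /set_mem At; rewrite (vE At).
Qed.

End weak_partial_existence.

(** * The uniform law on the circle *)

Section uniform_circle.
Context {R : realType}.

Lemma twopi_gt0 : 0 < 2 * pi :> R.
Proof. by rewrite mulr_gt0// pi_gt0. Qed.

Definition circle_prob : probability (measurableTypeR R) R := uniform_prob twopi_gt0.
Local Notation P := circle_prob.

Lemma FTC_everywhere (F h : R -> R) (a b : R) : a < b -> continuous h ->
  (forall t : R, is_derive t (1 : R) F (h t)) ->
  (\int[lebesgue_measure]_(t in `[a, b]) (h t)%:E = (F b - F a)%:E)%E.
Proof.
move=> ab ch dF.
have cF : continuous F.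
  move=> t; apply: differentiable_continuous; apply/derivable1_diffP.
  by case: (dF t).
rewrite (@continuous_FTC2 _ h F)//.
- exact: continuous_subspaceT.
- split.
  + by move=> t _; case: (dF t).
  + by apply: cvg_at_right_filter; exact: cF.
  + by apply: cvg_at_left_filter; exact: cF.
- by move=> t _; rewrite derive1E; case: (dF t).
Qed.

Lemma circle_prob_FTC (F h : R -> R) (M : R) : continuous h ->
  (forall t : R, is_derive t (1 : R) F (h t)) -> (forall t, `|h t| <= M) ->
  \int[P]_t h t = (F (2 * pi) - F 0) / (2 * pi).
Proof.
move=> ch dF hM.
have mh : measurable_fun [set: measurableTypeR R] (h : measurableTypeR R -> R) by exact: continuous_measurable_fun.
have ih := prob_integrable P mh hM.
have iM : P.-integrable setT (EFin \o (fun=> M)).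
  by apply: (@prob_integrable _ _ _ _ _ `|M|) => // ?; exact: measurable_cst.
(* [integral_uniform] applies to nonnegative integrands, so [h] is raised by its bound [M]. *)
have e : \int[P]_t (h t + M) = \int[P]_t h t + M.
  by rewrite RintegralD// prob_Rintegral_cst.
have dG (t : R) : is_derive t (1 : R) (fun t => F t + M * t) (h t + M).
  have ? := dF t; apply: is_derive_eq.
  by rewrite [_%:A]mulr1.
have cG : continuous (fun t => h t + M).
  by move=> t; apply: cvgD; [exact: ch|exact: cvg_cst].
have -> : \int[P]_t h t = \int[P]_t (h t + M) - M by rewrite e addrK.
rewrite /Rintegral integral_uniform; last 2 first.
- by apply/measurable_EFinP; apply: measurable_funD => //; exact: measurable_cst.
- by move=> t; rewrite lee_fin; have := hM t; rewrite ler_norml => /andP[+ _]; lra.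
rewrite (FTC_everywhere twopi_gt0 cG dG) -EFinM /=.
by move: (2 * pi) twopi_gt0 => p p0; field; rewrite gt_eqF.
Qed.

Lemma uniform_circle_law : circle_law P (@cos R) (@sin R).
Proof.
have ccos := @continuous_cos R; have csin := @continuous_sin R.
have cM (f g : R -> R) : continuous f -> continuous g -> continuous (fun t => f t * g t).
  by move=> cf cg t; apply: cvgM; [exact: cf|exact: cg].
have c2 : cos (2 * pi) = 1 :> R by rewrite mulr_natl cos2pi.
have s2 : sin (2 * pi) = 0 :> R by rewrite mulr_natl sin2pi.
have nc t : `|@cos R t| <= 1 by rewrite ler_norml cos_geN1 cos_le1.
have ns t : `|@sin R t| <= 1 by rewrite ler_norml sin_geN1 sin_le1.
have nM (x y : R) : `|x| <= 1 -> `|y| <= 1 -> `|x * y| <= 1.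
  by move=> *; rewrite normrM mulr_ile1.
have d1 (t : R) : is_derive t (1 : R) sin (cos t) by exact: is_derive_sin.
have d2 (t : R) : is_derive t (1 : R) (fun t => - cos t) (sin t).
  by apply: is_derive_eq; exact: opprK.
have d3 (t : R) : is_derive t (1 : R) (fun t => sin t * sin t / 2) (cos t * sin t).
  by apply: is_derive_eq; rewrite /GRing.scale/=; field.
have d4 (t : R) : is_derive t (1 : R) (fun t => (t + sin t * cos t) / 2) (cos t * cos t).
  by apply: is_derive_eq; rewrite /GRing.scale/=; have := cos2Dsin2 t; lra.
have d5 (t : R) : is_derive t (1 : R) (fun t => (t - sin t * cos t) / 2) (sin t * sin t).
  by apply: is_derive_eq; rewrite /GRing.scale/=; have := cos2Dsin2 t; lra.
have half : 2 * pi / 2 / (2 * pi) = 2^-1 :> R.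
  by move: (2 * pi) twopi_gt0 => p p0; field; rewrite gt_eqF.
split.
- exact: continuous_measurable_fun.
- exact: continuous_measurable_fun.
- by move=> t; exact: cos2Dsin2.
- by rewrite (circle_prob_FTC ccos d1 nc) s2 sin0 subrr mul0r.
- by rewrite (circle_prob_FTC csin d2 ns) c2 cos0 subrr mul0r.
- rewrite (circle_prob_FTC (cM _ _ ccos csin) d3 (fun t => nM _ _ (nc t) (ns t))).
  by rewrite s2 sin0 !mul0r subrr mul0r.
- rewrite (circle_prob_FTC (cM _ _ ccos ccos) d4 (fun t => nM _ _ (nc t) (nc t))).
  by rewrite s2 sin0 !mul0r !addr0 mul0r subr0 half.
- rewrite (circle_prob_FTC (cM _ _ csin csin) d5 (fun t => nM _ _ (ns t) (ns t))).
  by rewrite s2 sin0 !mul0r !subr0 mul0r subr0 half.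
Qed.

End uniform_circle.

Local Open Scope complex_scope.

(** * Plurisubharmonic functions and complex derivatives *)

Section complex_rows.
Context {R : realType}.

Lemma normc_le_ReIm (z : R[i]) : `|z| <= (`|complex.Re z| + `|complex.Im z|)%:C.
Proof.
rewrite normc_def lecR -[leRHS]ger0_norm ?addr_ge0// -sqrtr_sqr ler_wsqrtr//.
rewrite sqrrD !real_normK ?num_real//.
have : 0 <= `|complex.Re z| * `|complex.Im z| by rewrite mulr_ge0.
by rewrite mulr2n; lra.
Qed.

Lemma normc_ge_Im (z : R[i]) : (`|complex.Im z|)%:C <= `|z|.
Proof.
rewrite normc_def lecR -sqrtr_sqr ler_wsqrtr//.
by have := sqr_ge0 (complex.Re z); lra.
Qed.

Context {n : nat}.

Lemma toC_near (x : 'rV[R]_(n + n)) (A : set (Cn R n)) :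
  nbhs (toC x) A -> nbhs x (toC @^-1` A).
Proof.
move=> /nbhs_ballP[e /= e0 h].
(* The radius of a ball in [Cn] is an element of [R[i]]; being positive, it is real. *)
have e0' : 0 < complex.Re e by move: e0; rewrite ltcE => /andP[_].
have eE : e = (complex.Re e)%:C.
  by rewrite [RHS]RRe_real// gtr0_real.
apply: filterS (nbhs_box x (divr_gt0 e0' (ltr0n R 2))) => y hy.
apply: h; split => // i j; rewrite /ball /= (ord1 i) eE.
apply: le_lt_trans (normc_le_ReIm _) _; rewrite ltcR !mxE /=.
have := hy (lshift n j); have := hy (rshift n j).
by rewrite ![`|y _ _ - _|]distrC; lra.
Qed.

Lemma open_toC_preimage (A : set (Cn R n)) : open A -> open (toC @^-1` A).
Proof.
move=> oA; rewrite openE => x Ax; apply: toC_near.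
exact: (open_nbhs_nbhs (conj oA Ax)).
Qed.

(** Turns a weak derivative found in real coordinates into a function on [Cn], as [distr_dz]
    demands. *)
Definition fromC (z : 'rV[R[i]]_n) : 'rV[R]_(n + n) :=
  \row_i match fintype.split i with
         | inl k => complex.Re (z ord0 k) | inr k => complex.Im (z ord0 k) end.

Lemma toCK (x : 'rV[R]_(n + n)) : fromC (toC x) = x.
Proof. by apply/rowP => i; rewrite !mxE; case: splitP => k e; rewrite mxE /=; congr (x _ _); apply/val_inj. Qed.

End complex_rows.

Lemma weak_partial_eq {R : realType} {m} (D : set 'rV[R]_m) j (f g v : 'rV[R]_m -> R) :
  (forall x, D x -> f x = g x) -> weak_partial D j g v -> weak_partial D j f v.
Proof.
move=> fg [Lg Lv gv]; split => //.
  move=> K cK KD; apply: eq_integrable (Lg K cK KD); first exact: measurable_row_compact.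
  by move=> t /set_mem Kt; rewrite fg//; exact: KD.
move=> phi tphi; rewrite gv//; congr (- _); apply: eq_Rintegral => t _.
have [K [cK KD tK]] := tphi.
have [Dt|nDt] := pselect (D (row_of_tuple t)); first by rewrite fg.
have [_ out] := test_function_in_partial j cK tK.
by rewrite out ?mulr0// => /KD.
Qed.

Section psh.
Context {R : realType} {n : nat}.
Local Notation RB := (measurableTypeR R).
Local Notation T := ((n + n).-tuple RB).
Local Notation row := (@row_of_tuple R (n + n)).
Variables (Omega : set (Cn R n)) (u : Cn R n -> R).
Hypotheses (oO : open Omega) (u0 : forall z, Omega z -> 0 <= u z)
  (pu : psh_Cn Omega (fun z => (u z)%:E)).

Let D := @toC R n @^-1` Omega.

Let oD : open D. Proof. exact: open_toC_preimage. Qed.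

(** The energy estimate is stated for globally defined, nonnegative, measurable functions. Extension
    by zero provides these properties; semicontinuity and the mean value inequality are used inside
    [Omega] only. *)
Definition zero_extension (x : 'rV[R]_(n + n)) : R :=
  if `[< Omega (toC x) >] then u (toC x) else 0.
Local Notation g := zero_extension.

Lemma zero_extensionE x : D x -> g x = u (toC x).
Proof. by move=> Dx; rewrite /g asboolT. Qed.

Lemma zero_extension_ge0 x : 0 <= g x.
Proof. by rewrite /g; case: ifPn => // /asboolP /u0. Qed.

Let usc x (a : R) : D x -> g x < a -> \forall y \near x, D y /\ g y < a.
Proof.
move=> Dx; rewrite zero_extensionE// => ua.
have [_ h _] := pu.
have /toC_near : \forall w \near toC x, ((u w)%:E < a%:E)%E by apply: h; rewrite ?lte_fin.
apply: filterS2 (open_nbhs_nbhs (conj oD Dx)) => y Dy; rewrite /= lte_fin.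
by rewrite zero_extensionE.
Qed.

Lemma measurable_zero_extension : measurable_fun [set: T] (g \o row).
Proof.
apply: (measurability _ (RGenInftyO.measurableE R)) => /= _ [_ [a ->] <-].
rewrite setTI.
pose O := [set x | D x /\ g x < a].
have oO' : open O.
  rewrite openE => x [Dx gx]; exact: usc.
have [a0|a0] := leP a 0.
  rewrite (_ : _ @^-1` _ = set0)//; apply/seteqP; split => // t /=.
  by rewrite in_itv/= => /lt_le_trans/(_ a0); rewrite ltNge zero_extension_ge0.
(* For [a > 0] the sublevel set also contains the complement of [D], where [g] is 0. *)
rewrite (_ : _ @^-1` _ = (row @^-1` O) `|` ~` (row @^-1` D)).
  apply: measurableU; first exact: measurable_row_open.
  by apply: measurableC; exact: measurable_row_open.
apply/seteqP; split => t /=; rewrite in_itv/=.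
  by move=> h; have [Dt|nDt] := pselect (D (row t)); [left|right].
move=> [[]//|nD]; rewrite /g; case: ifPn => // /asboolP h.
by exfalso; exact: nD.
Qed.

Lemma zero_extension_locally_bounded x : D x ->
  exists r M : R, 0 < r /\ forall y, box x r y -> g y <= M.
Proof.
move=> Dx; have gx1 : g x < g x + 1 by rewrite ltrDl.
have [r r0 h] := nbhs_boxP (usc Dx gx1).
by exists r, (g x + 1); split => // y /h[_ /ltW].
Qed.

Section direction.
Variable k : 'I_n.
Local Notation p := (lshift n k).
Local Notation q := (rshift n k).
Local Notation P := (@circle_prob R).
Local Notation w := (dir p q (@cos R) (@sin R)).

Let pq : p != q. Proof. by rewrite eq_lrshift. Qed.

(** A complex disc in the direction of z_k is a disc in the plane of the real coordinates
    [lshift n k] and [rshift n k], so [dir] parametrizes its boundary. *)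
Lemma toC_disc (x : 'rV[R]_(n + n)) (zeta : R[i]) (s : R) :
  toC x + zeta *: (s%:C *: delta_mx ord0 k) =
  toC (x + s *: (\row_i (complex.Re zeta * (i == p)%:R + complex.Im zeta * (i == q)%:R))) :> 'rV[R[i]]_n.
Proof.
apply/rowP => j; rewrite !mxE !eqxx /= (inj_eq (@lshift_inj _ _)) (inj_eq (@rshift_inj _ _)).
rewrite eq_lrshift eq_rlshift !(mulr0, addr0, add0r).
case: zeta => a b; case: (j == k); rewrite /= ?mulr1 ?mulr0 ?addr0//.
by apply/eqP; rewrite eq_complex /=; apply/andP; split; apply/eqP; ring.
Qed.

(** Plurisubharmonicity is applied to the disc of radius [s] in the direction of z_k; as [s < r],
    the closed disc stays in the box. The bound [M] gives integrability on the circle. *)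
Lemma zero_extension_submean x (r M s : R) : box x r `<=` D ->
  (forall y, box x r y -> g y <= M) -> 0 < s < r ->
  g x <= \int[P]_t g (x + s *: w t).
Proof.
move=> xD gM /andP[s0 sr]; have r0 : 0 < r by exact: lt_trans sr.
have Dx : D x by apply: xD; exact: box_center.
have xs (y : 'rV[R]_(n + n)) : (forall i, `|y ord0 i| <= 1) -> box x r (x + s *: y).
  move=> y1 i; rewrite !mxE addrAC subrr add0r normrM (gtr0_norm s0).
  by apply: le_lt_trans sr; rewrite ler_piMr// ltW.
have [_ _ sub] := pu.
have := sub (toC x) (s%:C *: delta_mx ord0 k : 'rV[R[i]]_n).
have disc (zeta : R[i]) : `|zeta| <= 1 -> box x r
    (x + s *: (\row_i (complex.Re zeta * (i == p)%:R + complex.Im zeta * (i == q)%:R))).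
  move=> z1; apply: xs => i; rewrite mxE.
  have zR : `|complex.Re zeta| <= 1 by rewrite -lecR; apply: le_trans (normc_ge_Re _) z1.
  have zI : `|complex.Im zeta| <= 1 by rewrite -lecR; apply: le_trans (normc_ge_Im _) z1.
  have [->|ip] := eqVneq i p; first by rewrite (negPf pq) mulr1 mulr0 addr0.
  by have [_|iq] := eqVneq i q; rewrite mulr0 add0r ?mulr1// mulr0 normr0.
have mgx : measurable_fun setT (fun t => g (x + s *: w t)).
  have := measurable_fun_pair2 (tuple_of_row x)
    (measurable_dir_comp p q uniform_circle_law s measurable_zero_extension).
  by apply: eq_measurable_fun => t _ /=; rewrite tuple_of_rowK.
have dirE t : w t = \row_i (complex.Re (cos t +i* sin t) * (i == p)%:R + complex.Im (cos t +i* sin t) * (i == q)%:R).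
  by apply/rowP => i; rewrite !mxE.
have bw t : box x r (x + s *: w t).
  by apply: xs => i; exact: (dir_le1 pq uniform_circle_law).
have H0 : forall zeta : R[i], `|zeta| <= 1 -> Omega ((toC x : 'rV[R[i]]_n) + zeta *: (s%:C *: delta_mx ord0 k)).
  by move=> zeta z1; rewrite toC_disc; apply: xD; exact: disc.
move=> /(_ H0).
have ig : P.-integrable setT (EFin \o (fun t => g (x + s *: w t))).
  apply: (@prob_integrable _ _ _ _ _ M) => // t.
  by rewrite ger0_norm ?zero_extension_ge0//; exact: gM.
(* The unnormalized integral over one period is [2 * pi] times the mean for the uniform law. *)
rewrite (_ : (\int[lebesgue_measure]_(t in _) _)%E =
   ((2 * pi)%:E * \int[P]_t (g (x + s *: w t))%:E)%E); last first.
  rewrite integral_uniform; last 2 first.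
  - exact/measurable_EFinP.
  - by move=> t; rewrite lee_fin zero_extension_ge0.
  rewrite subr0 muleA -EFinM mulfV ?mul1e ?gt_eqF ?twopi_gt0//.
  apply: eq_integral => t _; congr EFin.
  rewrite -[RHS]/(g _) zero_extensionE ?toC_disc -?dirE//.
  exact: xD.
rewrite -zero_extensionE// EFin_Rintegral// -!EFinM lee_fin ler_pM2l//.
exact: twopi_gt0.
Qed.

Let swap_dir (t : RB) : @dir R (n + n) q p _ RB (@sin R) (@cos R) t =
  @dir R (n + n) p q _ RB (@cos R) (@sin R) t.
Proof. by apply/rowP => i; rewrite !mxE addrC. Qed.

Lemma psh_weak_partials :
  (exists v, weak_partial D p (u \o @toC R n) v) /\
  (exists v, weak_partial D q (u \o @toC R n) v).
Proof.
have [U [UU ooU]] := ultraFilterLemma (@eventually_filter).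
split.
- have [v hv] := exists_weak_partial_ultra pq uniform_circle_law oD zero_extension_ge0
    measurable_zero_extension zero_extension_locally_bounded zero_extension_submean UU ooU.
  by exists v; apply: weak_partial_eq hv => x Dx; rewrite zero_extensionE.
(* Exchanging both the coordinates and cos with sin describes the same circle, but now the weight
   picks out the derivative along [q]. *)
- have qp : q != p by rewrite eq_sym.
  have [] := exists_weak_partial_ultra qp (circle_law_sym uniform_circle_law) oD zero_extension_ge0
    measurable_zero_extension zero_extension_locally_bounded _ UU ooU.
    move=> x r M s h1 h2 h3; apply: le_trans (zero_extension_submean h1 h2 h3) _.
    by rewrite le_eqVlt; apply/orP; left; apply/eqP; apply: eq_Rintegral => t _; rewrite swap_dir.
  by move=> v hv; exists v; apply: weak_partial_eq hv => x Dx; rewrite zero_extensionE.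
Qed.

End direction.
End psh.

(** This lemma and the next two isolate scalar algebra, with variables in place of the integrals to
    which they are applied. *)
Lemma lin_opp {R : realType} (c d s t x y : R) : x = - s -> y = - t ->
  c * x + d * y = - (c * s + d * t).
Proof. by move=> -> ->; rewrite !mulrN opprD. Qed.

Lemma half_sum_bound {R : realType} (M A B r1 r2 r3 r4 : R) :
  `|r1| <= M * A -> `|r2| <= M * B -> `|r3| <= M * A -> `|r4| <= M * B ->
  `|2^-1 * r1 + (- 2^-1) * r2| + `|2^-1 * r3 + 2^-1 * r4| <= (A + B) * M.
Proof.
move=> h1 h2 h3 h4.
have := ler_normD (2^-1 * r1) ((- 2^-1) * r2); have := ler_normD (2^-1 * r3) (2^-1 * r4).
rewrite !normrM normrN [`|2^-1|]ger0_norm ?invr_ge0//; lra.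
Qed.

Lemma half_sums_linear {R : realType} (c x x1 x2 y y1 y2 z z1 z2 w w1 w2 : R) :
  x = c * x1 + x2 -> y = c * y1 + y2 -> z = c * z1 + z2 -> w = c * w1 + w2 ->
  - ((2^-1 * x + (- 2^-1) * y) +i* (2^-1 * z + 2^-1 * w)) =
  c%:C * - ((2^-1 * x1 + (- 2^-1) * y1) +i* (2^-1 * z1 + 2^-1 * w1)) +
  - ((2^-1 * x2 + (- 2^-1) * y2) +i* (2^-1 * z2 + 2^-1 * w2)).
Proof.
move=> -> -> -> ->.
by apply/eqP; rewrite eq_complex /=; apply/andP; split; apply/eqP; ring.
Qed.

Section test_integrals.
Context {R : realType} {m : nat}.
Local Notation RB := (measurableTypeR R).
Local Notation T := (m.-tuple RB).
Local Notation row := (@row_of_tuple R m).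
Local Notation mu := (leb m).
Implicit Types (f g v phi : 'rV[R]_m -> R) (D K : set 'rV[R]_m).

Definition row_integrable f := mu.-integrable [set: T] (EFin \o (f \o row)).

Lemma row_integrable_lin (c d : R) f g : row_integrable f -> row_integrable g ->
  row_integrable (fun x => c * f x + d * g x).
Proof.
move=> If Ig.
exact: (integrableD measurableT (integrable_scale c measurableT If) (integrable_scale d measurableT Ig)).
Qed.

Lemma rint_lin (c d : R) f g : row_integrable f -> row_integrable g ->
  rint (fun x => c * f x + d * g x) = c * rint f + d * rint g.
Proof.
move=> If Ig; rewrite /rint RintegralD//; last 2 first.
- exact: (integrable_scale c measurableT If).
- exact: (integrable_scale d measurableT Ig).
by congr (_ + _); exact: RintegralZl.
Qed.

(** The product is the extension by zero of its restriction to [K], so integrability of [f] on [K]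
    suffices. The bound later gives the continuity of distributions. *)
Lemma L1loc_mul_supported D K f phi (B : R) : compact K -> K `<=` D -> L1loc D f ->
  continuous phi -> (forall x, ~ K x -> phi x = 0) -> (forall x, `|phi x| <= B) ->
  row_integrable (fun x => f x * phi x) /\
  `|rint (fun x => f x * phi x)| <= B * \int[mu]_(t in row @^-1` K) `|f (row t)|.
Proof.
move=> cK KD Lf cphi phi0 phiB.
have mK := measurable_row_compact cK.
have ifK := Lf K cK KD.
have mphi := measurable_row_continuous cphi.
have E : (fun t => f (row t) * phi (row t)) = (fun t => phi (row t) * f (row t)) \_ (row @^-1` K).
  apply/funext => t; rewrite patchE; case: ifPn => [_|/negP nK]; first by rewrite mulrC.
  by rewrite phi0 ?mulr0// => Kt; apply: nK; exact: mem_set.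
have mphiK : measurable_fun (row @^-1` K) (phi \o row) by exact: measurable_funTS.
have iphif := integrable_bounded_mul mK mphiK (fun t _ => phiB (row t)) ifK.
split.
  rewrite /row_integrable (_ : _ \o row = (fun t => f (row t) * phi (row t)))// E.
  have := (integrable_mkcond _ mK).1 iphif.
  by apply: eq_integrable => // t _; rewrite restrict_EFin.
rewrite /rint (_ : (fun t : T => _) = (fun t => phi (row t) * f (row t)) \_ (row @^-1` K)); last exact: E.
rewrite -Rintegral_mkcond.
exact: (normr_Rintegral_mul_le mK mphiK (fun t _ => phiB (row t)) ifK).
Qed.

Lemma L1loc_mul_test D f phi : L1loc D f -> test_function D phi ->
  row_integrable (fun x => f x * phi x).
Proof.
move=> Lf [K [cK KD tphi]]; have [B _ hB] := test_function_in_bounded cK tphi.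
have [] // := L1loc_mul_supported cK KD Lf (test_function_in_continuous tphi) _ hB.
by case: tphi.
Qed.

Lemma test_function_partial D j phi : test_function D phi -> test_function D (partial j phi).
Proof. by move=> [K [cK KD tphi]]; exists K; split => //; exact: test_function_in_partial. Qed.

Lemma L1loc_lin D (c d : R) f g : L1loc D f -> L1loc D g -> L1loc D (fun x => c * f x + d * g x).
Proof.
move=> Lf Lg K cK KD; have mK := measurable_row_compact cK.
exact: (integrableD mK (integrable_scale c mK (Lf K cK KD)) (integrable_scale d mK (Lg K cK KD))).
Qed.

Lemma weak_partial_lin D j (c d : R) f1 v1 f2 v2 :
  weak_partial D j f1 v1 -> weak_partial D j f2 v2 ->
  weak_partial D j (fun x => c * f1 x + d * f2 x) (fun x => c * v1 x + d * v2 x).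
Proof.
move=> [Lf1 Lv1 h1] [Lf2 Lv2 h2]; split; [exact: L1loc_lin|exact: L1loc_lin|].
move=> phi tphi; have tp := test_function_partial j tphi.
have -> : (fun x => (c * v1 x + d * v2 x) * phi x) = (fun x => c * (v1 x * phi x) + d * (v2 x * phi x)).
  by apply/funext => x; ring.
have -> : (fun x => (c * f1 x + d * f2 x) * partial j phi x) =
    (fun x => c * (f1 x * partial j phi x) + d * (f2 x * partial j phi x)).
  by apply/funext => x; ring.
rewrite !rint_lin; try exact: (@L1loc_mul_test D).
exact: (lin_opp _ _ (h1 _ tphi) (h2 _ tphi)).
Qed.

End test_integrals.

(** * Complex derivatives of locally integrable functions *)

Section complex_distributions.
Context {R : realType} {n : nat}.
Implicit Types (Omega : set (Cn R n)) (k : 'I_n).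
Local Notation D Omega := (@toC R n @^-1` Omega).

(** With u = a + i b and d/dz = (d/dx - i d/dy) / 2, the derivative is (a_x + b_y) / 2 + i (b_x -
    a_y) / 2. *)
Lemma distr_dz_of_weak_partials Omega k (u : Cn R n -> R[i])
    (ap aq bp bq : 'rV[R]_(n + n) -> R) :
  weak_partial (D Omega) (lshift n k) (fun x => complex.Re (u (toC x))) ap ->
  weak_partial (D Omega) (rshift n k) (fun x => complex.Re (u (toC x))) aq ->
  weak_partial (D Omega) (lshift n k) (fun x => complex.Im (u (toC x))) bp ->
  weak_partial (D Omega) (rshift n k) (fun x => complex.Im (u (toC x))) bq ->
  distr_dz Omega k u (fun z => (2^-1 * ap (fromC z) + 2^-1 * bq (fromC z)) +i*
     (2^-1 * bp (fromC z) + (- 2^-1) * aq (fromC z))).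
Proof.
move=> [La Lap hap] [_ Laq haq] [Lb Lbp hbp] [_ Lbq hbq].
have fK (g : 'rV[R]_(n + n) -> R) : (fun x => g (fromC (toC x))) = g.
  by apply/funext => x; rewrite toCK.
split.
- by split.
- split; rewrite /= /comp /=.
  + rewrite (_ : (fun x => _) = fun x => 2^-1 * ap x + 2^-1 * bq x); first exact: L1loc_lin.
    by apply/funext => x; rewrite toCK.
  + rewrite (_ : (fun x => _) = fun x => 2^-1 * bp x + (- 2^-1) * aq x); first exact: L1loc_lin.
    by apply/funext => x; rewrite toCK.
move=> phi tphi.
have tp := test_function_partial (lshift n k) tphi.
have tq := test_function_partial (rshift n k) tphi.
rewrite /cint; apply/eqP; rewrite eq_complex /=; apply/andP; split; apply/eqP.
- rewrite (_ : (fun x => _) = (fun x => 2^-1 * (ap x * phi x) + 2^-1 * (bq x * phi x))); last first.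
    by apply/funext => x; rewrite !toCK; ring.
  rewrite [in RHS](_ : (fun x => _) = (fun x => 2^-1 * (complex.Re (u (toC x)) * partial (lshift n k) phi x) +
      2^-1 * (complex.Im (u (toC x)) * partial (rshift n k) phi x))); last first.
    by apply/funext => x; case: (u (toC x)) => s t /=; field.
  rewrite !rint_lin; try exact: (@L1loc_mul_test _ _ (D Omega)).
  exact: (lin_opp _ _ (hap _ tphi) (hbq _ tphi)).
- rewrite (_ : (fun x => _) = (fun x => 2^-1 * (bp x * phi x) + (- 2^-1) * (aq x * phi x))); last first.
    by apply/funext => x; rewrite !toCK; ring.
  rewrite [in RHS](_ : (fun x => _) = (fun x => 2^-1 * (complex.Im (u (toC x)) * partial (lshift n k) phi x) +
      (- 2^-1) * (complex.Re (u (toC x)) * partial (rshift n k) phi x))); last first.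
    by apply/funext => x; case: (u (toC x)) => s t /=; field.
  rewrite !rint_lin; try exact: (@L1loc_mul_test _ _ (D Omega)).
  exact: (lin_opp _ _ (hbp _ tphi) (haq _ tphi)).
Qed.

(** One derivative is moved to the test function, so the result is a distribution of order at most
    one. *)
Lemma distr_dzbar_exists Omega l (v : Cn R n -> R[i]) : cL1loc (D Omega) (v \o toC) ->
  distr_dzbar Omega l v (fun phi => - cint (fun x => v (toC x) * d_dzbar l phi x)).
Proof.
move=> [La Lb]; split=> //.
pose a x := complex.Re (v (toC x)); pose b x := complex.Im (v (toC x)).
have ReE phi : (fun x => complex.Re (v (toC x) * d_dzbar l phi x)) =
    (fun x => 2^-1 * (a x * partial (lshift n l) phi x) + (- 2^-1) * (b x * partial (rshift n l) phi x)).
  by apply/funext => x; rewrite /a /b; case: (v (toC x)) => s t /=; field.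
have ImE phi : (fun x => complex.Im (v (toC x) * d_dzbar l phi x)) =
    (fun x => 2^-1 * (a x * partial (rshift n l) phi x) + 2^-1 * (b x * partial (lshift n l) phi x)).
  by apply/funext => x; rewrite /a /b; case: (v (toC x)) => s t /=; field.
have it f j phi : L1loc (D Omega) f -> test_function (D Omega) phi ->
    row_integrable (fun x => f x * partial j phi x).
  by move=> Lf tphi; apply: (@L1loc_mul_test _ _ (D Omega)) => //; exact: test_function_partial.
(* Integrability is a hypothesis here so that the formula also covers [c * phi + psi], without first
   showing that this is a test function. *)
have cintE phi : (forall f j, L1loc (D Omega) f -> row_integrable (fun x => f x * partial j phi x)) ->
    cint (fun x => v (toC x) * d_dzbar l phi x) =
    (2^-1 * rint (fun x => a x * partial (lshift n l) phi x) +
      (- 2^-1) * rint (fun x => b x * partial (rshift n l) phi x)) +i*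
    (2^-1 * rint (fun x => a x * partial (rshift n l) phi x) +
      2^-1 * rint (fun x => b x * partial (lshift n l) phi x)).
  move=> ip; rewrite /cint ReE ImE.
  rewrite (rint_lin _ _ (ip a (lshift n l) La) (ip b (rshift n l) Lb)).
  by rewrite (rint_lin _ _ (ip a (rshift n l) La) (ip b (lshift n l) Lb)).
split.
- move=> c phi psi tphi tpsi.
  have pl j : partial j (fun x => c * phi x + psi x) = (fun x => c * partial j phi x + partial j psi x).
    apply/funext => x; rewrite /partial.
    have [[K1 [_ _ t1]] [K2 [_ _ t2]]] := (tphi, tpsi).
    have d1 := test_function_in_derivable (j := j) (x := x) t1.
    have d2 := test_function_in_derivable (j := j) (x := x) t2.
    rewrite (_ : (fun x => c * phi x + psi x) = (c \*: phi) + psi)//.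
    by rewrite (deriveD (derivableZ (k := c) d1) d2) (deriveZ c d1).
  have E f j : (fun x => f x * partial j (fun x => c * phi x + psi x) x) =
      (fun x => c * (f x * partial j phi x) + 1 * (f x * partial j psi x)).
    by rewrite pl; apply/funext => x; rewrite mulrDr mulrCA mul1r.
  have ic f j : L1loc (D Omega) f -> row_integrable (fun x => f x * partial j (fun x => c * phi x + psi x) x).
    by move=> Lf; rewrite E; exact: row_integrable_lin (it f j phi Lf tphi) (it f j psi Lf tpsi).
  have lin f j : L1loc (D Omega) f -> rint (fun x => f x * partial j (fun x => c * phi x + psi x) x) =
      c * rint (fun x => f x * partial j phi x) + rint (fun x => f x * partial j psi x).
    move=> Lf; rewrite E (rint_lin _ _ (it f j phi Lf tphi) (it f j psi Lf tpsi)).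
    by rewrite mul1r.
  rewrite (cintE _ ic) (cintE _ (fun f j Lf => it f j phi Lf tphi)) (cintE _ (fun f j Lf => it f j psi Lf tpsi)).
  exact: (half_sums_linear (lin a _ La) (lin b _ Lb) (lin a _ La) (lin b _ Lb)).
- move=> K cK KD.
  have mK := measurable_row_compact cK.
  pose A := Rintegral (leb (n + n)) (@row_of_tuple R (n + n) @^-1` K) (fun t => `|a (row_of_tuple t)|).
  pose B := Rintegral (leb (n + n)) (@row_of_tuple R (n + n) @^-1` K) (fun t => `|b (row_of_tuple t)|).
  (* The constant is the sum of the L^1 norms on [K] of the real and imaginary parts of [v]; only
     first derivatives of [phi] occur. *)
  exists (A + B), 1%N => phi M tphi hM.
  have bnd f j : L1loc (D Omega) f -> `|rint (fun x => f x * partial j phi x)| <= M *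
      Rintegral (leb (n + n)) (@row_of_tuple R (n + n) @^-1` K) (fun t => `|f (row_of_tuple t)|).
    move=> Lf; have tj := test_function_in_partial j cK tphi.
    have hj x : `|partial j phi x| <= M by exact: (hM [:: j] isT x).
    have [] // := L1loc_mul_supported cK KD Lf (test_function_in_continuous tj) _ hj.
    by case: tj.
  have tD : test_function (D Omega) phi by exists K.
  rewrite normrN (cintE _ (fun f j Lf => it f j phi Lf tD)).
  apply: le_trans (normc_le_ReIm _) _; rewrite lecR /=.
  exact: (half_sum_bound (bnd a _ La) (bnd b _ Lb) (bnd a _ La) (bnd b _ Lb)).
Qed.

End complex_distributions.

Lemma ReM {R : realType} (x y : R[i]) :
  complex.Re (x * y) = complex.Re x * complex.Re y - complex.Im x * complex.Im y.
Proof. by case: x => a b; case: y. Qed.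

Lemma ImM {R : realType} (x y : R[i]) :
  complex.Im (x * y) = complex.Re x * complex.Im y + complex.Im x * complex.Re y.
Proof. by case: x => a b; case: y. Qed.

Lemma ReD {R : realType} (x y : R[i]) : complex.Re (x + y) = complex.Re x + complex.Re y.
Proof. by case: x => a b; case: y. Qed.

Lemma ImD {R : realType} (x y : R[i]) : complex.Im (x + y) = complex.Im x + complex.Im y.
Proof. by case: x => a b; case: y. Qed.

(** * Local integrability of the product with the inverse matrix *)

Section bounded_measurable.
Context {R : realType} {m : nat} (K : set 'rV[R]_m).
Local Notation RB := (measurableTypeR R).
Local Notation T := (m.-tuple RB).
Local Notation row := (@row_of_tuple R m).
Local Notation mu := (leb m).
Hypothesis mK : measurable (row @^-1` K : set T).
Implicit Types (F G : 'rV[R]_m -> R[i]).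

Definition bounded_measurable F :=
  [/\ measurable_fun (row @^-1` K : set T) (fun t => complex.Re (F (row t))),
      measurable_fun (row @^-1` K : set T) (fun t => complex.Im (F (row t))) &
      exists M : R, forall x, K x -> `|complex.Re (F x)| <= M /\ `|complex.Im (F x)| <= M].

Lemma bounded_measurable_cst (c : R[i]) : bounded_measurable (fun=> c).
Proof.
split; [exact: measurable_cst|exact: measurable_cst|].
by exists (`|complex.Re c| + `|complex.Im c|) => x _; rewrite lerDl lerDr.
Qed.

Lemma bounded_measurableD F G : bounded_measurable F -> bounded_measurable G ->
  bounded_measurable (fun x => F x + G x).
Proof.
move=> [mF1 mF2 [M hM]] [mG1 mG2 [N hN]]; split.
- by under eq_fun do rewrite ReD; exact: measurable_funD.
- by under eq_fun do rewrite ImD; exact: measurable_funD.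
- exists (M + N) => x Kx; have [? ?] := hM x Kx; have [? ?] := hN x Kx.
  by rewrite ReD ImD; split; apply: le_trans (ler_normD _ _) _; rewrite lerD.
Qed.

Lemma bounded_measurableM F G : bounded_measurable F -> bounded_measurable G ->
  bounded_measurable (fun x => F x * G x).
Proof.
move=> [mF1 mF2 [M hM]] [mG1 mG2 [N hN]]; split.
- under eq_fun do rewrite ReM.
  by apply: measurable_funB; exact: measurable_funM.
- under eq_fun do rewrite ImM.
  by apply: measurable_funD; exact: measurable_funM.
- exists (M * N + M * N) => x Kx; have [? ?] := hM x Kx; have [? ?] := hN x Kx.
  rewrite ReM ImM; split; [apply: le_trans (ler_normB _ _) _|apply: le_trans (ler_normD _ _) _];
    by rewrite !normrM lerD// ler_pM.
Qed.

Lemma bounded_measurable_sum (I : Type) (r : seq I) (F : I -> 'rV[R]_m -> R[i]) :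
  (forall i, bounded_measurable (F i)) ->
  bounded_measurable (fun x => \sum_(i <- r) F i x).
Proof.
move=> hF; elim: r => [|i r IH].
  by under eq_fun do rewrite big_nil; exact: bounded_measurable_cst.
by under eq_fun do rewrite big_cons; exact: bounded_measurableD.
Qed.

Lemma bounded_measurable_prod (I : Type) (r : seq I) (F : I -> 'rV[R]_m -> R[i]) :
  (forall i, bounded_measurable (F i)) ->
  bounded_measurable (fun x => \prod_(i <- r) F i x).
Proof.
move=> hF; elim: r => [|i r IH].
  by under eq_fun do rewrite big_nil; exact: bounded_measurable_cst.
by under eq_fun do rewrite big_cons; exact: bounded_measurableM.
Qed.

Lemma bounded_measurable_det (r : nat) (A : 'rV[R]_m -> 'M[R[i]]_r) :
  (forall i j, bounded_measurable (fun x => A x i j)) ->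
  bounded_measurable (fun x => \det (A x)).
Proof.
move=> hA; apply: bounded_measurable_sum => s.
by apply: bounded_measurableM; [exact: bounded_measurable_cst|exact: bounded_measurable_prod].
Qed.

Lemma bounded_measurable_inv (d : 'rV[R]_m -> R) (c : R) : 0 < c ->
  measurable_fun (row @^-1` K : set T) (d \o row) -> (forall x, K x -> c <= d x) ->
  bounded_measurable (fun x => ((d x)%:C)^-1).
Proof.
move=> c0 md dc.
(* On [K], where [d >= c > 0], the inverse is written through exp and ln, whose measurability is
   inherited. *)
have E x : K x -> ((d x)%:C)^-1 = (expR (- ln (d x)))%:C.
  move=> Kx; rewrite expRN lnK ?posrE ?(lt_le_trans c0) ?dc//.
  by rewrite [RHS]rmorphV// unitfE gt_eqF// (lt_le_trans c0)// dc.
split.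
- apply: (@eq_measurable_fun _ _ _ _ _ (fun t => expR (- ln (d (row t))))).
    by move=> t /set_mem Kt; rewrite E.
  apply: measurableT_comp => //; apply: measurableT_comp => //.
  by apply: (measurableT_comp (@measurable_ln R)).
- have mc : measurable_fun (row @^-1` K : set T) (fun=> 0 : RB) by exact: measurable_cst.
  by apply: eq_measurable_fun mc => t /set_mem Kt; rewrite E.
- exists c^-1 => x Kx; rewrite E//=; split; last by rewrite normr0 invr_ge0 ltW.
  rewrite ger0_norm ?expR_ge0// expRN lnK ?posrE ?(lt_le_trans c0) ?dc//.
  by rewrite lef_pV2 ?posrE ?dc// (lt_le_trans c0)// dc.
Qed.

Definition complex_integrable F :=
  mu.-integrable (row @^-1` K) (EFin \o (fun t => complex.Re (F (row t)))) /\
  mu.-integrable (row @^-1` K) (EFin \o (fun t => complex.Im (F (row t)))).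

Lemma complex_integrableM F G : bounded_measurable F -> complex_integrable G ->
  complex_integrable (fun x => F x * G x).
Proof.
move=> [mF1 mF2 [M hM]] [iG1 iG2].
have b1 t : (row @^-1` K) t -> `|complex.Re (F (row t))| <= M by move=> /hM[].
have b2 t : (row @^-1` K) t -> `|complex.Im (F (row t))| <= M by move=> /hM[].
split.
- rewrite (_ : (fun t => _) = (fun t => complex.Re (F (row t)) * complex.Re (G (row t)) -
     complex.Im (F (row t)) * complex.Im (G (row t)))); last by apply/funext => t; rewrite ReM.
  exact: (integrableB mK (integrable_bounded_mul mK mF1 b1 iG1) (integrable_bounded_mul mK mF2 b2 iG2)).
- rewrite (_ : (fun t => _) = (fun t => complex.Re (F (row t)) * complex.Im (G (row t)) +
     complex.Im (F (row t)) * complex.Re (G (row t)))); last by apply/funext => t; rewrite ImM.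
  exact: (integrableD mK (integrable_bounded_mul mK mF1 b1 iG2) (integrable_bounded_mul mK mF2 b2 iG1)).
Qed.

Lemma complex_integrable_sum (I : Type) (r : seq I) (F : I -> 'rV[R]_m -> R[i]) :
  (forall i, complex_integrable (F i)) ->
  complex_integrable (fun x => \sum_(i <- r) F i x).
Proof.
move=> hF; elim: r => [|i r [IH1 IH2]].
  split; rewrite (_ : _ \o _ = cst 0%E); try exact: integrable0;
    by apply/funext => t; rewrite /= big_nil.
have [h1 h2] := hF i.
split.
- rewrite (_ : (fun t => _) = (fun t => complex.Re (F i (row t)) + complex.Re (\sum_(j <- r) F j (row t)))).
    exact: (integrableD mK h1 IH1).
  by apply/funext => t; rewrite big_cons ReD.
- rewrite (_ : (fun t => _) = (fun t => complex.Im (F i (row t)) + complex.Im (\sum_(j <- r) F j (row t)))).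
    exact: (integrableD mK h2 IH2).
  by apply/funext => t; rewrite big_cons ImD.
Qed.

(** By the cofactor formula the entries of the inverse are polynomials in bounded measurable entries
    divided by a determinant that is at least [c]; they are bounded multipliers of integrable
    functions. *)
Lemma complex_integrable_invmx_mul (r : nat) (A G : 'rV[R]_m -> 'M[R[i]]_r)
    (d : 'rV[R]_m -> R) (c : R) :
  0 < c -> (forall x, K x -> \det (A x) = (d x)%:C /\ c <= d x) ->
  (forall i j, bounded_measurable (fun x => A x i j)) ->
  (forall i j, complex_integrable (fun x => G x i j)) ->
  forall i j, complex_integrable (fun x => (invmx (A x) *m G x) i j).
Proof.
move=> c0 hd hA hG i j.
have md : measurable_fun (row @^-1` K : set T) (d \o row).
  have [mre _ _] := bounded_measurable_det hA.
  by apply: eq_measurable_fun mre => t /set_mem Kt; have [-> _] := hd _ Kt.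
have binv := bounded_measurable_inv c0 md (fun x Kx => (hd x Kx).2).
pose B x l := ((d x)%:C)^-1 * cofactor (A x) l i.
have bB l : bounded_measurable (fun x => B x l).
  apply: bounded_measurableM => //; rewrite /cofactor.
  apply: bounded_measurableM; first exact: bounded_measurable_cst.
  apply: bounded_measurable_det => i' j'.
  rewrite (_ : (fun x => _) = (fun x => A x (lift l i') (lift i j'))); first exact: hA.
  by apply/funext => x; rewrite !mxE.
have E x : K x -> (invmx (A x) *m G x) i j = \sum_l B x l * G x l j.
  move=> Kx; have [dE cd] := hd x Kx; rewrite mxE; apply: eq_bigr => l _; congr (_ * _).
  rewrite /invmx unitmxE dE unitfE; have d0 : 0 < d x by exact: lt_le_trans cd.
  have -> : (d x)%:C != 0 by rewrite -[0]/(0%:C) (inj_eq (@complexI R)) gt_eqF.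
  by rewrite !mxE.
have [i1 i2] : complex_integrable (fun x => \sum_l B x l * G x l j).
  by apply: complex_integrable_sum => l; exact: complex_integrableM.
split.
- by apply: eq_integrable i1 => // t /set_mem Kt /=; rewrite E.
- by apply: eq_integrable i2 => // t /set_mem Kt /=; rewrite E.
Qed.

End bounded_measurable.

(** * Hermitian metrics in frames and charts *)

Section hermitian_forms.
Context {R : realType} {V : vectType R[i]} (h : {hermitian_sym V for @Num.conj R[i]}).

Lemma herm_sumZ (I : finType) (a b : I -> R[i]) (x : I -> V) :
  h (\sum_i a i *: x i) (\sum_i b i *: x i) =
  \sum_i \sum_j a i * Num.conj (b j) * h (x i) (x j).
Proof.
rewrite linear_sumlz /=; apply: eq_bigr => i _; rewrite linearZl_LR /= linear_sumr mulr_sumr.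
by apply: eq_bigr => j _; rewrite linearZr_LR /= mulrA.
Qed.

(** For [lam] of modulus 1, [q lam] is twice the real part of [Num.conj lam * h a b]; the values at
    1 and i give the real and imaginary parts. *)
Lemma herm_polar (a b : V) :
  let q lam := complex.Re (h (a + lam *: b) (a + lam *: b)) -
     complex.Re (h a a) - complex.Re (h b b) in
  h a b = (2^-1 * q 1) +i* (2^-1 * q (0 +i* 1)).
Proof.
move=> q; have -> : h a b = complex.Re (h a b) +i* complex.Im (h a b) by case: (h a b).
have E lam : q lam = complex.Re (Num.conj lam * h a b + lam * Num.conj (h a b)) +
    complex.Re (lam * Num.conj lam * h b b) - complex.Re (h b b).
  rewrite /q; have -> : h (a + lam *: b) (a + lam *: b) = h a a + (Num.conj lam * h a b + lam * Num.conj (h a b))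
      + lam * Num.conj lam * h b b.
    have -> : Num.conj (h a b) = h b a by rewrite [RHS]hermC expr0 mul1r.
    rewrite linearDl !linearDr /= linearZl_LR linearZl_LR /= !linearZr_LR /= -!mulrA -!addrA.
    by congr (_ + (_ + (_ + _))); rewrite mulrCA.
  by rewrite !ReD; lra.
by congr (_ +i* _); rewrite E; case: (h a b) => s t; case: (h b b) => p w /=; field.
Qed.

End hermitian_forms.

Section change_of_basis.
Context {R : realType} {V : vectType R[i]} {r : nat}.
Implicit Types e f : r.-tuple V.

Definition change_mx f e : 'M[R[i]]_r := \matrix_(i, j) coord f i (tnth e j).

Lemma change_mx_mul e f : basis_of fullv e -> basis_of fullv f ->
  change_mx f e *m change_mx e f = 1%:M.
Proof.
move=> be bf; apply/matrixP => i j; rewrite !mxE.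
transitivity (coord f i (\sum_k coord e k (tnth f j) *: e`_k)).
  rewrite linear_sum; apply: eq_bigr => k _.
  by rewrite !mxE (tnth_nth 0 e) mulrC; exact/esym/linearZ.
rewrite -(coord_basis be) ?memvf// (tnth_nth 0) coord_free ?(basis_free bf)//.
by rewrite eq_sym.
Qed.

Lemma det_change_mx_neq0 e f : basis_of fullv e -> basis_of fullv f ->
  \det (change_mx f e) != 0.
Proof.
move=> be bf; have /(congr1 determinant) := change_mx_mul be bf.
rewrite det_mulmx det1 => h; apply/eqP => h0; move: h; rewrite h0 mul0r.
by move/esym/eqP; rewrite oner_eq0.
Qed.

Lemma gram_change (h : {hermitian_sym V for @Num.conj R[i]}) e f :
  basis_of fullv f ->
  \matrix_(i, j) h (tnth e j) (tnth e i) =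
  (map_mx Num.conj (change_mx f e))^T *m \matrix_(i, j) h (tnth f j) (tnth f i) *m change_mx f e.
Proof.
move=> bf; apply/matrixP => i j; rewrite !mxE.
rewrite {1}(coord_basis bf (memvf (tnth e j))) {1}(coord_basis bf (memvf (tnth e i))).
rewrite herm_sumZ; apply: eq_bigr => k _; rewrite !mxE mulr_suml.
apply: eq_bigr => l _; rewrite !mxE !(tnth_nth 0) -!mulrA mulrCA.
by congr (_ * _); rewrite mulrC.
Qed.

Lemma det_gram_change (h : {hermitian_sym V for @Num.conj R[i]}) e f :
  basis_of fullv f ->
  \det (\matrix_(i, j) h (tnth e j) (tnth e i)) =
  `|\det (change_mx f e)| ^+ 2 * \det (\matrix_(i, j) h (tnth f j) (tnth f i)).
Proof.
move=> bf; rewrite (gram_change h e bf) !det_mulmx det_tr det_map_mx normCK.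
by rewrite mulrC mulrA.
Qed.

End change_of_basis.

Lemma realc_gt0 {R : realType} (x : R) : (0 < x%:C) = (0 < x).
Proof. by rewrite -[X in X < _]/(0%:C) ltcR. Qed.

Section charts.
Context {R : realType} {n : nat} {X : complexManifold R n}.
Implicit Types (c : @chart R X n) (A : set X) (f g : X -> R[i]).

Lemma cinv_chart_image c A z : (cmap c @` (dom c `&` A)) z ->
  [/\ dom c (cinv c z), A (cinv c z) & cmap c (cinv c z) = z].
Proof. by move=> [p [dp Ap] <-]; rewrite cmapK. Qed.

Lemma open_chart_image c A : open A -> open (cmap c @` (dom c `&` A)).
Proof.
move=> oA; rewrite openE => _ [p [dp Ap] <-].
have cod : (cmap c @` dom c) (cmap c p) by exists p.
have oc := @cod_open R X n c; have H := continuous_open_subspace (cinv c) oc.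
have /= cc : {for cmap c p, continuous (cinv c)}.
  have := @cinv_continuous R X n c; rewrite H => /(_ (cmap c p)); apply; exact: mem_set.
have nA : nbhs (cinv c (cmap c p)) A by rewrite cmapK//; exact: open_nbhs_nbhs.
have := cc _ nA; apply: filterS2 (open_nbhs_nbhs (conj oc cod)) => z [q dq <-] /=.
by rewrite cmapK// => Aq; exists q.
Qed.

Lemma holo_on_continuous c A f z : atlas c -> holo_on A f -> (cmap c @` (A `&` dom c)) z ->
  {for z, continuous (f \o cinv c : Cn R n -> R[i]^o)}.
Proof. by move=> ac hf Az; apply: differentiable_continuous; exact: hf. Qed.

Lemma holo_onD A f g : holo_on A f -> holo_on A g -> holo_on A (fun x => f x + g x).
Proof. by move=> hf hg c ac z Az; exact: differentiableD (hf _ ac _ Az) (hg _ ac _ Az). Qed.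

Lemma holo_onZ A (a : R[i]) f : holo_on A f -> holo_on A (fun x => a * f x).
Proof. by move=> hf c ac z Az; exact: (differentiableZ a (hf _ ac _ Az)). Qed.

End charts.

Lemma continuous_det {K : numFieldType} {T : topologicalType} {r : nat} (A : T -> 'M[K]_r) (z : T) :
  (forall i j, {for z, continuous (fun w => A w i j : K^o)}) ->
  {for z, continuous (fun w => \det (A w) : K^o)}.
Proof.
move=> hA.
pose F (s : 'S_r) (w : T) : K^o := (-1) ^+ s * \prod_i A w i (s i).
have hF s : F s w @[w --> z] --> F s z.
  apply: cvgM; first exact: cvg_cst.
  pose G (i : 'I_r) (w : T) : K^o := A w i (s i).
  by apply: (@cvg_big K^o _ *%R 1 xpredT (@mul_continuous K) T (nbhs z) (index_enum _) G (G^~ z)) => i _; exact: hA.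
exact: (@cvg_big K^o _ +%R 0 xpredT (@add_continuous K^o) T (nbhs z) (index_enum _) F (F^~ z) _ (fun s _ => hF s)).
Qed.

Section frames.
Context {R : realType} {n r : nat} {X : complexManifold R n} {E : holoVectorBundle X r}.
Implicit Types (c : @chart R X n) (e f t : local_frame r (fib E)).

Lemma holo_section_linear A (u v : forall x, fib E x) (a : R[i]) :
  holo_section A u -> holo_section A v -> holo_section A (fun x => u x + a *: v x).
Proof.
move=> hu hv t tt i.
rewrite (_ : (fun x => _) = (fun x => coord (fvec t x) i (u x) + a * coord (fvec t x) i (v x))).
  by apply: holo_onD; [exact: hu|apply: holo_onZ; exact: hv].
by apply/funext => x; rewrite addrC linearP/= addrC.
Qed.

Variable h : singularMetric E.
Local Notation H e x := (form_mx (mform h) e x).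

Lemma det_change_near c e t z : atlas c -> holo_frame e -> triv t ->
  dom c (cinv c z) -> cmap c (cinv c z) = z -> fdom e (cinv c z) -> fdom t (cinv c z) ->
  exists a b : R, [/\ 0 < a, 0 < b & \forall w \near z,
    a%:C <= `|\det (change_mx (fvec t (cinv c w)) (fvec e (cinv c w)))| <= b%:C].
Proof.
move=> ac he tt dz cz ez tz.
pose g w := \det (change_mx (fvec t (cinv c w)) (fvec e (cinv c w))).
have cg : {for z, continuous (g : Cn R n -> R[i]^o)}.
  apply: continuous_det => i j.
  rewrite (_ : (fun w => _) = (fun x => coord (fvec t x) i (tnth (fvec e x) j)) \o cinv c); last first.
    by apply/funext => w; rewrite mxE.
  apply: (holo_on_continuous ac (he j t tt i)).
  by exists (cinv c z).
pose m := complex.Re `|g z|.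
have gz : `|g z| = m%:C by rewrite /m normc_def.
have n0 : 0 < m.
  rewrite -ltcR -gz normr_gt0 /g.
  by apply: det_change_mx_neq0; exact: fbasis.
exists (m / 2), (m + 1); split.
- by rewrite divr_gt0.
- by rewrite addr_gt0.
have h1 : (m / 2)%:C < `|g z| by rewrite gz ltcR; lra.
have h2 : `|g z| < (m + 1)%:C by rewrite gz ltcR; lra.
have n1 := cvgr_norm_gt (g z : R[i]^o) cg _ h1; have n2 := cvgr_norm_lt (g z : R[i]^o) cg _ h2.
near=> w; apply/andP; split; apply: ltW; near: w; [exact: n1|exact: n2].
Unshelve. all: by end_near.
Qed.

(** The bound is known in the frame [f] and wanted in the frame [e]. As [holo_frame] relates each of
    them only to the frames of [triv], they are compared through such a frame [t]. *)
Lemma det_form_mx_lower_bound c e f z (k : R) (U : set X) : atlas c -> holo_frame e -> holo_frame f ->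
  dom c (cinv c z) -> cmap c (cinv c z) = z -> fdom e (cinv c z) -> fdom f (cinv c z) ->
  open U -> U (cinv c z) -> 0 < k ->
  (forall x, U x -> fdom f x -> k%:C <= \det (H f x)) ->
  exists2 d : R, 0 < d & \forall w \near z, d%:C <= \det (H e (cinv c w)).
Proof.
move=> ac he hf dz cz ez fz oU Uz k0 Uk.
have [t tt tz] := triv_cover E (cinv c z).
have [a [a' [a0 _ he']]] := det_change_near ac he tt dz cz ez tz.
have [b' [b [_ b0 hf']]] := det_change_near ac hf tt dz cz fz tz.
(* With [D] the determinant in the frame [t]: [k] is at most [b ^+ 2 * D], and the determinant in
   [e] is at least [a ^+ 2 * D]. *)
exists ((a / b) ^+ 2 * k); first by rewrite mulr_gt0// exprn_gt0// divr_gt0.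
have oV : open (U `&` (fdom e `&` (fdom f `&` fdom t))).
  by do !apply: openI => //; exact: fdom_open.
have nV : \forall w \near z, (cmap c @` (dom c `&` (U `&` (fdom e `&` (fdom f `&` fdom t))))) w.
  apply: open_nbhs_nbhs; split; first exact: open_chart_image.
  by exists (cinv c z).
near=> w.
have Vw : (cmap c @` (dom c `&` (U `&` (fdom e `&` (fdom f `&` fdom t))))) w by near: w.
have [dw [Uw [ew [fw tw]]] _] := cinv_chart_image Vw.
have /andP[a1 _] : a%:C <= `|\det (change_mx (fvec t (cinv c w)) (fvec e (cinv c w)))| <= a'%:C by near: w; exact: he'.
have /andP[_ b1] : b'%:C <= `|\det (change_mx (fvec t (cinv c w)) (fvec f (cinv c w)))| <= b%:C by near: w; exact: hf'.
have bt := fbasis tw.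
set P := \det (change_mx _ _) in a1; set Q := \det (change_mx _ _) in b1.
have kf := Uk _ Uw fw.
rewrite /form_mx (det_gram_change _ _ bt) -/P; rewrite /form_mx (det_gram_change _ _ bt) -/Q in kf.
set D := \det _ in kf *.
have a2 : (a ^+ 2)%:C <= `|P| ^+ 2 by rewrite rmorphXn /= ler_pXn2r// nnegrE// ler0c ltW.
have b2 : `|Q| ^+ 2 <= (b ^+ 2)%:C by rewrite rmorphXn /= ler_pXn2r// nnegrE// ler0c ltW.
have k0' : 0 < k%:C by rewrite realc_gt0.
(* The sign of [D] is read off from the bound by [k > 0]; it is needed to multiply inequalities by
   [D]. *)
have QD : 0 < `|Q| ^+ 2 * D by exact: lt_le_trans kf.
have Q0 : 0 < `|Q| ^+ 2.
  rewrite lt_def exprn_ge0// andbT; apply/eqP => Q0.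
  by move: QD; rewrite Q0 mul0r ltxx.
have D0 : 0 < D by move: QD; rewrite pmulr_rgt0.
have kD : k%:C <= (b ^+ 2)%:C * D by apply: le_trans kf _; rewrite ler_pM2r.
apply: le_trans (_ : (a ^+ 2)%:C * D <= _); last by rewrite ler_pM2r.
rewrite exprMn exprVn -mulrA rmorphM /= ler_pM2l ?realc_gt0 ?exprn_gt0//.
by rewrite rmorphM /= fmorphV ler_pdivrMl ?realc_gt0 ?exprn_gt0.
Unshelve. all: by end_near.
Qed.

End frames.

Lemma bounded_measurable_psh {R : realType} {n : nat} (Omega : set (Cn R n)) (u : Cn R n -> R)
    (K : set 'rV[R]_(n + n)) :
  open Omega -> (forall z, Omega z -> 0 <= u z) -> psh_Cn Omega (fun z => (u z)%:E) ->
  compact K -> K `<=` toC @^-1` Omega -> bounded_measurable K (fun x => (u (toC x))%:C).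
Proof.
move=> oO u0 pu cK KO.
have uE x : K x -> zero_extension Omega u x = u (toC x) by move=> /KO; exact: zero_extensionE.
have [M M0 hM] := locally_bounded_compact (zero_extension_locally_bounded oO pu) cK KO.
split => /=.
- apply: eq_measurable_fun (measurable_funTS (measurable_zero_extension oO u0 pu)).
  by move=> t /set_mem Kt /=; rewrite uE.
- exact: measurable_cst.
- exists M => x Kx; rewrite normr0 M0 ger0_norm ?u0//; last exact: KO.
  by rewrite -uE ?hM.
Qed.

(** * The curvature in a chart and a holomorphic frame *)

Section curvature.
Context {R : realType} {n r : nat} {X : complexManifold R n} {E : holoVectorBundle X r}.
Variables (h : singularMetric E) (h_neg : griffiths_negative h)
  (c : @chart R X n) (e : local_frame r (fib E)) (ac : atlas c) (he : holo_frame e).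

Let Omega := cmap c @` (dom c `&` fdom e).
Let D := @toC R n @^-1` Omega.
Let H z := form_mx (mform h) e (cinv c z).

Let N (lam : R[i]) (i j : 'I_r) (z : Cn R n) : R :=
  norm2 h (fun x => tnth (fvec e x) i + lam *: tnth (fvec e x) j) (cinv c z).

(** Half of [q lam] in [herm_polar], for the frame vectors [j] and [i] in this order, since
    [form_mx] transposes; the terms with [0] are their squared norms. The factor [1] gives the
    nested two-term shape of [weak_partial_lin]. *)
Let comb (lam : R[i]) (i j : 'I_r) (z : Cn R n) : R :=
  2^-1 * N lam j i z + 1 * ((- 2^-1) * N 0 j i z + (- 2^-1) * N 0 i j z).

Let oO : open Omega. Proof. by apply: open_chart_image; exact: fdom_open. Qed.

Let N_ge0 lam i j z : 0 <= N lam i j z.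
Proof.
rewrite /N /norm2; set v := _ + _.
by have := mform_ge0 h v; rewrite lecE => /andP[].
Qed.

Let N_psh lam i j : psh_Cn Omega (fun z => (N lam i j z)%:E).
Proof.
rewrite /Omega setIC.
exact: (h_neg (fdom_open e) (holo_section_linear lam (he i) (he j)) ac).
Qed.

Let HE z i j : H z i j = comb 1 i j z +i* comb (0 +i* 1) i j z.
Proof.
rewrite mxE herm_polar /comb /N /norm2 !scale0r !addr0.
by congr (_ +i* _); rewrite mul1r !mulrDr !mulrN !mulNr -addrA.
Qed.

Let bounded_measurable_H K i j : compact K -> K `<=` D ->
  bounded_measurable K (fun x => H (toC x) i j).
Proof.
move=> cK KD.
have bN lam i' j' : bounded_measurable K (fun x => (N lam i' j' (toC x))%:C).
  exact: (bounded_measurable_psh oO (fun z _ => N_ge0 lam i' j' z) (N_psh lam i' j')).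
have bC (a : R[i]) lam i' j' : bounded_measurable K (fun x => a * (N lam i' j' (toC x))%:C).
  exact: bounded_measurableM (bounded_measurable_cst _ _) (bN _ _ _).
rewrite (_ : (fun x => _) = (fun x =>
  ((2^-1 : R)%:C * (N 1 j i (toC x))%:C +
    ((- 2^-1 : R)%:C * (N 0 j i (toC x))%:C + (- 2^-1 : R)%:C * (N 0 i j (toC x))%:C)) +
  ((0 +i* (2^-1 : R)) * (N (0 +i* 1) j i (toC x))%:C +
    ((0 +i* (- 2^-1 : R)) * (N 0 j i (toC x))%:C + (0 +i* (- 2^-1 : R)) * (N 0 i j (toC x))%:C)))).
  by do !apply: bounded_measurableD; exact: bC.
apply/funext => x; rewrite HE /comb.
by apply/eqP; rewrite eq_complex /=; apply/andP; split; apply/eqP; ring.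
Qed.

Let comb_weak_partials k lam i j :
  exists p, weak_partial D (lshift n k) (comb lam i j \o @toC R n) p.1 /\
    weak_partial D (rshift n k) (comb lam i j \o @toC R n) p.2.
Proof.
have w lam' i' j' := psh_weak_partials oO (fun z _ => N_ge0 lam' i' j' z) (N_psh lam' i' j') k.
have [[a1 h1] [b1 g1]] := w lam j i.
have [[a2 h2] [b2 g2]] := w 0 j i.
have [[a3 h3] [b3 g3]] := w 0 i j.
exists (fun x => 2^-1 * a1 x + 1 * ((- 2^-1) * a2 x + (- 2^-1) * a3 x),
  fun x => 2^-1 * b1 x + 1 * ((- 2^-1) * b2 x + (- 2^-1) * b3 x)); split => /=.
- exact: (weak_partial_lin _ _ h1 (weak_partial_lin _ _ h2 h3)).
- exact: (weak_partial_lin _ _ g1 (weak_partial_lin _ _ g2 g3)).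
Qed.

Let distr_dz_H k i j : exists v, distr_dz Omega k (fun z => H z i j) v.
Proof.
have [[a b] [ha hb]] := comb_weak_partials k 1 i j.
have [[a' b'] [ha' hb']] := comb_weak_partials k (0 +i* 1) i j.
have ReE : (fun x => complex.Re (H (toC x) i j)) = comb 1 i j \o @toC R n.
  by apply/funext => x; rewrite HE.
have ImE : (fun x => complex.Im (H (toC x) i j)) = comb (0 +i* 1) i j \o @toC R n.
  by apply/funext => x; rewrite HE.
eexists; apply: distr_dz_of_weak_partials; rewrite ?ReE ?ImE; [exact: ha|exact: hb|exact: ha'|exact: hb'].
Qed.

Hypothesis det_lb : forall z, Omega z ->
  exists2 d : R, 0 < d & \forall w \near z, d%:C <= \det (H w).

Let det_compact K : compact K -> K `<=` D ->
  exists2 d : R, 0 < d & forall x, K x -> d%:C <= \det (H (toC x)).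
Proof.
move=> cK KD.
(* Local lower bounds for the determinant are local upper bounds for its inverse, so
   [locally_bounded_compact] makes them uniform. *)
pose g x := (complex.Re (\det (H (toC x))))^-1.
have lb x : D x -> exists s M : R, 0 < s /\ forall y, box x s y -> g y <= M.
  move=> Dx; have [d d0 hd] := det_lb Dx.
  have [s s0 hs] := nbhs_boxP (toC_near hd).
  exists s, d^-1; split => // y /hs /=; rewrite lecE => /andP[_ /= dH].
  by rewrite /g lef_pV2 ?posrE// (lt_le_trans d0).
have [M M0 hM] := locally_bounded_compact lb cK KD.
(* [M] may be 0, so it is raised by 1 before inversion. *)
exists (M + 1)^-1; first by rewrite invr_gt0 ltr_wpDl.
move=> x Kx; have [d d0 /nbhs_singleton] := det_lb (KD _ Kx).
rewrite !lecE => /andP[im0 /= dH]; apply/andP; split => //=.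
have r0 : 0 < complex.Re (\det (H (toC x))) by exact: lt_le_trans dH.
rewrite -[leRHS]invrK lef_pV2 ?posrE ?invr_gt0// ?ltr_wpDl//.
by apply: le_trans (hM _ Kx) _; rewrite lerDl.
Qed.

Lemma curvature_in_chart :
  exists G : 'I_n -> Cn R n -> 'M[R[i]]_r,
    let theta k z := invmx (H z) *m G k z in
    [/\ forall k i j, distr_dz Omega k (fun z => H z i j) (fun z => G k z i j),
        forall k i j, cL1loc (toC @^-1` Omega) (fun x => theta k (toC x) i j) &
        exists Theta : 'I_n -> 'I_n -> 'I_r -> 'I_r ->
            ('rV[R]_(n + n) -> R) -> R[i],
          forall l k i j,
            distr_dzbar Omega l (fun z => theta k z i j) (Theta l k i j)].
Proof.
pose G k z : 'M[R[i]]_r := \matrix_(i, j) projT1 (cid (distr_dz_H k i j)) z.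
have GE k i j : (fun z => G k z i j) = projT1 (cid (distr_dz_H k i j)).
  by apply/funext => z; rewrite mxE.
have hG k i j : distr_dz Omega k (fun z => H z i j) (fun z => G k z i j).
  by rewrite GE; exact: (projT2 (cid (distr_dz_H k i j))).
exists G => theta.
have Ltheta k i j : cL1loc D (fun x => theta k (toC x) i j).
  suff hK K : compact K -> K `<=` D -> complex_integrable K (fun x => theta k (toC x) i j).
    by split => K cK KD; have [] := hK K cK KD.
  move=> cK KD; have mK := measurable_row_compact cK.
  have [d d0 hd] := det_compact cK KD.
  apply: (@complex_integrable_invmx_mul R (n + n) K mK r (fun x => H (toC x)) (fun x => G k (toC x))
    (fun x => complex.Re (\det (H (toC x)))) d d0).
  (* The order of [R[i]] compares only numbers with equal imaginary parts, so the lower bound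
     already says that the determinant is real. *)
  - move=> x Kx; have := hd x Kx; rewrite lecE => /andP[/= /eqP im0 ->]; split => //.
    by case: (\det _) im0 => a b /= ->.
  - by move=> i' j'; exact: bounded_measurable_H.
  - by move=> i' j'; have [_ [L1 L2] _] := hG k i' j'; split; [exact: L1|exact: L2].
split => //.
exists (fun l k i j phi => - cint (fun x => theta k (toC x) i j * d_dzbar l phi x)) => l k i j.
exact: (distr_dzbar_exists l (Ltheta k i j)).
Qed.

End curvature.

Local Close Scope complex_scope.

Theorem corollary1p5 (R : realType) (n r : nat) (X : complexManifold R n)
  (E : holoVectorBundle X r) (h : singularMetric E)
  (h_neg : griffiths_negative h)
  (F_closed : closed (degeneracy_set h))
  (frames : set (local_frame r (fib E)))
  (frames_holo : forall e, frames e -> holo_frame e)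
  (frames_cover : forall x : X, exists2 e, frames e & fdom e x)
  (U : nat -> set X)
  (U_open : forall j, (1 <= j)%N -> open (U j))
  (U_mono : forall j, (1 <= j)%N -> U j `<=` U j.+1)
  (U_cover : \bigcup_(j in [set j | (1 <= j)%N]) U j = ~` degeneracy_set h)
  (U_det : forall j, (1 <= j)%N -> forall x, U j x ->
     forall e, frames e -> fdom e x ->
       j%:R^-1 < \det (form_mx (mform h) e x)) :
  curvature_exists_on h (~` degeneracy_set h).
Proof.
move=> c e ac he eV; apply: (curvature_in_chart h_neg ac he) => z Oz.
have [dz ez cz] := cinv_chart_image Oz.
have [j j1 Uz] : (\bigcup_(j in [set j | (1 <= j)%N]) U j) (cinv c z).
  by rewrite U_cover; exact: eV.
have [f ff fz] := frames_cover (cinv c z).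
(* The hypothesis bounds the determinant in the frame [f] of [frames], near the point, with a fixed
   [j]; the lemma carries the bound over to the arbitrary frame [e]. *)
apply: (det_form_mx_lower_bound (k := j%:R^-1) ac he (frames_holo _ ff) dz cz ez fz (U_open j j1) Uz).
  by rewrite invr_gt0 ltr0n.
move=> x Ux fx; rewrite fmorphV rmorph_nat; apply: ltW; exact: U_det.
Qed.
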